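(* Let $n\ge2$ and let $\Omega\subset\mathbb{R}^n$ be a nonempty bounded domain, with weight $\omega$ associated with a fixed family of paths $\gamma$ as described in the context. Let $(Q_j)_{j\ge0}$ be the Whitney decomposition of $\Omega$ described in the context. Let $p\in(1,+\infty)$ and $f\in L^p_0(\Omega)$. Then $f$ can be decomposed as $$f=\sum_jf_j,$$ where, for all $j$, the function $f_j$ satisfies the following three properties: (i) $f_j$ is supported in $2Q_j$; (ii) $\int_{2Q_j}f_j(x)\,dx=0$; (iii) $\displaystyle\sum_j\int_{2Q_j}|f_j(x)|^p\left(\frac{d^n(x)}{\omega(x)}\right)^pdx\leq C\int_\Omega|f(x)|^p\,dx$, for some $C>0$ only depending on $\Omega$, $p$ and the choice of the paths $\gamma$. If one furthermore assumes that there exists $C>0$ such that the weight $\omega$ satisfies $\omega(x)\leq C\,d^n(x)$ for almost all $x\in\Omega$, then the conclusion of (iii) can be strengthened as $$C^{-1}\int_\Omega|f(x)|^p\,dx\leq\sum_j\int_{2Q_j}|f_j(x)|^p\,dx\leq C\int_\Omega|f(x)|^p\,dx.$$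
   Context: A domain is a connected open set. $L^p_0(\Omega)$ is the subspace of $L^p(\Omega)$ of functions with zero integral over $\Omega$. For $x\in\Omega$, $d(x)$ is the distance from $x$ to $\partial\Omega$. For $x,y\in\Omega$, $\mathrm{dist}_\Omega(y,x)$ is the infimum of the lengths of rectifiable paths in $\Omega$ joining $y$ to $x$. A reference point $x_0\in\Omega$ is fixed and $d_\Omega(y):=\mathrm{dist}_\Omega(y,x_0)$. For $s>0$, $\Omega_s=\{z\in\Omega;\ d(z)>s\}$. The length of a path is denoted by $l(\cdot)$, and the image of a path is denoted by the same letter as the path. A family of paths $\gamma=\{\gamma(y);\ y\in\Omega\}$ is fixed, where for each $y\in\Omega$, $\gamma(y)$ is a path $t\in[0,1]\mapsto\gamma(t,y)$, with the following properties: $(\gamma.a)$ for all $y\in\Omega$ and $t\in[0,1]$, $\gamma(t,y)\in\Omega$, with $\gamma(0,y)=y$ and $\gamma(1,y)=x_0$; $(\gamma.b)$ $(t,y)\mapsto\gamma(t,y)$ is measurable and $\gamma(y)$ is rectifiable; $(\gamma.c)$ there exists a constant $C>0$, only depending on the dimension, such that for all $x,y\in\Omega$: $l(\gamma(y)\cap B(x,r))\leq Cr$ for all $r\leq\frac12 d(x)$, and $l(\gamma(y))\leq C\,d_\Omega(y)$; $(\gamma.d)$ for all $\varepsilon>0$ small enough there exists $\delta>0$ such that $\gamma(y)\subset\Omega_\delta$ for all $y\in\Omega_\varepsilon$. The weight associated with $\gamma$ is $$\omega(x)=\left|\left\{y\in\Omega;\ \mathrm{dist}_\Omega(\gamma(y),x)\leq\tfrac12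 d(x)\right\}\right|,\qquad x\in\Omega,$$ where $\mathrm{dist}_\Omega(\gamma(y),x)$ is the distance in $\Omega$ from the path $\gamma(y)$ to the point $x$ and $|\cdot|$ is Lebesgue measure. Whitney decomposition: $\Omega=\bigcup_{j\geq0}Q_j$, where the $Q_j$ are closed cubes with pairwise disjoint interiors such that for all $j\geq0$, $2Q_j\subset\Omega$ while $4Q_j\cap\Omega^c\neq\emptyset$ ($\lambda Q_j$ is the cube with the same center as $Q_j$ and side length multiplied by $\lambda$); $x_0$ is the center of $Q_0$. *)

(* Defs.v *)
From HB Require Import structures.
From mathcomp Require Import all_boot all_order all_algebra.
From mathcomp Require Import all_classical all_reals all_analysis.

Set Implicit Arguments.
Unset Strict Implicit.
Unset Printing Implicit Defensive.

Import Order.TTheory GRing.Theory Num.Theory.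
Import numFieldNormedType.Exports.

Local Open Scope classical_set_scope.
Local Open Scope ring_scope.

Section lebesgue_outer_measure.
Variables (R : realType) (n : nat).
Local Open Scope ereal_scope.

Definition box (b : 'rV[R]_n * 'rV[R]_n) : set 'rV[R]_n :=
  [set x | forall i, b.1 ord0 i <= x ord0 i <= b.2 ord0 i]%R.

Definition box_volume (b : 'rV[R]_n * 'rV[R]_n) : R :=
  (\prod_(i < n) Num.max 0 (b.2 ord0 i - b.1 ord0 i))%R.

Definition box_cover (A : set 'rV[R]_n) : set (set ('rV[R]_n * 'rV[R]_n)) :=
  [set S | countable S /\ A `<=` \bigcup_(b in S) box b].

Definition lebesgue_outer (A : set 'rV[R]_n) : \bar R :=
  ereal_inf [set \esum_(b in S) (box_volume b)%:E | S in box_cover A].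

Lemma box_volume_ge0 b : 0 <= (box_volume b)%:E.
Proof. by rewrite lee_fin prodr_ge0// => i _; rewrite le_max lexx. Qed.

Lemma lebesgue_outer_ge0 A : 0 <= lebesgue_outer A.
Proof.
apply: le_ereal_inf_tmp => _ [S _ <-].
by apply: esum_ge0 => b _; exact: box_volume_ge0.
Qed.

Lemma lebesgue_outer0 : lebesgue_outer set0 = 0.
Proof.
apply/eqP; rewrite eq_le lebesgue_outer_ge0 andbT.
apply: ereal_inf_lbound; exists set0; last exact: esum_set0.
by split; [exact: countable0 | exact: sub0set].
Qed.

Lemma le_lebesgue_outer :
  {homo lebesgue_outer : A B / A `<=` B >-> A <= B}.
Proof.
move=> A B AB; apply: ereal_inf_le_tmp => _ [S [cS BS] <-].
by exists S => //; split => //; exact: subset_trans BS.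
Qed.

Lemma lebesgue_outer_sigma_subadditive : sigma_subadditive lebesgue_outer.
Proof.
move=> A; have [[i ioo]|] := pselect (exists i, lebesgue_outer (A i) = +oo).
  rewrite (eseries_pinfty _ _ ioo) ?leey// => k _.
  by rewrite -ltNye (lt_le_trans _ (lebesgue_outer_ge0 _)).
rewrite -forallNE => Aoo.
apply/lee_addgt0Pr => e e0.
rewrite (le_trans _ (epsilon_trick _ _ (ltW e0)))//; last first.
  by move=> k; exact: lebesgue_outer_ge0.
pose P k S := box_cover (A k) S /\
  \esum_(b in S) (box_volume b)%:E <=
    lebesgue_outer (A k) + (e / (2 ^ k.+1)%:R)%:E.
have [G PG] : {G : nat -> set _ & forall k, P k (G k)}.
  apply: (@choice _ _ P) => k; rewrite /P.
  have Afin : lebesgue_outer (A k) \is a fin_num.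
    by rewrite ge0_fin_numE ?lebesgue_outer_ge0// ltey; apply/eqP/Aoo.
  have ek : (0 < e / (2 ^ k.+1)%:R)%R by rewrite divr_gt0// ltr0n expn_gt0.
  have [_ [S cS <-] /ltW le] := lb_ereal_inf_adherent ek Afin.
  by exists S.
apply: (@le_trans _ _ (\esum_(b in \bigcup_k G k) (box_volume b)%:E)).
  apply: ereal_inf_lbound; exists (\bigcup_k G k) => //; split.
    by apply: bigcup_countable => // k _; exact: (PG k).1.1.
  move=> x [k _ /((PG k).1.2) [b Gb xb]].
  by exists b => //; exists k.
rewrite seqDU_bigcup_eq esum_bigcupT; last 2 first.
- exact: trivIset_seqDU.
- by move=> b; exact: box_volume_ge0.
rewrite nneseries_esumT; last first.
  by move=> k; rewrite adde_ge0 ?lebesgue_outer_ge0// lee_fin divr_ge0// ltW.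
apply: le_esum => k _; apply: le_trans (PG k).2.
rewrite (esum_mkcond (seqDU G k)) (esum_mkcond (G k)).
apply: le_esum => b _; case: ifPn => [/set_mem bk|_].
  by rewrite mem_set//; exact: (@subset_seqDU _ G k).
by case: ifPn => // _; exact: box_volume_ge0.
Qed.

HB.instance Definition _ := isOuterMeasure.Build R 'rV[R]_n lebesgue_outer
  lebesgue_outer0 lebesgue_outer_ge0 le_lebesgue_outer
  lebesgue_outer_sigma_subadditive.

End lebesgue_outer_measure.
Definition lebesgue_outer_measure (R : realType) (n : nat) :
  {outer_measure set 'rV[R]_n -> \bar R} := @lebesgue_outer R n.

(* R^n with the sigma-algebra of Lebesgue (not only Borel) measurable sets *)
Notation Rn R n := (caratheodory_type (lebesgue_outer_measure R n)).

Definition leb {R : realType} {n : nat} : {measure set (Rn R n) -> \bar R} :=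
  (lebesgue_outer_measure R n : set (Rn R n) -> \bar R).

Section domain.
Variables (R : realType) (n : nat).
Implicit Types (Omega A : set 'rV[R]_n) (x y z : 'rV[R]_n).

(* The library norm on 'rV[R]_n is the sup norm; it induces the same topology
   and the same bounded sets. *)
Definition enorm x : R := Num.sqrt (\sum_(i < n) x ord0 i ^+ 2).

Definition eball x (r : R) : set 'rV[R]_n := [set z | enorm (z - x) < r].

(* A cube of side s, with sides parallel to the axes *)
Definition cube (c : 'rV[R]_n) (s : R) : set 'rV[R]_n :=
  [set x | forall i, `|x ord0 i - c ord0 i| <= s / 2].

Definition bdist Omega x : R :=
  inf [set enorm (x - z) | z in closure Omega `\` Omega°].

Definition inner Omega (s : R) : set 'rV[R]_n :=
  [set z | Omega z /\ bdist Omega z > s].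

Definition path_in Omega (g : R -> 'rV[R]_n) y x :=
  [/\ {within `[0, 1], continuous g},
      (forall t, t \in `[0, 1] -> Omega (g t)), g 0 = y & g 1 = x].

(* Length, counted with multiplicity, of the part of the path g lying in A:
   only the steps of the subdivision along which g stays in A are counted.
   For A open this is the total length of g over the (relatively open) set of
   parameters t such that g t is in A. *)
Definition length_in (g : R -> 'rV[R]_n) A : \bar R :=
  ereal_sup [set l | exists (k : nat) (t : nat -> R),
    [/\ 0 <= t 0%N, t k <= 1, {homo t : i j / (i <= j)%N >-> i <= j} &
        l = (\sum_(i < k | `[< g @` `[t i, t i.+1] `<=` A >])
               enorm (g (t i.+1) - g (t i)))%:E]].

Definition path_length (g : R -> 'rV[R]_n) : \bar R := length_in g setT.

Definition rectifiable (g : R -> 'rV[R]_n) := (path_length g < +oo)%E.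

Definition gdist Omega y x : \bar R :=
  ereal_inf [set path_length g | g in
    [set g | path_in Omega g y x /\ rectifiable g]].

Definition gdist_path Omega (g : R -> 'rV[R]_n) x : \bar R :=
  ereal_inf [set gdist Omega z x | z in g @` `[0, 1]].

(* gamma t y is the point of parameter t of the path starting at y. Since each
   path is continuous in t, measurability for the product of the Borel sets of
   R and the Lebesgue sets of R^n amounts to Lebesgue measurability in
   (t, y). *)
Definition path_family Omega (x0 : 'rV[R]_n) (gamma : R -> 'rV[R]_n -> 'rV[R]_n)
    : Prop :=
  [/\ forall y, Omega y -> path_in Omega (gamma ^~ y) y x0,
      (forall U : set 'rV[R]_n, open U ->
         measurable ((`[0, 1] `*` Omega) `&`
           [set u | U (gamma u.1 u.2)] : set (measurableTypeR R * Rn R n))) /\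
      (forall y, Omega y -> rectifiable (gamma ^~ y)),
      exists2 C : R, 0 < C & forall x y, Omega x -> Omega y ->
        (forall r : R, 0 < r -> r <= bdist Omega x / 2 ->
           (length_in (gamma ^~ y) (eball x r) <= (C * r)%:E)%E) /\
        (path_length (gamma ^~ y) <= C%:E * gdist Omega y x0)%E &
      \forall e \near 0^'+, exists2 delta : R, 0 < delta &
        forall y, inner Omega e y ->
          (gamma ^~ y) @` `[0, 1] `<=` inner Omega delta].

(* The set has measure at most |Omega|, so nothing is lost by [fine] when
   Omega is bounded. *)
Definition weight Omega (gamma : R -> 'rV[R]_n -> 'rV[R]_n) x : R :=
  fine (leb [set y | Omega y /\
    (gdist_path Omega (gamma ^~ y) x <= (bdist Omega x / 2)%:E)%E]).

(* Q_j is the cube of center c j and side s j. *)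
Definition whitney Omega (x0 : 'rV[R]_n) (c : nat -> 'rV[R]_n) (s : nat -> R)
    : Prop :=
  [/\ forall j, 0 < s j,
      Omega = \bigcup_j cube (c j) (s j),
      forall j k, j != k ->
        (cube (c j) (s j))° `&` (cube (c k) (s k))° = set0,
      forall j, cube (c j) (2 * s j) `<=` Omega /\
        cube (c j) (4 * s j) `&` ~` Omega !=set0 &
      c 0%N = x0].

Definition Lp0 (Omega : set (Rn R n)) (p : R) (f : Rn R n -> R) : Prop :=
  [/\ measurable_fun Omega f,
      (\int[leb]_(x in Omega) (`|f x| `^ p)%:E < +oo)%E &
      (\int[leb]_(x in Omega) (f x)%:E = 0)%E].

End domain.

(* Main.v *)
(* Cut the Whitney cubes into small cells and carry the mass of each [y] to [x0]
   from cell to cell along [gamma y], loops erased. This is a flow between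
   neighbouring cells in which the mass [M k] through cell [k] is at most the
   weight there. Given [g] with cell averages [a k], let the flow carry the
   well-mixed value [A k], where [M k A k = v k a k + sum_l m l k A l] and [v k]
   is the volume of the cell; Young's inequality gives the Hardy-type bound
   [sum v A^p <= C sum v |a|^p]. Grouping by Whitney cube the local oscillations
   of [g] and the elementary exchanges between neighbouring cells decomposes [g]
   up to a small [L^p] error, and iterating on the error gives the series. The
   converse inequality in the last assertion is the bounded overlap of the cubes
   [3/2 Q_j]. *)
Require Import Defs.
From HB Require Import structures.
From mathcomp Require Import all_boot all_order all_algebra.
From mathcomp Require Import all_classical all_reals all_analysis.
From mathcomp Require Import measurable_realfun.
From mathcomp Require Import ring lra.

Set Implicit Arguments.
Unset Strict Implicit.
Unset Printing Implicit Defensive.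

Import Order.TTheory GRing.Theory Num.Theory.
Import numFieldNormedType.Exports.

Local Open Scope classical_set_scope.
Local Open Scope ring_scope.

(** * Lebesgue measure of boxes and cubes *)

(** Mixing makes the estimate local: what leaves cell [k] is its throughput times a single value, so
    the exchanges charged to it are at most [2 * (wt k * A k)], and the factor cell volume over
    [wt k] reduces this to volume times [2 * A k]. Loops are erased because the weight counts a
    starting point once, however often its path returns to a cell. The balance equations are solved
    by linear algebra: each cell injects its own positive volume, which gives a minimum principle,
    hence invertibility, monotonicity and bounds free of the size of the graph. The obstacle is
    finiteness. There are infinitely many cells, and the number of time samples that makes
    consecutive cells neighbours depends on the starting point. A set of starting points of small
    measure [eta] is therefore dropped; its mass stays in place as [lost] and produces an error
    controlled by [eta] and the maximum of the cell averages. That maximum is known only after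
    cutting [g] off to finitely many cells, so [eta] is chosen last. All remaining mass piles up in
    the cell of [x0], and there the zero mean of [g] makes it small. *)

Section lebesgue_box.
Variables (R : realType).
Local Open Scope ereal_scope.

(** Cavalieri in place of compactness: the slice at height [t] is covered by the slices of the boxes
    whose last interval contains [t], and integration in [t] multiplies each volume by the last
    side. Indexing coordinates by [nat] keeps the types fixed in the induction; [K] lets the family
    shrink with the slice. *)
Lemma prod_le_cover (n : nat) (a b : nat -> R) (lo hi : nat -> nat -> R)
    (K : set nat) :
  (forall i, a i <= b i)%R ->
  (forall x : nat -> R, (forall i, (i < n)%N -> a i <= x i <= b i)%R ->
     exists2 k, K k & forall i, (i < n)%N -> (lo k i <= x i <= hi k i)%R) ->
  (\prod_(i < n) (b i - a i))%:E <=
  \sum_(k <oo) (\1_K k * \prod_(i < n) Num.max 0 (hi k i - lo k i))%:E.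
Proof.
move=> ab; elim: n K => [|n IH] K cov.
  (* In dimension 0 every box has volume 1, and the cover contains at least one box. *)
  have [//|k Kk _] := cov a.
  rewrite big_ord0; under eq_eseriesr do rewrite big_ord0.
  have u0 m : (0 <= m)%N -> true -> 0 <= (\1_K m * 1 : R)%:E.
    by move=> _ _; rewrite lee_fin mulr1 indicE.
  apply: le_trans (@nneseries_lim_ge R _ xpredT 0%N k.+1 u0).
  rewrite big_mkord big_ord_recr/= [in X in _ <= _ + X]indicE mem_set// mulr1 leeDr//.
  by apply: sume_ge0 => i _; exact: u0.
pose vol k : R := (\prod_(i < n) Num.max 0 (hi k i - lo k i))%R.
have vol0 k : (0 <= vol k)%R.
  by apply: prodr_ge0 => i _; rewrite le_max lexx.
pose I k : set R := [set` `[lo k n, hi k n]%R].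
pose f k (t : R) : \bar R := (\1_K k * vol k * \1_(I k) t)%:E.
have f0 k t : 0 <= f k t by rewrite lee_fin !mulr_ge0// indicE.
have mf k (D : set R) : measurable_fun D (f k).
  apply/measurable_EFinP; apply: measurable_funM => //.
  by apply: measurable_indic; exact: measurable_itv.
have slice t : t \in `[a n, b n]%R ->
    (\prod_(i < n) (b i - a i))%:E <= \sum_(k <oo) f k t.
  rewrite in_itv/= => tab.
  apply: le_trans (IH (K `&` [set k | I k t]) _) _.
    move=> x xab.
    have [i|k Kk xk] := cov (fun i => if i == n then t else x i).
      by rewrite ltnS leq_eqVlt; case: eqVneq => [->//|_ /xab].
    exists k.
      split => //=; have := xk n (ltnSn n).
      by rewrite eqxx /I/= in_itv.
    by move=> i ilt; have := xk i (ltnW ilt); rewrite (ltn_eqF ilt).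
  apply: lee_nneseries => [k _ _|k _].
    by rewrite lee_fin; apply: mulr_ge0 => //; exact: vol0.
  rewrite lee_fin -/(vol k) mulrAC ler_wpM2r//.
  rewrite !indicE; case: (boolP (k \in _ `&` _)) => [|_].
    by rewrite inE => -[Kk Ik]; rewrite !mem_set//= mulr1.
  exact: mulr_ge0.
have -> : (\prod_(i < n.+1) (b i - a i))%:E =
    \int[lebesgue_measure]_(t in `[a n, b n]) (\prod_(i < n) (b i - a i))%:E.
  rewrite integral_cst//= lebesgue_measure_itv/= big_ord_recr/= lte_fin.
  have := ab n; rewrite le_eqVlt => /predU1P[->|->].
    by rewrite subrr ltxx mulr0 mule0.
  by rewrite EFinM.
apply: (@le_trans _ _
   (\int[lebesgue_measure]_(t in `[a n, b n]) \sum_(k <oo) f k t)).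
  apply: ge0_le_integral => //.
  - by move=> t _; rewrite lee_fin prodr_ge0// => i _; rewrite subr_ge0.
  - by apply: (@ge0_emeasurable_sum _ _ _ _ f xpredT).
rewrite (@integral_nneseries _ _ _ lebesgue_measure _ _ f)//; last by move=> k; exact: mf.
apply: lee_nneseries => [k _ _|k _].
  by apply: integral_ge0 => t _.
rewrite /f; under eq_integral do rewrite EFinM.
rewrite ge0_integralZl_EFin//; last 2 first.
- by apply/measurable_EFinP; apply: measurable_indic; exact: measurable_itv.
- exact: mulr_ge0.
rewrite big_ord_recr/= mulrA [leRHS]EFinM lee_pmul//.
- by rewrite lee_fin mulr_ge0.
- exact: integral_ge0.
rewrite integral_indic//; last exact: measurable_itv.
apply: (@le_trans _ _ (lebesgue_measure (I k))).
  apply: le_measure => //; rewrite inE; last exact: measurable_itv.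
  by apply: measurableI; exact: measurable_itv.
rewrite /I lebesgue_measure_itv/= lte_fin; case: ltP => // h.
  by rewrite -EFinB lee_fin le_max lexx orbT.
by rewrite lee_fin le_max lexx.
Qed.

Lemma esum_countableE (T : pointedType) (S : set T) (a : T -> \bar R) :
  countable S -> (forall b, S b -> 0 <= a b) ->
  exists f : T -> nat, exists g : nat -> T, [/\ forall b, S b -> g (f b) = b,
    forall k, (f @` S) k -> S (g k) &
    \esum_(b in S) a b = \sum_(k <oo | k \in f @` S) a (g k)].
Proof.
move=> cS a0; have [f injf] := countable_injP _ cS.
pose g k : T := xget point [set b | S b /\ f b = k].
have gf b : S b -> g (f b) = b.
  move=> Sb; rewrite /g; case: xgetP => [_ -> [Sc fc]|/(_ b)/=].
    by apply: injf; rewrite ?inE.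
  by case.
exists f, g; split => //; first by move=> _ [b Sb <-]; rewrite gf.
rewrite nneseries_esum; last by move=> k /set_mem[b Sb <-]; rewrite gf//; exact: a0.
rewrite set_mem_set (esum_image S f)//.
by apply: eq_esum => b Sb; rewrite gf.
Qed.

Lemma lebesgue_outer_ge_box (n : nat) (B : 'rV[R]_n * 'rV[R]_n) :
  (forall i, B.1 ord0 i <= B.2 ord0 i)%R ->
  (\prod_(i < n) (B.2 ord0 i - B.1 ord0 i))%:E <= lebesgue_outer (box B).
Proof.
move=> B12; apply: le_ereal_inf_tmp => _ [S [cS BS] <-].
have [f [g [gf fg ->]]] := @esum_countableE _ S (fun b => (box_volume b)%:E) cS
  (fun b _ => box_volume_ge0 b).
(* Dimension 0 is separate because [inord], used below to extend vectors to sequences, needs an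
   inhabited ordinal type. *)
case: n => [|n] in B B12 S cS BS f g gf fg *.
  have : box B (const_mx 0%R) by case.
  move=> /BS[b Sb _]; rewrite big_ord0.
  have u0 m : (0 <= m)%N -> m \in f @` S -> 0 <= (box_volume (g m))%:E.
    by move=> _ _; exact: box_volume_ge0.
  apply: le_trans (@nneseries_lim_ge R _ _ 0%N (f b).+1 u0).
  rewrite big_mkcond big_nat_recr//= mem_set; last by exists b.
  rewrite {2}/box_volume big_ord0 leeDr// sume_ge0// => i _.
  by case: ifP => // _; exact: box_volume_ge0.
pose ext (x : 'rV[R]_n.+1) (i : nat) : R := x ord0 (inord i).
have := @prod_le_cover n.+1 (ext B.1) (ext B.2) (fun k => ext (g k).1)
  (fun k => ext (g k).2) (f @` S).
rewrite /ext; under eq_bigr do rewrite inord_val.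
move=> /(_ (fun i => B12 _)) H; apply: le_trans (H _) _ => [x xB|].
  pose y : 'rV[R]_n.+1 := \row_i x i.
  have /BS[b Sb yb] : box B y.
    by move=> i; rewrite mxE; have := xB i (ltn_ord i); rewrite inord_val.
  exists (f b); first by exists b.
  by move=> i ilt; have := yb (inord i); rewrite gf// mxE inordK.
rewrite [leRHS]eseries_mkcond.
apply: lee_nneseries => [k _ _|k _].
  rewrite lee_fin mulr_ge0 ?indicE// prodr_ge0// => i _.
  by rewrite le_max lexx.
rewrite indicE; case: ifP => _ /=; last by rewrite mul0r.
rewrite mul1r lee_fin /box_volume.
by under eq_bigr do rewrite inord_val.
Qed.

Lemma lebesgue_outer_box (n : nat) (B : 'rV[R]_n * 'rV[R]_n) :
  (forall i, B.1 ord0 i <= B.2 ord0 i)%R ->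
  lebesgue_outer (box B) = (\prod_(i < n) (B.2 ord0 i - B.1 ord0 i))%:E.
Proof.
move=> B12; apply/eqP; rewrite eq_le lebesgue_outer_ge_box// andbT.
apply: ereal_inf_lbound; exists [set B].
  by split; [exact: countable1|move=> x Bx; exists B].
rewrite esum_set1 ?box_volume_ge0//; congr (_%:E); apply: eq_bigr => i _.
by apply/max_idPr; rewrite subr_ge0.
Qed.

Lemma lebesgue_outer_le_box (n : nat) (B : 'rV[R]_n * 'rV[R]_n) :
  lebesgue_outer (box B) <= (box_volume B)%:E.
Proof.
apply: ereal_inf_lbound; exists [set B].
  by split; [exact: countable1|move=> x Bx; exists B].
by rewrite esum_set1// box_volume_ge0.
Qed.

(** The sum runs over [S] and not over the image of [h]: truncating boxes is not injective, and the
    volumes have to be added box by box. *)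
Lemma lebesgue_outer_le_image (n : nat) (X : set 'rV[R]_n) S
    (h : 'rV[R]_n * 'rV[R]_n -> 'rV[R]_n * 'rV[R]_n) :
  countable S -> X `<=` \bigcup_(b in S) box (h b) ->
  lebesgue_outer X <= \esum_(b in S) (box_volume (h b))%:E.
Proof.
move=> cS XS.
have [f [g [gf fg ->]]] := @esum_countableE _ S (fun b => (box_volume (h b))%:E) cS
  (fun b _ => box_volume_ge0 (h b)).
pose A k : set 'rV[R]_n := if k \in f @` S then box (h (g k)) else set0.
apply: (@le_trans _ _ (lebesgue_outer (\bigcup_k A k))).
  apply: le_lebesgue_outer => x /XS[b Sb hx].
  by exists (f b) => //; rewrite /A mem_set ?gf//; exists b.
apply: le_trans (lebesgue_outer_sigma_subadditive _) _.
rewrite [leRHS]eseries_mkcond; apply: lee_nneseries => [k _ _|k _].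
  exact: lebesgue_outer_ge0.
rewrite /A; case: ifP => _; first exact: lebesgue_outer_le_box.
by rewrite lebesgue_outer0.
Qed.

End lebesgue_box.

(** * Measurability and volume of half-spaces, cubes and their preimages *)

Section lebesgue_measurable.
Variables (R : realType) (n : nat).

Let upd (x : 'rV[R]_n) (i : 'I_n) (r : R) : 'rV[R]_n :=
  \row_k if k == i then r else x ord0 k.

(** Carathéodory's criterion: the hyperplane cuts each box of a cover into two boxes whose volumes
    add up, so a cover of [X] yields covers of both parts at the same total cost. If the hyperplane
    misses a box, one half has volume 0 thanks to [Num.max 0]. *)
Lemma measurable_halfspace (i : 'I_n) (r : R) :
  measurable ([set x | x ord0 i <= r] : set (Rn R n)).
Proof.
apply: le_caratheodory_measurable => X.
apply: le_ereal_inf_tmp => _ [S [cS XS] <-].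
pose h1 (b : 'rV[R]_n * 'rV[R]_n) := (b.1, upd b.2 i (Num.min r (b.2 ord0 i))).
pose h2 (b : 'rV[R]_n * 'rV[R]_n) := (upd b.1 i (Num.max r (b.1 ord0 i)), b.2).
have vol b : box_volume b = box_volume (h1 b) + box_volume (h2 b).
  have volE B : box_volume B = Num.max 0 (B.2 ord0 i - B.1 ord0 i) *
      \prod_(j < n | j != i) Num.max 0 (B.2 ord0 j - B.1 ord0 j).
    by rewrite /box_volume (bigD1 i).
  rewrite !volE /= !mxE !eqxx.
  set P := (\prod_(j < n | _) _ in LHS).
  have -> : (\prod_(j < n | j != i) Num.max 0 ((upd b.2 i (Num.min r (b.2 ord0 i))) ord0 j - b.1
    ord0 j)) = P.
    by apply: eq_bigr => j ji; rewrite mxE (negbTE ji).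
  have -> : (\prod_(j < n | j != i) Num.max 0 (b.2 ord0 j - upd b.1 i (Num.max r (b.1 ord0 i))
    ord0 j)) = P.
    by apply: eq_bigr => j ji; rewrite mxE (negbTE ji).
  rewrite -mulrDl; congr (_ * _).
  move: (b.1 ord0 i) (b.2 ord0 i) => u v.
  rewrite /Num.max /Num.min; do !case: ifPn; rewrite -?leNgt; lra.
under eq_esum do rewrite vol EFinD.
rewrite esumD; try by move=> b _; exact: box_volume_ge0.
apply: leeD; apply: lebesgue_outer_le_image => // x [/XS[b Sb bx]] /=.
  move=> xr; exists b => // j; rewrite /h1 /= mxE; have := bx j.
  by case: eqP => [->|//]; rewrite le_min xr => /andP[-> ->].
move=> /negP; rewrite -ltNge => xr; exists b => // j; rewrite /h2 /= mxE; have := bx j.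
by case: eqP => [->|//]; rewrite ge_max (ltW xr) => /andP[-> ->].
Qed.

Lemma measurable_coord (i : 'I_n) (D : set (Rn R n)) :
  measurable_fun D (fun x : Rn R n => x ord0 i : R).
Proof.
apply: measurable_funTS => mT.
apply: (measurability _ (RGenOInfty.measurableE R)) => // _ [_ [r ->] <-].
rewrite setTI (_ : _ @^-1` _ = ~` [set x : 'rV[R]_n | x ord0 i <= r]).
  exact/measurableC/measurable_halfspace.
by apply/seteqP; split => x /=; rewrite in_itv/= andbT ltNge => /negP.
Qed.

(** A general [h] is needed for the positions [gamma r y] at a fixed time; the identity gives the
    cubes themselves. *)
Lemma measurable_cube_preimage d (T : measurableType d) (D : set T)
    (h : T -> 'rV[R]_n) c s :
  measurable D -> (forall i, measurable_fun D (fun x => h x ord0 i)) ->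
  measurable (D `&` [set x | cube c s (h x)]).
Proof.
move=> mD mh.
have -> : D `&` [set x | cube c s (h x)] = D `&` \bigcap_(i in [set: 'I_n])
    (D `&` (fun x => h x ord0 i) @^-1` `[c ord0 i - s / 2, c ord0 i + s / 2]).
  apply/seteqP; split => x /= [Dx H]; split => //.
    by move=> i _; split => //=; have := H i; rewrite in_itv/= ler_distl.
  by move=> i; have [_ /=] := H i I; rewrite in_itv/= ler_distl.
apply: measurableI => //; apply: fin_bigcap_measurable => // i _.
by apply: mh => //; exact: measurable_itv.
Qed.

Lemma measurable_cube c s : measurable (cube c s : set (Rn R n)).
Proof.
rewrite -[cube c s]setTI; apply: (@measurable_cube_preimage _ (Rn R n)).
  exact: measurableT.
by move=> i; exact: measurable_coord.
Qed.

Lemma cube_box (c : 'rV[R]_n) s :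
  cube c s = box (c - const_mx (s / 2), c + const_mx (s / 2)).
Proof.
by apply/seteqP; split => x /= H i; have := H i; rewrite /= !mxE ler_distl.
Qed.

Lemma leb_cube (c : 'rV[R]_n) s : 0 <= s -> leb (cube c s) = (s ^+ n)%:E.
Proof.
move=> s0; rewrite cube_box /leb /= lebesgue_outer_box/=.
  congr (_%:E); rewrite (eq_bigr (fun=> s)) ?prodr_const ?card_ord// => i _.
  by rewrite !mxE; field.
by move=> i; rewrite !mxE; lra.
Qed.

Definition ocube (c : 'rV[R]_n) (s : R) : set 'rV[R]_n :=
  [set x | forall i, `|x ord0 i - c ord0 i| < s / 2].

Lemma sub_ocube_cube (c : 'rV[R]_n) s : ocube c s `<=` cube c s.
Proof. by move=> x cx i; exact/ltW/cx. Qed.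

Lemma cube_sub_ocube (c : 'rV[R]_n) s : 0 < s -> cube c (s / 2) `<=` ocube c s.
Proof. by move=> s0 x cx i; apply: le_lt_trans (cx i) _; lra. Qed.

Lemma coord_le_norm (x : 'rV[R]_n) i : `|x ord0 i| <= `|x|.
Proof.
rewrite [leRHS]mx_normrE.
exact: (@le_bigmax _ _ _ 0 (fun ij : 'I_1 * 'I_n => `|x ij.1 ij.2|) (ord0, i)).
Qed.

Lemma norm_le_coord (x : 'rV[R]_n) r :
  0 <= r -> (forall i, `|x ord0 i| <= r) -> `|x| <= r.
Proof.
move=> r0 xr; rewrite [leLHS]mx_normrE; apply/bigmax_leP; split => //= -[i j] _.
by rewrite (ord1 i)/=.
Qed.

Lemma norm_lt_coord (x : 'rV[R]_n) r :
  0 < r -> (forall i, `|x ord0 i| < r) -> `|x| < r.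
Proof.
move=> r0 xr; rewrite [ltLHS]mx_normrE; apply/bigmax_ltP; split => //= -[i j] _.
by rewrite (ord1 i)/=.
Qed.

Lemma cubeE (c : 'rV[R]_n) s x : 0 <= s -> cube c s x <-> `|x - c| <= s / 2.
Proof.
move=> s0; split => [cx|cx i].
  by apply: norm_le_coord => [|i]; [lra|rewrite !mxE; exact: cx].
by have := coord_le_norm (x - c) i; rewrite !mxE => /le_trans; apply.
Qed.

Lemma ocubeE (c : 'rV[R]_n) s x : 0 < s -> ocube c s x <-> `|x - c| < s / 2.
Proof.
move=> s0; split => [cx|cx i].
  by apply: norm_lt_coord => [|i]; [lra|rewrite !mxE; exact: cx].
by have := coord_le_norm (x - c) i; rewrite !mxE => /le_lt_trans; apply.
Qed.

Lemma leb_bounded (A : set 'rV[R]_n) : bounded_set A -> (leb A < +oo)%E.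
Proof.
move=> [M [_ MA]]; have := MA (`|M| + 1).
rewrite (le_lt_trans (ler_norm M)) ?ltrDl// => /(_ isT) MA1.
have M0 : 0 <= 2 * (`|M| + 1) by rewrite mulr_ge0// addr_ge0.
have A_cube : A `<=` cube 0 (2 * (`|M| + 1)).
  by move=> x /MA1/= xM; apply/cubeE => //; rewrite subr0; lra.
apply: (@le_lt_trans _ _ (leb (cube (0 : 'rV[R]_n) (2 * (`|M| + 1))))).
  exact: le_lebesgue_outer.
by rewrite leb_cube ?ltry.
Qed.

Lemma ocube_sub_interior (c : 'rV[R]_n) s :
  0 < s -> ocube c s `<=` (cube c s)°.
Proof.
move=> s0 x /ocubeE -/(_ s0) xc; rewrite /interior/=.
apply/nbhs_ballP; exists (s / 2 - `|x - c|); first by rewrite /= subr_gt0.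
move=> y; rewrite mx_norm_ball /ball_/= => xy; apply/cubeE; first exact: ltW.
have := ler_distD x y c; rewrite distrC in xy.
lra.
Qed.

(** A common point of the open and the closed cube, pushed slightly towards [c'], enters the second
    interior without leaving the first cube. Consequently, giving a shared face to another cube
    never removes interior points. *)
Lemma ocube_cube_disjoint (c c' : 'rV[R]_n) (s s' : R) : 0 < s -> 0 < s' ->
  ocube c s `&` ocube c' s' = set0 -> ocube c s `&` cube c' s' = set0.
Proof.
move=> s0 s'0 dis; apply/seteqP; split => // x [/ocubeE -/(_ s0) xc].
move=> /cubeE -/(_ (ltW s'0)) xc'.
pose e := s / 2 - `|x - c|; have e0 : 0 < e by rewrite /e subr_gt0.
(* [e] is the room left in the first cube; this [t] satisfies both [t < 1] and [t * s' < e]. *)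
pose t := e / (e + s').
have t0 : 0 < t by rewrite divr_gt0// addr_gt0.
have es : 0 < e + s' by rewrite addr_gt0.
have t1 : t < 1 by rewrite /t ltr_pdivrMr//; lra.
have te : t * s' < e.
  by rewrite /t mulrAC ltr_pdivrMr// ltr_pM2l//; lra.
pose y := x + t *: (c' - x).
suff : (ocube c s `&` ocube c' s') y by rewrite dis.
split; apply/ocubeE => //.
  rewrite /y addrAC; apply: le_lt_trans (ler_normD _ _) _.
  rewrite normrZ (gtr0_norm t0) [`|c' - x|]distrC.
  have : t * `|x - c'| <= t * (s' / 2) by rewrite ler_wpM2l// ltW.
  rewrite /e in te *; nra.
have -> : y - c' = (1 - t) *: (x - c').
  by rewrite /y scalerBl scale1r -scalerN opprB addrAC.
rewrite normrZ gtr0_norm ?subr_gt0//.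
have : (1 - t) * `|x - c'| <= (1 - t) * (s' / 2) by rewrite ler_wpM2l// subr_ge0 ltW.
by nra.
Qed.

Lemma leb_ocube_ge (c : 'rV[R]_n) s : 0 < s ->
  (((s / 2) ^+ n)%:E <= leb (ocube c s))%E.
Proof.
move=> s0; have s20 : 0 <= s / 2 by lra.
by rewrite -(leb_cube c s20); exact/le_lebesgue_outer/cube_sub_ocube.
Qed.

End lebesgue_measurable.

(** * Transport on a finite graph and a discrete Hardy inequality *)

Section transport_chain.
Variables (R : realType) (V : finType) (m : V -> V -> R) (v M : V -> R).
Hypothesis m_ge0 : forall i j, 0 <= m i j.
Hypothesis v_gt0 : forall j, 0 < v j.
Hypothesis M_in : forall j, M j = v j + \sum_i m i j.
Hypothesis M_out : forall i, \sum_j m i j <= M i.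

(** At a minimum point [k], the inflow terms are at least their value with [A k] in place of [A i];
    by [M_in] what is left is [0 <= v k * A k]. It serves for uniqueness, comparison and the maximum
    bound. *)
Lemma chain_min_principle (A : V -> R) :
  (forall j, \sum_i m i j * A i <= M j * A j) -> forall j, 0 <= A j.
Proof.
move=> HA j; pose k := [arg min_(i < j) A i]%O.
have kmin i : A k <= A i by rewrite /k; case: arg_minP => // l _; apply.
apply: le_trans (kmin j).
have : \sum_i m i k * A k <= M k * A k.
  by apply: le_trans (HA k); apply: ler_sum => i _; rewrite ler_wpM2l.
by rewrite -mulr_suml M_in mulrDl lerDr pmulr_rge0.
Qed.

(** The system is square, so injectivity suffices; the minimum principle applied to a kernel vector
    and to its opposite gives it. *)
Lemma chain_solvable (a : V -> R) :
  exists A : V -> R, forall j, M j * A j = v j * a j + \sum_i m i j * A i.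
Proof.
pose e (i : 'I_#|V|) : V := enum_val i.
have sumE (F : V -> R) : \sum_i F i = \sum_(i < #|V|) F (e i).
  by rewrite (reindex e)//; exact/onW_bij/enum_val_bij.
pose D : 'M[R]_#|V| := \matrix_(i, j) ((i == j)%:R * M (e j) - m (e i) (e j)).
have DE (u : 'rV[R]_#|V|) j :
    (u *m D) ord0 j = M (e j) * u ord0 j - \sum_i m (e i) (e j) * u ord0 i.
  rewrite mxE; under eq_bigr do rewrite mxE mulrBr.
  rewrite sumrB (bigD1 j)//= eqxx mul1r big1 ?addr0; last first.
    by move=> i /negbTE ->; rewrite mul0r mulr0.
  by rewrite mulrC; congr (_ - _); apply: eq_bigr => i _; rewrite mulrC.
have ker0 (u : 'rV[R]_#|V|) : u *m D = 0 -> u = 0.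
  have pos (w : 'rV[R]_#|V|) : w *m D = 0 -> forall i, 0 <= w ord0 i.
    move=> wD i.
    have := @chain_min_principle (fun x => w ord0 (enum_rank x)) _ (e i).
    rewrite /e enum_valK; apply => j; rewrite sumE -subr_ge0.
    have := DE w (enum_rank j); rewrite wD mxE /e enum_rankK => /esym => h.
    by under eq_bigr do rewrite enum_valK; rewrite h.
  move=> uD; apply/rowP => i; rewrite mxE; apply/eqP; rewrite eq_le pos// andbT.
  by have := pos (- u) _ i; rewrite mulNmx uD oppr0 mxE oppr_ge0; apply.
have Du : D \in unitmx.
  rewrite -row_free_unit -kermx_eq0; apply/eqP/row_matrixP => i.
  by rewrite row0; apply: ker0; rewrite -row_mul mulmx_ker row0.
pose u := (\row_j (v (e j) * a (e j))) *m invmx D.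
exists (fun x => u ord0 (enum_rank x)) => j.
have := DE u (enum_rank j); rewrite mulmxKV// mxE /e enum_rankK => h.
rewrite sumE; under eq_bigr do rewrite /e enum_valK.
by rewrite h subrK.
Qed.

Lemma young_powR_pred (x y p : R) : 0 <= x -> 0 <= y -> 1 < p ->
  x * y `^ (p - 1) <= p^-1 * x `^ p + (1 - p^-1) * y `^ p.
Proof.
move=> x0 y0 p1.
have p0 : 0 < p by lra.
have q0 : 0 < p / (p - 1) by rewrite divr_gt0//; lra.
have := @conjugate_powR R x (y `^ (p - 1)) p (p / (p - 1)) x0 (powR_ge0 _ _) p0 q0.
have -> : p^-1 + (p / (p - 1))^-1 = 1 by field; lra.
move=> /(_ erefl); rewrite -powRrM.
have -> : (p - 1) * (p / (p - 1)) = p by field; lra.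
have -> : (y `^ p / (p / (p - 1))) = (1 - p^-1) * y `^ p by field; lra.
by rewrite [_ / p]mulrC.
Qed.

(* [2^p/(p-1)] comes from using Young's inequality on [(2a) A^(p-1)]. *)
Lemma chain_hardy (p : R) (a A : V -> R) : 1 < p ->
  (forall j, 0 <= a j) -> (forall j, 0 <= A j) ->
  (forall j, M j * A j = v j * a j + \sum_i m i j * A i) ->
  \sum_j v j * A j `^ p <= 2 `^ p / (p - 1) * \sum_j v j * a j `^ p.
Proof.
move=> p1 a0 A0 HA.
have p0 : 0 < p by lra.
(* The balance equation is multiplied by [A j] to the power [p - 1], and Young is applied to each
   transfer term. *)
have step j : M j * A j `^ p <= v j * (a j * A j `^ (p - 1)) +
    (p^-1 * \sum_i m i j * A i `^ p + (1 - p^-1) * ((M j - v j) * A j `^ p)).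
  rewrite -{1}(mulr_powRB1 (A0 j) p0) mulrA HA mulrDl -mulrA lerD2l mulr_suml.
  rewrite M_in addrAC subrr add0r mulr_suml !mulr_sumr -big_split/=.
  apply: ler_sum => i _; rewrite -mulrA.
  have := young_powR_pred (A0 i) (A0 j) p1.
  by move=> /(ler_wpM2l (m_ge0 i j)); lra.
have S1 : \sum_j M j * A j `^ p <= \sum_j v j * (a j * A j `^ (p - 1)) +
    (p^-1 * \sum_i M i * A i `^ p + (1 - p^-1) * \sum_j (M j - v j) * A j `^ p).
  apply: le_trans (ler_sum _ (fun j _ => step j)) _.
  rewrite !big_split/= -!mulr_sumr lerD2l lerD2r ler_wpM2l ?invr_ge0 ?(ltW p0)//.
  rewrite exchange_big/=; apply: ler_sum => i _.
  by rewrite -mulr_suml ler_wpM2r// powR_ge0.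
have S2 : (1 - p^-1) * \sum_j v j * A j `^ p <=
    \sum_j v j * (a j * A j `^ (p - 1)).
  have E : \sum_j (M j - v j) * A j `^ p =
      \sum_j M j * A j `^ p - \sum_j v j * A j `^ p.
    by rewrite -sumrB; apply: eq_bigr => j _; rewrite mulrBl.
  by move: S1; rewrite E; lra.
have S3 : \sum_j v j * (a j * A j `^ (p - 1)) <=
    2^-1 * (p^-1 * 2 `^ p * \sum_j v j * a j `^ p +
            (1 - p^-1) * \sum_j v j * A j `^ p).
  rewrite !mulr_sumr -big_split/= mulr_sumr; apply: ler_sum => j _.
  have := young_powR_pred (mulr_ge0 (ler0n R 2) (a0 j)) (A0 j) p1.
  rewrite powRM// => /(ler_wpM2l (ltW (v_gt0 j))); lra.
rewrite mulrAC -[_ / _]mulrC ler_pdivlMl; last lra.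
have {S2 S3} := le_trans S2 S3.
set X := \sum_j v j * A j `^ p; set Y := \sum_j v j * a j `^ p.
have -> : 1 - p^-1 = (p - 1) / p by field; lra.
move=> /(ler_wpM2l (ltW p0)).
have -> : p * ((p - 1) / p * X) = (p - 1) * X by field; lra.
have -> : p * (2^-1 * (p^-1 * 2 `^ p * Y + (p - 1) / p * X)) =
   2^-1 * (2 `^ p * Y + (p - 1) * X) by field; lra.
lra.
Qed.

End transport_chain.

(** * Loop erasure of weighted trajectories on a finite graph *)

Section loop_erasure.
Variables (R : realType) (V : finType).

Lemma sum_count_in (k x : V) (p : seq V) :
  (\sum_l count_mem (l, k) (zip (x :: p) p) = count_mem k p)%N.
Proof.
elim: p x => [|y p IH] x /=; first by rewrite big1.
rewrite big_split/= IH; congr (_ + _)%N.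
rewrite (bigD1 x)//= big1 ?addn0 => [|l lx]; last first.
  by rewrite xpair_eqE eq_sym (negbTE lx).
by rewrite xpair_eqE eqxx.
Qed.

Lemma sum_count_out (k x : V) (p : seq V) :
  (\sum_l count_mem (k, l) (zip (x :: p) p) = count_mem k (belast x p))%N.
Proof.
elim: p x => [|y p IH] x /=; first by rewrite big1.
rewrite big_split/= IH; congr (_ + _)%N.
rewrite (bigD1 y)//= big1 ?addn0 => [|l lx]; last first.
  by rewrite xpair_eqE [y == l]eq_sym (negbTE lx) andbF.
by rewrite xpair_eqE eqxx andbT.
Qed.

Lemma path_zip (adj : rel V) (k l x : V) (p : seq V) :
  path adj x p -> (k, l) \in zip (x :: p) p -> adj k l.
Proof.
elim: p x => [//|y p IH] x /= /andP[xy yp]; rewrite inE => /orP[|].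
  by move=> /eqP[-> ->].
exact: IH.
Qed.

Lemma shorten_facts (x : V) (p : seq V) :
  [/\ uniq (x :: shorten x p), last x (shorten x p) = last x p &
   {subset x :: shorten x p <= x :: p}].
Proof.
(* The always true relation is enough here, as [shortenP] only asks for some path. *)
have xp : path [rel _ _ | true] x p by elim: p x => //= y p IH x; exact: IH.
case: (shortenP xp) => q _ uq sub; split => //.
by move=> y; rewrite !inE => /orP[->//|/sub ->]; rewrite orbT.
Qed.

(* [m k l] is the mass of the loop-erased trajectories that step from [k] to
   [l], and [N k] the mass of those that visit [k]. *)
Lemma loop_erased_flow (W : finType) (adj : rel V) (w : W -> R)
    (x : W -> V) (p : W -> seq V) (root : V) :
  (forall i, 0 <= w i) ->
  (forall i, w i != 0 -> path adj (x i) (p i) /\ last (x i) (p i) = root) ->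
  exists (m : V -> V -> R) (N : V -> R),
    [/\ (forall k l, 0 <= m k l), (forall k l, m k l != 0 -> adj k l),
        (forall k, N k = \sum_(i | x i == k) w i + \sum_l m l k),
        (forall k, \sum_l m k l = if k == root then 0 else N k) &
        (forall k, N k <= \sum_(i | k \in x i :: p i) w i)].
Proof.
move=> w0 wp; pose c i := shorten (x i) (p i).
pose m k l := \sum_i w i * (count_mem (k, l) (zip (x i :: c i) (c i)))%:R.
pose N k := \sum_i w i * (k \in x i :: c i)%:R.
(* Without loops the number of visits is an indicator, so [N k] counts each trajectory at most
   once. *)
have cU i k : count_mem k (x i :: c i) = (k \in x i :: c i).
  by rewrite count_uniq_mem//; have [] := shorten_facts (x i) (p i).
exists m, N; split.
- by move=> k l; apply: sumr_ge0 => i _; rewrite mulr_ge0.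
- move=> k l; apply: contraNT => nadj; rewrite /m big1// => i _.
  have [->|wi0] := eqVneq (w i) 0; first by rewrite mul0r.
  have [pi _] := wp _ wi0.
  rewrite (count_memPn _) ?mulr0//; apply: contra nadj.
  by apply: path_zip; rewrite /c; case: (shortenP pi).
- move=> k; rewrite /m exchange_big/= [X in X + _]big_mkcond -big_split/=.
  apply: eq_bigr => i _; rewrite -mulr_sumr -natr_sum sum_count_in -cU/=.
  by case: eqP => _; rewrite ?add0r// natrD mulrDr mulr1.
- move=> k; rewrite /m exchange_big/=.
  transitivity (\sum_i w i * (if k == root then 0 else (k \in x i :: c i)%:R)).
    apply: eq_bigr => i _; rewrite -mulr_sumr -natr_sum sum_count_out.
    have [->|wi0] := eqVneq (w i) 0; first by rewrite !mul0r.
    have [_ lasti] := wp _ wi0; congr (_ * _).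
    have [_ lastc _] := shorten_facts (x i) (p i).
    (* The last vertex is the root and occurs once, so no step leaves the root; for any other [k]
       every visit is followed by a step. *)
    have := cU i k; rewrite lastI -cats1 count_cat/= -/(c i) lastc lasti addn0.
    rewrite (eq_sym root); case: eqVneq => [_|_]; rewrite ?addn0 => cUk.
      apply/eqP; rewrite pnatr_eq0 -leqn0 -(leq_add2r 1) add0n cUk.
      exact: leq_b1.
    by rewrite cUk.
  by case: ifP => _//; rewrite big1// => i _; rewrite mulr0.
- move=> k; rewrite [leRHS]big_mkcond; apply: ler_sum => i _.
  have [_ _ sub] := shorten_facts (x i) (p i).
  by case: ifPn => [_|/(contra (@sub k))/negbTE ->]; rewrite ?mulr0// ler_piMr// lern1 leq_b1.
Qed.

End loop_erasure.

(** * Whitney cubes and their cells *)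

Section whitney_geometry.
Variables (R : realType) (n : nat).
Implicit Types (x y z w : 'rV[R]_n) (Omega : set 'rV[R]_n).

Lemma norm_le_enorm x : `|x| <= enorm x.
Proof.
apply: norm_le_coord => [|i]; first exact: sqrtr_ge0.
rewrite -sqrtr_sqr ler_wsqrtr// (bigD1 i)//= lerDl.
by apply: sumr_ge0 => j _; exact: sqr_ge0.
Qed.

Lemma enorm_le_norm x : enorm x <= n%:R * `|x|.
Proof.
case: (posnP n) => [n0|n0].
  by rewrite /enorm big1 ?sqrtr0 ?mulr_ge0// => i; move: (ltn_ord i); rewrite {2}n0.
rewrite -[leRHS]ger0_norm ?mulr_ge0// -[leRHS]sqrtr_sqr ler_wsqrtr// exprMn.
apply: (@le_trans _ _ (\sum_(i < n) `|x| ^+ 2)).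
  apply: ler_sum => i _; rewrite -(real_normK (num_real (x ord0 i))).
  by rewrite ler_sqr ?nnegrE// coord_le_norm.
rewrite sumr_const card_ord -[leLHS]mulr_natl ler_wpM2r ?sqr_ge0//.
by rewrite -natrX ler_nat -{1}(expn1 n) leq_pexp2l.
Qed.

Lemma enormZ (a : R) x : enorm (a *: x) = `|a| * enorm x.
Proof.
rewrite /enorm; under eq_bigr do rewrite mxE exprMn.
by rewrite -mulr_sumr sqrtrM ?sqr_ge0// sqrtr_sqr.
Qed.

Lemma enormN x : enorm (- x) = enorm x.
Proof. by rewrite -scaleN1r enormZ normrN1 mul1r. Qed.

(** The first exit parameter, an infimum, gives the boundary point. This relates [bdist], an infimum
    over the topological boundary, to distances to points outside [Omega]. *)
Lemma segment_boundary Omega x w : open Omega -> Omega x -> ~ Omega w ->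
  exists2 t, 0 <= t <= 1 & (closure Omega `\` Omega°) (x + t *: (w - x)).
Proof.
move=> oO Ox Ow; pose g (t : R) := x + t *: (w - x).
pose S := [set t : R | 0 <= t <= 1 /\ ~ Omega (g t)].
have S1 : S 1.
  by split; [rewrite ler01 lexx|rewrite /g scale1r addrC subrK].
have lbS : lbound S 0 by move=> t [/andP[]].
have infS : has_inf S by split; [exists 1|exists 0].
have cg t e : 0 < e -> exists2 d, 0 < d & forall t', `|t' - t| < d -> `|g t' - g t| < e.
  move=> e0; exists (e / (`|w - x| + 1)); first by rewrite divr_gt0// ltr_wpDl.
  move=> t' tt'; rewrite /g opprD addrACA subrr add0r -scalerBl normrZ.
  rewrite ltr_pdivlMr ?ltr_wpDl// in tt'; apply: le_lt_trans tt'.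
  by rewrite ler_wpM2l// lerDl.
have ball_Omega t : Omega (g t) -> exists2 d, 0 < d & forall t', `|t' - t| < d -> Omega (g t').
  move=> /oO /nbhs_ballP[e /= e0 eO].
  have [d d0 de] := cg t e e0; exists d => // t' /de.
  by rewrite distrC => te; apply: eO; rewrite mx_norm_ball.
pose t0 := inf S.
have t00 : 0 <= t0 by apply: lb_le_inf => //; exists 1.
have t01 : t0 <= 1 by apply: ge_inf => //; exists 0.
have NOt0 : ~ Omega (g t0).
  move=> /ball_Omega[d d0 dO].
  have [t St tt0] := inf_adherent d0 infS.
  have : t0 <= t by apply: ge_inf => //; exists 0.
  move=> t0t; have [_] := St; apply; apply: dO.
  by rewrite ger0_norm ?subr_ge0//; rewrite /t0 in t0t *; lra.
exists t0; first by rewrite t00.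
split; last by move=> /interior_subset.
have t0_gt0 : 0 < t0.
  rewrite lt_neqAle t00 andbT; apply/eqP => t0E; apply: NOt0.
  by rewrite -t0E /g scale0r addr0.
move=> B /nbhs_ballP[e /= e0 eB].
have [d d0 de] := cg t0 e e0.
(* A parameter just before the exit; the minimum keeps it nonnegative, and minimality of [t0] puts
   [g t] in [Omega]. *)
pose t := t0 - Num.min t0 (d / 2).
have m0 : 0 < Num.min t0 (d / 2) by rewrite lt_min t0_gt0 divr_gt0.
have m1 : Num.min t0 (d / 2) <= t0 by rewrite ge_min lexx.
have m2 : Num.min t0 (d / 2) <= d / 2 by rewrite ge_min lexx orbT.
exists (g t); split.
  apply: contrapT => Ot.
  have St : S t by split => //; rewrite /t; lra.
  have : t0 <= t by apply: ge_inf => //; exists 0.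
  by rewrite /t; lra.
apply: eB; rewrite mx_norm_ball /ball_/= distrC; apply: de.
by rewrite /t ltr_norml; lra.
Qed.

(** [Omega != setT] makes the boundary nonempty; otherwise [inf] would return its default 0. *)
Lemma bdist_ge Omega x r : open Omega -> Omega x -> Omega != setT ->
  (forall w, ~ Omega w -> r <= `|x - w|) -> r <= bdist Omega x.
Proof.
move=> oO Ox /setTPn[w Ow] xr.
have [t _ bt] := segment_boundary oO Ox Ow.
apply: lb_le_inf; first by exists (enorm (x - (x + t *: (w - x)))), (x + t *: (w - x)).
move=> _ [z [_ Oz] <-]; apply: le_trans (norm_le_enorm _).
by apply: xr => Oz'; apply: Oz; move/(_ z Oz') : (oO).
Qed.

Lemma bdist_le Omega x w : open Omega -> Omega x -> ~ Omega w ->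
  bdist Omega x <= n%:R * `|x - w|.
Proof.
move=> oO Ox Ow; have [t /andP[t0 t1] bt] := segment_boundary oO Ox Ow.
apply: (@le_trans _ _ (enorm (x - (x + t *: (w - x))))).
  apply: ge_inf; last by exists (x + t *: (w - x)).
  by exists 0 => _ [z _ <-]; exact: sqrtr_ge0.
rewrite opprD addrA subrr add0r enormN enormZ (ger0_norm t0).
apply: le_trans (_ : enorm (w - x) <= _); first by rewrite ler_piMl// sqrtr_ge0.
by rewrite distrC enorm_le_norm.
Qed.


Lemma path_length_segment x z :
  (path_length (fun t : R => z + t *: (x - z))%R <= (enorm (x - z)%R)%:E)%E.
Proof.
apply: ge_ereal_sup => _ [k [t [t0 t1 ht ->]]]; rewrite lee_fin.
under eq_bigl do rewrite asboolT//.
have -> : \sum_(i < k) enorm (z + t i.+1 *: (x - z) - (z + t i *: (x - z))) =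
    \sum_(0 <= i < k) (t i.+1 - t i) * enorm (x - z).
  rewrite big_mkord; apply: eq_bigr => i _.
  rewrite opprD addrACA subrr add0r -scalerBl enormZ ger0_norm// subr_ge0.
  exact: ht.
rewrite -mulr_suml telescope_sumr// ler_piMl ?sqrtr_ge0//.
lra.
Qed.

Lemma gdist_le_segment Omega x z :
  (forall t, 0 <= t <= 1 -> Omega (z + t *: (x - z))) ->
  (gdist Omega z x <= (enorm (x - z)%R)%:E)%E.
Proof.
move=> seg; apply: (@le_trans _ _ (path_length (fun t : R => z + t *: (x - z))%R)).
  apply: ereal_inf_lbound; exists (fun t : R => z + t *: (x - z)) => //; split.
    split.
    - apply: continuous_subspaceT => t; apply: cvgD; first exact: cvg_cst.
      by apply: cvgZr_tmp; exact: cvg_id.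
    - by move=> t; rewrite in_itv/=; exact: seg.
    - by rewrite scale0r addr0.
    - by rewrite scale1r addrC subrK.
  by rewrite /rectifiable (le_lt_trans (path_length_segment _ _))// ltry.
exact: path_length_segment.
Qed.

Lemma cube_segment c (s : R) x z (t : R) : 0 <= s ->
  cube c s x -> cube c s z -> 0 <= t <= 1 -> cube c s (z + t *: (x - z)).
Proof.
move=> s0 /cubeE -/(_ s0) xc /cubeE -/(_ s0) zc /andP[t0 t1]; apply/cubeE => //.
have -> : z + t *: (x - z) - c = t *: (x - c) + (1 - t) *: (z - c).
  by apply/rowP => i; rewrite !mxE; ring.
rewrite (le_trans (ler_normD _ _))// !normrZ (ger0_norm t0).
rewrite [`|1 - t|]ger0_norm ?subr_ge0//.
have := ler_wpM2l t0 xc.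
have : (1 - t) * `|z - c| <= (1 - t) * (s / 2) by rewrite ler_wpM2l// subr_ge0.
lra.
Qed.

End whitney_geometry.

Section whitney_family.
Variables (R : realType) (n : nat) (Omega : set 'rV[R]_n) (x0 : 'rV[R]_n).
Variables (c : nat -> 'rV[R]_n) (s : nat -> R).
Hypothesis n_gt0 : (0 < n)%N.
Hypothesis oO : open Omega.
Hypothesis wh : whitney Omega x0 c s.
Implicit Types x y z w : 'rV[R]_n.

Lemma whitney_side_gt0 j : 0 < s j.
Proof. by have [] := wh. Qed.

Lemma whitney_bigcup : Omega = \bigcup_j cube (c j) (s j).
Proof. by have [] := wh. Qed.

Lemma whitney_sub2 j : cube (c j) (2 * s j) `<=` Omega.
Proof. by have [_ _ _ /(_ j)[]] := wh. Qed.

Lemma whitney_escape j : exists2 w, ~ Omega w & `|w - c j| <= 2 * s j.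
Proof.
have [_ _ _ /(_ j)[_ [w [cw Ow]]] _] := wh; exists w => //.
have s0 : 0 <= 4 * s j by rewrite mulr_ge0// ltW// whitney_side_gt0.
by have /cubeE -/(_ s0) := cw; lra.
Qed.

Lemma whitney_far j x w : ~ Omega w -> s j - `|x - c j| <= `|x - w|.
Proof.
move=> Ow; have : s j <= `|w - c j|.
  rewrite leNgt; apply/negP => h; apply: Ow; apply: (@whitney_sub2 j).
  have s0 := whitney_side_gt0 j.
  by apply/cubeE; lra.
have := ler_distD x w (c j); rewrite (distrC w x); lra.
Qed.

Lemma whitney_setT : Omega != setT.
Proof.
by have [w Ow _] := whitney_escape 0; apply/setTPn; exists w.
Qed.

Lemma whitney_bdist_ge j x : Omega x -> s j - `|x - c j| <= bdist Omega x.
Proof.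
move=> Ox; apply: bdist_ge => // [|w]; first exact: whitney_setT.
exact: whitney_far.
Qed.

Lemma whitney_bdist_le j x : Omega x ->
  bdist Omega x <= n%:R * (2 * s j + `|x - c j|).
Proof.
move=> Ox; have [w Ow wc] := whitney_escape j.
apply: le_trans (bdist_le oO Ox Ow) _; rewrite ler_wpM2l//.
have := ler_distD (c j) x w; rewrite (distrC (c j) w); lra.
Qed.

(** A point [w] outside [Omega] within [2 * s j] of [c j] lies within [5 / 2 * s j + |x - y|] of
    [y], while the doubled cube [k] forces that distance to be at least [s k / 2]. *)
Lemma whitney_side_le j k x y :
  `|x - c j| <= s j / 2 -> `|y - c k| <= s k / 2 ->
  s k <= 5 * s j + 2 * `|x - y|.
Proof.
move=> xj yk; have [w Ow wc] := whitney_escape j.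
have := whitney_far k y Ow.
have := ler_distD x y w; have := ler_distD (c j) x w.
rewrite (distrC (c j) w) (distrC y x); lra.
Qed.

Section subdivision.
Variable M : nat.
Hypothesis M_gt0 : (0 < M)%N.

(* Each Whitney cube is cut into [M ^ n] equal closed cubes. *)
Lemma whitney_subdivision : exists (J : nat -> nat) (b : nat -> 'rV[R]_n),
  [/\ forall k, cube (b k) (s (J k) / M%:R) `<=` cube (c (J k)) (s (J k)),
      Omega = \bigcup_k cube (b k) (s (J k) / M%:R) &
      forall k l, k != l -> ocube (b k) (s (J k) / M%:R) `&`
        ocube (b l) (s (J l) / M%:R) = set0].
Proof.
case: M M_gt0 => // m _.
pose T := {ffun 'I_n -> 'I_m.+1}.
pose u0 : T := [ffun=> ord0].
pose P := #|{: T}|.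
have P0 : (0 < P)%N by apply/card_gt0P; exists u0.
(* Mixed radix numbering: the quotient of [k] by [P] names the Whitney cube, the remainder names one
   of the functions that assign a slot to each coordinate. *)
pose J k := (k %/ P)%N.
pose u k : T := nth u0 (enum {: T}) (k %% P).
pose b k : 'rV[R]_n := \row_i (c (J k) ord0 i - s (J k) / 2 +
   ((u k i)%:R + 2^-1) * (s (J k) / m.+1%:R)).
have m0 : 0 < m.+1%:R :> R by rewrite ltr0n.
have s0 j : 0 < s j := whitney_side_gt0 j.
have t0 j : 0 < s j / m.+1%:R by rewrite divr_gt0.
have tm j : s j = m.+1%:R * (s j / m.+1%:R) by rewrite mulrC divfK// gt_eqF.
have um k i : (u k i)%:R + 1 <= m.+1%:R :> R.
  by rewrite natr1 ler_nat; exact: ltn_ord.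
have sub k : cube (b k) (s (J k) / m.+1%:R) `<=` cube (c (J k)) (s (J k)).
  move=> x xb i; have := xb i; rewrite mxE !ler_distl.
  have u1 := um k i; have u2 : 0 <= (u k i)%:R :> R by [].
  have := tm (J k); have := t0 (J k); set t := (s (J k) / m.+1%:R) => tpos tE.
  have : ((u k i)%:R + 1) * t <= m.+1%:R * t by rewrite ler_wpM2r// ltW.
  have : 0 <= (u k i)%:R * t by rewrite mulr_ge0// ltW.
  by move=> h1 h2 /andP[x1 x2]; apply/andP; split; lra.
exists J, b; split.
- exact: sub.
- rewrite [LHS]whitney_bigcup; apply/seteqP; split; last first.
    by move=> x [k _ /sub xk]; exists (J k).
  move=> x [j _ xj]; set t := s j / m.+1%:R.
  have tj : 0 < t := t0 j.
  have stE : s j = m.+1%:R * t := tm j.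
  (* The slot is the integer part of [r], except at the right end [r = m.+1], which belongs to the
     last slot. *)
  have slot (r : R) : 0 <= r -> r <= m.+1%:R -> exists q : 'I_m.+1, q%:R <= r <= q%:R + 1.
    move=> r0 rm; case: (leqP (Num.truncn r) m) => [qm|mq].
      exists (Ordinal (qm : Num.truncn r < m.+1)%N) => /=.
      by have /andP[-> /ltW] := truncn_itv r0; rewrite -natr1.
    exists ord_max; rewrite /= natr1 rm andbT.
    have /andP[h _] := truncn_itv r0; apply: le_trans h.
    by rewrite ler_nat ltnW.
  have ex i : exists q : 'I_m.+1, q%:R * t <= x ord0 i - c j ord0 i + s j / 2 <= (q%:R + 1) * t.
    have := xj i; rewrite ler_distl => /andP[x1 x2].
    have [||q /andP[q1 q2]] := @slot ((x ord0 i - c j ord0 i + s j / 2) / t).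
    - by rewrite divr_ge0 ?(ltW tj)//; lra.
    - by rewrite ler_pdivrMr// -stE; lra.
    by exists q; rewrite -ler_pdivlMr// q1 -ler_pdivrMr.
  have [q Hq] := fin_all_exists ex.
  pose U : T := [ffun i => q i].
  have idx : (index U (enum {: T}) < P)%N by rewrite /P cardE index_mem mem_enum.
  pose k := (j * P + index U (enum {: T}))%N.
  have Jk : J k = j by rewrite /J /k divnMDl// divn_small// addn0.
  have uk : u k = U.
    by rewrite /u /k modnMDl modn_small// nth_index// mem_enum.
  exists k => // i; rewrite mxE Jk -/t uk ffunE ler_distl.
  by have := Hq i; move=> /andP[h1 h2]; apply/andP; split; lra.
- move=> k l kl; apply/seteqP; split => // x [xk xl].
  (* Pieces of different Whitney cubes have disjoint interiors by assumption; two pieces of the same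
     cube are separated along a coordinate where their slots differ. *)
  have [Jkl|/eqP Jkl] := eqVneq (J k) (J l); last first.
    have intJ i : ocube (b i) (s (J i) / m.+1%:R) `<=` (cube (c (J i)) (s (J i)))°.
      move=> y /(ocube_sub_interior (t0 _)).
      by apply: interiorS; exact: sub.
    have [_ _ /(_ (J k) (J l)) dis _ _] := wh.
    have /dis dis' : J k != J l by exact/eqP.
    suff : set0 x by []. 
    by rewrite -dis'; split; exact: intJ.
  have uv : u k != u l.
    apply: contra kl; rewrite /u => /eqP uv.
    have : (k %% P == l %% P)%N.
      by rewrite -(nth_uniq u0 (_ : _ < size (enum {: T}))%N _ (enum_uniq {: T}))
        -?cardE ?ltn_pmod// uv.
    by move=> /eqP h; rewrite (divn_eq k P) (divn_eq l P) h -/(J k) Jkl.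
  have [i ui] : exists i, u k i != u l i.
    apply/existsP; apply: contraR uv; rewrite negb_exists => /forallP uv.
    by apply/eqP/ffunP => i; have := uv i; rewrite negbK => /eqP.
  have := xk i; have := xl i; rewrite !mxE -Jkl.
  have := t0 (J k); set t := (s (J k) / m.+1%:R) => tpos.
  rewrite !ltr_distl => /andP[a1 a2] /andP[b1 b2].
  have hlt (p q : nat) : (p < q)%N -> p%:R + 1 <= q%:R :> R.
    by move=> pq; rewrite natr1 ler_nat.
  have := ui; rewrite neq_ltn => /orP[|] /hlt /(ler_wpM2r (ltW tpos)); lra.
Qed.


Variables (J : nat -> nat) (b : nat -> 'rV[R]_n).
Hypothesis cube_sub : forall k,
  cube (b k) (s (J k) / M%:R) `<=` cube (c (J k)) (s (J k)).
Hypothesis cube_cover : Omega = \bigcup_k cube (b k) (s (J k) / M%:R).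
Hypothesis cube_dis : forall k l, k != l ->
  ocube (b k) (s (J k) / M%:R) `&` ocube (b l) (s (J l) / M%:R) = set0.
Hypothesis M_ge : (100 * n <= M)%N.

Let t k := s (J k) / M%:R.

Let M0 : 0 < M%:R :> R. Proof. by rewrite ltr0n. Qed.

Let t_gt0 k : 0 < t k. Proof. by rewrite divr_gt0// whitney_side_gt0. Qed.

Let tE k : s (J k) = M%:R * t k.
Proof. by rewrite /t mulrC divfK// gt_eqF. Qed.

Let nt_le k : 100 * (n%:R * t k) <= s (J k).
Proof. by rewrite tE mulrA ler_wpM2r ?(ltW (t_gt0 _))// -natrM ler_nat. Qed.

Let t_le k : 100 * t k <= s (J k).
Proof.
apply: le_trans (nt_le k); rewrite ler_wpM2l// ler_peMl ?(ltW (t_gt0 _))//.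
by rewrite ler1n.
Qed.

(** A shared face goes to the cube of smallest index, which turns the closed cubes into an exact
    partition of [Omega]. *)
Definition cell : nat -> set 'rV[R]_n := seqDU (fun k => cube (b k) (t k)).

Lemma cell_sub_cube k : cell k `<=` cube (b k) (t k).
Proof. exact: subset_seqDU. Qed.

Lemma cell_cover : \bigcup_k cell k = Omega.
Proof. by rewrite -seqDU_bigcup_eq cube_cover. Qed.

Lemma cell_sub k : cell k `<=` Omega.
Proof. by rewrite -cell_cover => x xk; exists k. Qed.

Lemma cell_trivIset : trivIset setT cell.
Proof. exact: trivIset_seqDU. Qed.

Lemma cell_inj x k l : cell k x -> cell l x -> k = l.
Proof. by move=> xk xl; apply: (cell_trivIset I I); exists x. Qed.

Lemma cell_dist k x : cell k x -> `|x - c (J k)| <= s (J k) / 2.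
Proof.
by move=> /cell_sub_cube/cube_sub/cubeE; apply; rewrite ltW// whitney_side_gt0.
Qed.

Let cell_center k x : cell k x -> `|x - b k| <= t k / 2.
Proof. by move=> /cell_sub_cube/cubeE; apply; exact: ltW. Qed.

Lemma measurable_cell_preimage d (T : measurableType d) (D : set T)
    (h : T -> 'rV[R]_n) k :
  measurable D -> (forall i, measurable_fun D (fun x : T => h x ord0 i)) ->
  measurable (D `&` [set x : T | cell k (h x)]).
Proof.
move=> mD mh.
have mB i : measurable (D `&` [set x : T | cube (b i) (t i) (h x)]).
  exact: measurable_cube_preimage.
rewrite (_ : _ `&` _ = (D `&` [set x : T | cube (b k) (t k) (h x)]) `\`
    \big[setU/set0]_(i < k) (D `&` [set x : T | cube (b i) (t i) (h x)])).
  by apply: measurableD => //; exact: bigsetU_measurable.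
rewrite -!(bigcup_mkord k (fun i => D `&` [set x : T | cube (b i) (t i) (h x)])).
rewrite /cell /seqDU; apply/seteqP; split => x /=.
  move=> [Dx [xk xi]]; split => // -[i /= ik [_ xi']]; apply: xi.
  by rewrite -(bigcup_mkord k (fun i => cube (b i) (t i))); exists i.
move=> [[Dx xk] xi]; split => //; split => //.
rewrite -(bigcup_mkord k (fun i => cube (b i) (t i))) => -[i ik xi'].
by apply: xi; exists i.
Qed.

Lemma measurable_cell k : measurable (cell k : set (Rn R n)).
Proof.
rewrite -[cell k]setTI; apply: (@measurable_cell_preimage _ (Rn R n)).
  exact: measurableT.
by move=> i; exact: measurable_coord.
Qed.

Lemma ocube_sub_cell k : ocube (b k) (t k) `<=` cell k.
Proof.
move=> x xk; split; first exact: sub_ocube_cube.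
rewrite -(bigcup_mkord k (fun i => cube (b i) (t i))) => -[i /= ik xi].
suff : set0 x by [].
rewrite -(@ocube_cube_disjoint _ _ (b k) (b i) (t k) (t i))//.
by apply: cube_dis; rewrite gt_eqF.
Qed.

Lemma leb_cell_ge k : (((t k / 2) ^+ n)%:E <= leb (cell k))%E.
Proof.
apply: le_trans (leb_ocube_ge _ (t_gt0 k)) _.
exact/le_lebesgue_outer/ocube_sub_cell.
Qed.

Lemma leb_cell_lty k : (leb (cell k) < +oo)%E.
Proof.
apply: (@le_lt_trans _ _ (leb (cube (b k) (t k)))).
  exact/le_lebesgue_outer/cell_sub_cube.
by rewrite leb_cube ?ltry// ltW.
Qed.

Lemma leb_cellE k : leb (cell k) = (fine (leb (cell k)))%:E.
Proof. by rewrite fineK// ge0_fin_numE ?leb_cell_lty// measure_ge0. Qed.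

Lemma leb_cell_gt0 k : 0 < fine (leb (cell k)).
Proof.
have := leb_cell_ge k; rewrite leb_cellE lee_fin; apply: lt_le_trans.
by rewrite exprn_gt0// divr_gt0.
Qed.

Lemma cell_bdist_ge k x : cell k x -> s (J k) / 2 <= bdist Omega x.
Proof.
move=> xk; have := cell_dist xk; have := whitney_bdist_ge (J k) (cell_sub xk).
lra.
Qed.

(** A point of the cell has [bdist] at most [5 / 2 * n * s (J k)], that is [5 * n * M] times
    [t k / 2], and the cell contains an open cube of side [t k]. *)
Lemma cell_bdist_expn k x : cell k x ->
  bdist Omega x ^+ n <= (5 * n%:R * M%:R) ^+ n * fine (leb (cell k)).
Proof.
move=> xk.
have b0 : 0 <= bdist Omega x.
  by apply: le_trans (cell_bdist_ge xk); rewrite divr_ge0// ltW// whitney_side_gt0.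
apply: (@le_trans _ _ ((5 * n%:R * M%:R * (t k / 2)) ^+ n)).
  rewrite lerXn2r ?nnegrE//.
    by rewrite !mulr_ge0// ltW// whitney_side_gt0.
  apply: le_trans (whitney_bdist_le (J k) (cell_sub xk)) _.
  have := cell_dist xk; rewrite {1}tE => h.
  have -> : 5 * n%:R * M%:R * (t k / 2) = n%:R * (5 / 2 * (M%:R * t k)) by lra.
  by rewrite ler_wpM2l// tE; lra.
rewrite exprMn ler_wpM2l ?exprn_ge0 ?mulr_ge0//.
by have := leb_cell_ge k; rewrite leb_cellE lee_fin.
Qed.

(* Not symmetric: mass leaving cell [k] must stay in the enlargement of the
   Whitney cube containing [k], where the corresponding [F j] is supported. *)
Definition adj (k l : nat) : bool :=
  `[< cell l `<=` cube (c (J k)) (3 / 2 * s (J k)) >].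

(** By [whitney_side_le], cell [l] has side below [s (J k) / 18]; added to [s (J k) / 2] and
    [s (J k) / 8], this stays below the half side [3 / 4 * s (J k)]. *)
Lemma adj_close k l x y : cell k x -> cell l y ->
  `|x - y| <= s (J k) / 8 -> adj k l.
Proof.
move=> xk yl xy; apply/asboolP => z zl.
have sk := whitney_side_gt0 (J k).
apply/cubeE; first by rewrite mulr_ge0// ltW.
have := whitney_side_le (cell_dist xk) (cell_dist yl).
have := cell_dist xk.
have := cell_center yl.
have := cell_center zl.
have := ler_distD x z (c (J k)); have := ler_distD y z x; have := ler_distD (b l) z y.
have := t_le l; rewrite (distrC (b l) y) (distrC y x); lra.
Qed.

(** The segment from [g r] to [x] stays in the convex cube. Its Euclidean length is at most
    [n * t k], and [M >= 100 * n] makes this smaller than [s (J k) / 4], hence than half of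
    [bdist]. *)
Lemma cell_gdist_path (g : R -> 'rV[R]_n) (r : R) k x : 0 <= r <= 1 -> cell k (g r) ->
  cell k x -> (gdist_path Omega g x <= (bdist Omega x / 2)%:E)%E.
Proof.
move=> r01 gk xk; apply: (@le_trans _ _ (gdist Omega (g r) x)).
  apply: ereal_inf_lbound; exists (g r) => //; exists r => //=.
apply: (@le_trans _ _ (enorm (x - g r))%:E).
  apply: gdist_le_segment => u u01; rewrite cube_cover; exists k => //.
  by apply: cube_segment (ltW (t_gt0 k)) (cell_sub_cube xk) (cell_sub_cube gk) _.
rewrite lee_fin; apply: le_trans (enorm_le_norm _) _.
have := cell_bdist_ge xk; have := nt_le k.
have := cell_center gk.
have := cell_center xk.
have := ler_distD (b k) x (g r); rewrite (distrC (b k)) => h1 h2 h3 h4 h5.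
have : n%:R * `|x - g r| <= n%:R * t k by rewrite ler_wpM2l//; lra.
have : 0 <= n%:R * t k by rewrite mulr_ge0// ltW.
lra.
Qed.

(** A ball of radius [e] around [g r] inside [Omega] bounds from below the side of every Whitney
    cube met near [g r], because such a cube has a point outside [Omega] close to it. Moves below
    [e / 50] then fall under the threshold [s (J k) / 8]. *)
Lemma path_adj_local (g : R -> 'rV[R]_n) y x r : path_in Omega g y x ->
  r \in `[0, 1] -> exists2 d, 0 < d & forall r1 r2, r1 \in `[0, 1] ->
    r2 \in `[0, 1] -> `|r1 - r| < d -> `|r2 - r| < d ->
  forall k l, cell k (g r1) -> cell l (g r2) -> adj k l.
Proof.
move=> [cg gO _ _] r01; have /oO/nbhs_ballP[e /= e0 eO] := gO _ r01.
have /subspace_continuousP/(_ r r01) /cvgrPdist_lt/(_ (e / 50)) := cg.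
rewrite divr_gt0// => /(_ isT).
rewrite near_withinE => /nbhs_ballP[d /= d0 dg].
exists d => // r1 r2 r101 r201 r1d r2d k l kr1 lr2.
have h1 : `|g r - g r1| < e / 50 by apply: dg => //; rewrite /ball/= distrC.
have h2 : `|g r - g r2| < e / 50 by apply: dg => //; rewrite /ball/= distrC.
apply: (adj_close kr1 lr2).
have [w Ow wc] := whitney_escape (J k).
have : e <= `|g r - w|.
  by rewrite leNgt; apply/negP => h; apply: Ow; apply: eO; rewrite mx_norm_ball.
have := ler_distD (g r1) (g r) w; have := ler_distD (c (J k)) (g r1) w.
have := cell_dist kr1; have := ler_distD (g r) (g r1) (g r2).
by rewrite (distrC (g r1) (g r)) (distrC (c (J k)) w); lra.
Qed.

(** A Lebesgue number argument on the compact interval. *)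
Lemma path_adj_uniform (g : R -> 'rV[R]_n) y x : path_in Omega g y x ->
  exists2 d, 0 < d & forall r1 r2, r1 \in `[0, 1] -> r2 \in `[0, 1] ->
    `|r1 - r2| < d -> forall k l, cell k (g r1) -> cell l (g r2) -> adj k l.
Proof.
move=> pg.
pose P (d r1 : R) := r1 \in `[0, 1] -> forall r2, r2 \in `[0, 1] -> `|r1 - r2| < d ->
  forall k l, cell k (g r1) -> cell l (g r2) -> adj k l.
have /compact_near_coveringP cov := @segment_compact R 0 1.
have : \forall d \near 0^'+, `[0, 1] `<=` P d.
  apply: cov => r r01; have [d d0 dP] := path_adj_local pg r01.
  exists (ball r (d / 2), [set d' : R | d' < d / 2]) => /=.
    split; first by apply: nbhsx_ballx; rewrite divr_gt0.
    by apply: nbhs_right_lt; rewrite divr_gt0.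
  move=> [r1 d'] /= [r1d dd'] r101 r2 r201 r12; apply: dP => //.
    by rewrite distrC; rewrite /ball/= in r1d; lra.
  by rewrite /ball/= in r1d; have := ler_distD r1 r2 r; rewrite (distrC r2 r1) (distrC r1 r); lra.
move=> near_d; have : \forall d \near 0^'+, 0 < d /\ `[0, 1] `<=` P d.
  by near=> d; split; near: d => //; exact: nbhs_right_gt.
move=> /filter_ex[d [d0 dP]]; exists d => // r1 r2 r101 r201 r12.
exact: (dP r1 r101 r101).
Unshelve. all: by end_near. Qed.

Lemma path_adj_fine (g : R -> 'rV[R]_n) y x : path_in Omega g y x ->
  exists K0, forall K, (K0 <= K)%N -> forall i, (i < K)%N ->
  forall k l, cell k (g (i%:R / K%:R)) -> cell l (g (i.+1%:R / K%:R)) -> adj k l.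
Proof.
move=> /path_adj_uniform[d d0 dP]; exists (Num.truncn d^-1).+1 => K K0 i iK.
have K_gt0 : 0 < K%:R :> R by rewrite ltr0n; exact: leq_trans iK.
apply: dP.
- by rewrite in_itv/= divr_ge0//= ler_pdivrMr// mul1r ler_nat ltnW.
- by rewrite in_itv/= divr_ge0//= ler_pdivrMr// mul1r ler_nat.
rewrite distrC -mulrBl -natrB// subSnn mul1r ger0_norm ?invr_ge0// invf_plt//.
by apply: lt_le_trans (truncnS_gt _) _; rewrite ler_nat.
Qed.

End subdivision.

End whitney_family.

(** * The flow between cells carried by the paths *)

Section finite_measure_facts.
Context d (T : measurableType d) (R : realType).
Variable mu : {measure set T -> \bar R}.

Lemma measure_bigcup_fintype (I : finType) (P : pred I) (F : I -> set T) :
  (forall i, measurable (F i)) -> trivIset setT F ->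
  mu (\bigcup_(i in [set i | P i]) F i) = (\sum_(i | P i) mu (F i))%E.
Proof.
move=> mF tF; rewrite measure_fin_bigcup//; last first.
- exact: sub_trivIset tF.
- exact: (finite_finpred P).
rewrite (@fsbigE _ _ _ _ _ (enum P)); last 3 first.
- exact: enum_uniq.
- by move=> i /=; rewrite mem_enum.
- by move=> i /= Pi; rewrite mem_enum => /negP.
by rewrite big_enum_cond; apply: eq_bigl => i; rewrite mem_setE andbb.
Qed.

(** Continuity from above for the unions of the tails of [D \ G i]; these decrease to the empty set
    even though [G] need not be monotone. *)
Lemma measure_setD_eventually (D : set T) (G : nat -> set T) (eta : R) :
  measurable D -> (forall k, measurable (G k)) -> (mu D < +oo)%E ->
  (forall x, D x -> exists k0, forall k, (k0 <= k)%N -> G k x) ->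
  0 < eta -> exists k0, forall k, (k0 <= k)%N -> (mu (D `\` G k) <= eta%:E)%E.
Proof.
move=> mD mG Dfin DG eta0.
pose F k := \bigcup_(i >= k) (D `\` G i).
have mDG i : measurable (D `\` G i) by exact: measurableD.
have mF k : measurable (F k) by apply: bigcup_measurable.
have F0 : \bigcap_k F k = set0.
  apply/seteqP; split => // x Fx.
  have [i _ [Dx _]] := Fx 0%N I.
  have [k0 k0P] := DG _ Dx.
  have [j /= k0j [_ Gj]] := Fx k0 I.
  exact/Gj/k0P.
have : mu (F k) @[k --> \oo] --> mu (\bigcap_k F k).
  apply: nonincreasing_cvg_mu => //.
  - apply: le_lt_trans Dfin; apply: le_measure; rewrite ?inE//.
    by move=> x [i _ []].
  - by rewrite F0.
  - move=> i j ij; apply/subsetPset => x [k /= jk h]; exists k => //=.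
    exact: leq_trans jk.
rewrite F0 measure0 => /fine_cvgP[Ffin Fcvg].
have /cvgrPdist_lt/(_ _ eta0) Fcvg' := Fcvg.
have [k0 _ k0P] : \forall k \near \oo, mu (F k) \is a fin_num /\ `|0 - fine (mu (F k))| < eta.
  by near=> k; split; near: k.
exists k0 => k k0k; apply: (@le_trans _ _ (mu (F k))).
  by apply: le_measure; rewrite ?inE// => x h; exists k => /=.
have [fk] := k0P k k0k; rewrite sub0r normrN => h.
by rewrite -(fineK fk) lee_fin ltW// (le_lt_trans (ler_norm _)).
Unshelve. all: by end_near. Qed.

End finite_measure_facts.

Section packing.
Variables (R : realType) (n : nat) (Omega : set 'rV[R]_n) (x0 : 'rV[R]_n).
Variables (c : nat -> 'rV[R]_n) (s : nat -> R).
Hypothesis n_gt0 : (0 < n)%N.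
Hypothesis oO : open Omega.
Hypothesis wh : whitney Omega x0 c s.

(* Volume comparison: the halved cubes are disjoint, of side at least
   [bdist Omega x / (11 / 2 * n)], inside a cube of side [10 * bdist Omega x]. *)
Lemma whitney_overlap (x : 'rV[R]_n) (N : nat) :
  (\sum_(j < N) `[< cube (c j) (3 / 2 * s j) x >] <= (55 * n) ^ n)%N.
Proof.
pose P := [pred j : 'I_N | `[< cube (c j) (3 / 2 * s j) x >] ].
rewrite -big_mkcond/= sum1_card.
have s0 j : 0 < s j := whitney_side_gt0 wh j.
have [/eqP->//|] := boolP (#|P| == 0)%N.
rewrite -lt0n => /card_gt0P[j0 Pj0].
have near j : P j -> `|x - c j| <= 3 / 4 * s j.
  by move=> /asboolP/cubeE; rewrite mulr_ge0 ?(ltW (s0 j))// => /(_ isT); lra.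
have Ox : Omega x.
  apply: (whitney_sub2 wh (j := j0)); apply/cubeE; first by rewrite mulr_ge0// ltW.
  by have := near _ Pj0; have := s0 j0; lra.
have D1 j : P j -> s j <= 4 * bdist Omega x.
  by move=> /near; have := whitney_bdist_ge oO wh j Ox; lra.
have D2 j : P j -> bdist Omega x <= 11 / 4 * n%:R * s j.
  move=> /near h; apply: le_trans (whitney_bdist_le oO wh j Ox) _.
  by rewrite -mulrA mulrCA ler_wpM2l//; lra.
have D0 : 0 < bdist Omega x by have := D1 _ Pj0; have := s0 j0; lra.
pose F (j : 'I_N) : set (Rn R n) := cube (c j) (s j / 2).
have mF j : measurable (F j) by exact: measurable_cube.
have tF : trivIset setT F.
  move=> i j _ _ [z [Fi Fj]]; apply/eqP; apply: contraT => ij.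
  have [_ _ /(_ i j ij) dis _ _] := wh.
  suff : set0 z by [].
  by rewrite -dis; split; apply: ocube_sub_interior => //; exact: cube_sub_ocube.
have n0 : 0 < n%:R :> R by rewrite ltr0n.
have : (leb (\bigcup_(j in [set j | P j]) F j) <= leb (cube x (10 * bdist Omega x)))%E.
  apply: le_lebesgue_outer => z [j /= Pj Fj]; apply/cubeE; first by rewrite mulr_ge0// ltW.
  have /cubeE : cube (c j) (s j / 2) z by [].
  rewrite divr_ge0 ?(ltW (s0 j))// => /(_ isT).
  have := near _ Pj; have := D1 _ Pj; have := s0 j; have := ler_distD (c j) z x.
  by rewrite (distrC (c j) x); lra.
rewrite measure_bigcup_fintype// leb_cube ?mulr_ge0 ?(ltW D0)//.
under eq_bigr do rewrite leb_cube ?divr_ge0 ?(ltW (s0 _))//.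
rewrite sumEFin lee_fin => h.
have : #|P|%:R * (bdist Omega x / (11 / 2 * n%:R)) ^+ n <= (10 * bdist Omega x) ^+ n.
  apply: le_trans h; rewrite mulr_natl -sumr_const; apply: ler_sum => j Pj.
  rewrite lerXn2r ?nnegrE ?divr_ge0 ?mulr_ge0 ?(ltW D0) ?(ltW (s0 j)) ?(ltW n0)//.
  by rewrite ler_pdivrMr ?mulr_gt0//; have := D2 _ Pj; lra.
set a := bdist Omega x / _ => ha.
have a0 : 0 < a by rewrite divr_gt0// mulr_gt0.
have : (10 * bdist Omega x) ^+ n = (55 * n%:R) ^+ n * a ^+ n.
  by rewrite -exprMn /a; congr (_ ^+ _); field; rewrite gt_eqF.
move=> E; move: ha; rewrite E ler_pM2r ?exprn_gt0//.
by rewrite -natrM -natrX ler_nat.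
Qed.

End packing.

Lemma path_map_iota (V : eqType) (e : rel V) (h : nat -> V) K a :
  (forall i, (a <= i < a + K)%N -> e (h i) (h i.+1)) ->
  path e (h a) (map h (iota a.+1 K)) /\ last (h a) (map h (iota a.+1 K)) = h (a + K)%N.
Proof.
elim: K a => [|K IH] a he /=; first by rewrite addn0.
have [|-> ->] := IH a.+1.
  by move=> i /andP[ai iK]; apply: he; rewrite (ltnW ai) addnS.
by rewrite he ?addSnnS// leqnn addnS ltnS leq_addr.
Qed.

(** * From the paths to a flow on finitely many cells *)

Section discrete_flow.
Variables (R : realType) (n : nat) (Omega : set 'rV[R]_n) (x0 : 'rV[R]_n).
Variable gamma : R -> 'rV[R]_n -> 'rV[R]_n.
Variables (E : nat -> set 'rV[R]_n) (adj : rel nat).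
Hypothesis Omega_fin : (leb Omega < +oo)%E.
Hypothesis mOmega : measurable (Omega : set (Rn R n)).
Hypothesis E_cover : \bigcup_k E k = Omega.
Hypothesis E_inj : forall x k l, E k x -> E l x -> k = l.
Hypothesis mE : forall k, measurable (E k : set (Rn R n)).
Hypothesis gamma0 : forall y, Omega y -> gamma 0 y = y.
Hypothesis gamma1 : forall y, Omega y -> gamma 1 y = x0.
Hypothesis gammaO : forall (r : R) y, 0 <= r <= 1 -> Omega y -> Omega (gamma r y).
Hypothesis mEgamma : forall (r : R) k, 0 <= r <= 1 ->
  measurable (Omega `&` [set y | E k (gamma r y)] : set (Rn R n)).
Hypothesis gamma_adj : forall y, Omega y -> exists K0, forall K, (K0 <= K)%N ->
  forall i, (i < K)%N -> forall k l, E k (gamma (i%:R / K%:R) y) ->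
  E l (gamma (i.+1%:R / K%:R) y) -> adj k l.
Hypothesis gamma_visit : forall y (r : R) k x, Omega y -> 0 <= r <= 1 ->
  E k (gamma r y) -> E k x ->
  (gdist_path Omega (gamma ^~ y) x <= (bdist Omega x / 2)%:E)%E.

Let leb_fin (A : set 'rV[R]_n) : A `<=` Omega -> (leb A)%E = (fine (leb A))%:E.
Proof.
move=> AO; rewrite fineK// ge0_fin_numE ?measure_ge0//.
by apply: le_lt_trans Omega_fin; exact: le_lebesgue_outer.
Qed.

Let C r k : set (Rn R n) := Omega `&` [set y | E k (gamma r y)].

(** The starting points for which [K] equal time steps move only between adjacent cells. By
    [gamma_adj] each point is good for all large [K], with a threshold that depends on the point. *)
Let Good K : set (Rn R n) := Omega `\` \bigcup_(i in `I_K) \bigcup_k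
  \bigcup_(l in [set l | ~~ adj k l]) (C (i%:R / K%:R) k `&` C (i.+1%:R / K%:R) l).

Let frac01 i K : (0 < K)%N -> (i <= K)%N -> 0 <= (i%:R / K%:R : R) <= 1.
Proof.
move=> K0 iK; rewrite divr_ge0//= ler_pdivrMr ?ltr0n//.
by rewrite mul1r ler_nat.
Qed.

Let mGood K : measurable (Good K).
Proof.
case: K => [|K].
  by rewrite /Good bigcup0 ?setD0// => i.
apply: measurableD => //; apply: bigcup_measurable => i /= iK.
apply: bigcup_measurable => k _; apply: bigcup_measurable => l _.
by apply: measurableI; apply: mEgamma; apply: frac01 => //; exact: ltnW.
Qed.

Let Y K N : set (Rn R n) := Good K `&` \bigcap_(i in `I_K.+1)
  \bigcup_(k in `I_N) C (i%:R / K%:R) k.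

Let mY K N : (0 < K)%N -> measurable (Y K N).
Proof.
move=> K0; apply: measurableI => //.
apply: bigcap_measurable => [|i /= iK]; first by exists 0%N.
by apply: bigcup_measurable => k _; apply: mEgamma; exact: frac01.
Qed.

Let YO K N : Y K N `<=` Omega. Proof. by move=> y [[]]. Qed.

Let exists_Y (N0 : nat) (eta : R) : 0 < eta -> exists K N,
  [/\ (0 < K)%N, (N0 <= N)%N & (leb (Omega `\` Y K N) <= eta%:E)%E].
Proof.
move=> eta0; have eta2 : 0 < eta / 2 by rewrite divr_gt0.
have [|k1 k1P] := @measure_setD_eventually _ _ _ leb Omega Good (eta / 2)
  mOmega mGood Omega_fin _ eta2.
  move=> y Oy; have [K0 K0P] := gamma_adj Oy.
  exists K0 => K KK; split => // -[i /= iK [k _ [l /= /negP nadj [[_ hk] [_ hl]]]]].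
  by apply: nadj; exact: (K0P K KK i iK k l hk hl).
(* The successor keeps [K] positive, so that the sample times [i / K] end at 1. *)
pose K := k1.+1.
have GoodO : Good K `<=` Omega by move=> y [].
have [|//|k2 k2P] := @measure_setD_eventually _ _ _ leb (Good K) (Y K) (eta / 2)
  (mGood K) (fun N => @mY K N (ltn0Sn _)) _ _ eta2.
- by apply: le_lt_trans Omega_fin; exact: le_lebesgue_outer.
- move=> y Gy; have Oy := GoodO _ Gy.
  have ex (i : 'I_K.+1) : exists k, E k (gamma (i%:R / K%:R) y).
    have : Omega (gamma (i%:R / K%:R) y) by have := frac01 (ltn0Sn k1) (ltn_ord i : (i <= K)%N);
      move=> h; exact: gammaO.
    by rewrite -E_cover => -[k _ Ek]; exists k.
  have [f fP] := fin_all_exists ex.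
  exists (\max_i (f i).+1)%N => N fN; split => // i /= iK.
  exists (f (Ordinal iK)); last by split => //; exact: (fP (Ordinal iK)).
  by apply: leq_trans fN; exact: (leq_bigmax (Ordinal iK)).
exists K, (maxn N0 k2); split => //; first exact: leq_maxl.
set N := maxn _ _.
have mYN : measurable (Y K N) by exact: mY.
have sub : Omega `\` Y K N `<=` (Omega `\` Good K) `|` (Good K `\` Y K N).
  by move=> y [Oy Yy]; case: (pselect (Good K y)) => [Gy|Gy]; [right|left].
apply: (@le_trans _ _ (leb ((Omega `\` Good K) `|` (Good K `\` Y K N)))).
  exact: le_lebesgue_outer.
apply: le_trans (measureU2 _ _ _) _; try exact: measurableD.
rewrite [eta]splitr EFinD leeD//; first exact: k1P (leqnSn _).
by apply: k2P; exact: leq_maxr.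
Qed.

(** Up to measure [eta], starting points are sorted by their sampled sequence of cells, and the
    loop-erased flow of these classes is taken. A dropped point is counted in [M] only in its own
    cell, as [lost]. For the weight bound, every point counted in [M k] has a path that meets cell
    [k]. *)
Lemma discrete_flow (r0 N0 : nat) (eta : R) : E r0 x0 -> (r0 < N0)%N -> 0 < eta ->
  exists (N : nat) (m : 'I_N -> 'I_N -> R) (M lost : 'I_N -> R),
  [/\ (N0 <= N)%N,
      (forall k l, 0 <= m k l) /\ (forall k l : 'I_N, m k l != 0 -> adj k l),
      [/\ forall k, 0 <= lost k, forall k : 'I_N, lost k <= fine (leb (E k)) &
          \sum_k lost k <= eta],
      (forall k : 'I_N, M k = fine (leb (E k)) + \sum_l m l k) /\
      (forall k, \sum_l m k l = if val k == r0 then 0 else M k - lost k) &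
      forall (k : 'I_N) x, E k x -> M k <= weight Omega gamma x].
Proof.
move=> Er0 r0N0 eta0.
have [K [N [K_gt0 N0N YN]]] := exists_Y N0 eta0.
have r0N : (r0 < N)%N by exact: leq_trans N0N.
pose root : 'I_N := Ordinal r0N.
pose W := {ffun 'I_K.+1 -> 'I_N}.
(* The sets [Tr f] partition [Y K N] measurably into finitely many classes, one for each sampled
   trajectory. *)
pose Tr (f : W) : set (Rn R n) :=
  Y K N `&` \bigcap_(i in [set: 'I_K.+1]) C (i%:R / K%:R) (f i).
have mYN : measurable (Y K N) by exact: mY.
have TrO f : Tr f `<=` Omega by move=> y [/YO].
have mTr f : measurable (Tr f).
  apply: measurableI => //; apply: fin_bigcap_measurable => // i _.
  by apply: mEgamma; exact: (frac01 K_gt0 (ltn_ord i)).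
have tTr : trivIset setT Tr.
  move=> f g _ _ [y [[_ fy] [_ gy]]]; apply/ffunP => i; apply: val_inj.
  by apply: E_inj (fy i I).2 (gy i I).2.
have exTr y : Y K N y -> exists f, Tr f y.
  move=> Yy; have ex (i : 'I_K.+1) : exists k : 'I_N, C (i%:R / K%:R) k y.
    have [_ /(_ i (ltn_ord i))[k /= kN Ck]] := Yy.
    by exists (Ordinal kN).
  have [f fP] := fin_all_exists ex.
  by exists [ffun i => f i]; split => // i _; rewrite ffunE.
pose h (f : W) i := f (inord i).
pose w f := fine (leb (Tr f)).
have w_ge0 f : 0 <= w f by exact: fine_ge0.
pose p (f : W) := map (h f) (iota 1 K).
have wp f : w f != 0 -> path [rel k l : 'I_N | adj k l] (h f 0%N) (p f) /\
    last (h f 0%N) (p f) = root.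
  move=> wf; have [y Ty] : Tr f !=set0.
    by apply/set0P; apply: contra wf => /eqP Tf; rewrite /w Tf measure0.
  have [[[Oy Gy] _] Cy] := Ty.
  have Ch i : (i <= K)%N -> C (i%:R / K%:R) (h f i) y.
    by move=> iK; have := Cy (inord i) I; rewrite inordK.
  have [|-> ->] := @path_map_iota _ [rel k l : 'I_N | adj k l] (h f) K 0%N.
    rewrite add0n => i /andP[_ iK] /=; apply: contraT => nadj; exfalso; apply: Gy.
    exists i => //; exists (h f i) => //; exists (h f i.+1) => //.
    by split; apply: Ch => //; exact: ltnW.
  split=> //; apply: val_inj => /=; apply: E_inj Er0.
  have [_ /=] := Ch K (leqnn K).
  by rewrite divff ?gamma1// pnatr_eq0 -lt0n.
have [m [V [m0 madj VE mout Vle]]] := loop_erased_flow w_ge0 wp.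
pose lost (k : 'I_N) := fine (leb (E k `\` Y K N)).
have EO k : E k `<=` Omega by rewrite -E_cover => y Ey; exists k.
have EYO k : E k `\` Y K N `<=` Omega by move=> y [/EO].
have mEY k : measurable (E k `\` Y K N : set (Rn R n)) by exact: measurableD.
have sumw (P : pred W) (A : set (Rn R n)) : A `<=` Omega ->
    \bigcup_(f in [set f | P f]) Tr f = A -> \sum_(f | P f) w f = fine (leb A).
  move=> AO AE; apply: EFin_inj; rewrite -(leb_fin AO) -AE measure_bigcup_fintype//.
  by rewrite -sumEFin; apply: eq_bigr => f _; rewrite [RHS]leb_fin.
exists N, m, (fun k => V k + lost k), lost; split.
- exact: N0N.
- by split => // k l /madj.
- split => [k|k|]; first exact: fine_ge0.
    rewrite -lee_fin -!leb_fin//.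
    by apply: le_lebesgue_outer => y [].
  rewrite -lee_fin -sumEFin; apply: le_trans YN.
  under eq_bigr do rewrite -leb_fin//.
  rewrite -(@measure_bigcup_fintype _ _ _ leb 'I_N xpredT (fun k => E k `\` Y K N))//.
    by apply: le_lebesgue_outer => y [k _ [/EO Oy Yy]].
  by move=> k l _ _ [y [[yk _] [yl _]]]; apply: val_inj; exact: E_inj yk yl.
- split=> k; last first.
    by rewrite mout addrK.
  rewrite VE addrAC; congr (_ + _).
  rewrite (@sumw _ (E k `&` Y K N)) => [||]; first last.
  + apply/seteqP; split => y /=.
      move=> [f /eqP fk Tf]; split; last by case: Tf.
      have [Oy] := Tf.2 (inord 0) I.
      rewrite /= inordK// mul0r gamma0 -?fk//.
    move=> [Ek Yy]; have [f Tf] := exTr _ Yy; exists f => //; apply/eqP/val_inj.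
    have [Oy] := Tf.2 (inord 0) I; rewrite /= inordK// mul0r gamma0// => Ef.
    exact: E_inj Ef Ek.
  + by move=> y [/EO].
  apply: EFin_inj; rewrite EFinD -!leb_fin//; last by move=> y [/EO].
  by rewrite addeC; apply/esym; exact: measureDI.
- move=> k x Ekx.
  (* [A] collects the kept points whose trajectory visits [k]. It is disjoint from the dropped
     points of cell [k], and both sets lie in the set that defines the weight at [x]. *)
  pose A : set (Rn R n) := \bigcup_(f in [set f : W | k \in h f 0%N :: p f]) Tr f.
  have AO : A `<=` Omega by move=> y [f _ /TrO].
  have mA : measurable A by apply: fin_bigcup_measurable => //;
    exact: (finite_finpred [pred f : W | k \in h f 0%N :: p f]).
  have AY : A `<=` Y K N by move=> y [f _ []].
  apply: (@le_trans _ _ (fine (leb A) + lost k)).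
    by rewrite lerD2r -(@sumw (fun f : W => k \in h f 0%N :: p f) A).
  pose S := [set y | Omega y /\ (gdist_path Omega (gamma ^~ y) x <= (bdist Omega x / 2)%:E)%E].
  have SO : S `<=` Omega by move=> y [].
  rewrite /weight -/S -lee_fin EFinD -!leb_fin// -measureU//.
    apply: le_lebesgue_outer => y [[f /= kf Tf]|[Ek _]].
      have Oy := TrO _ _ Tf; split => //.
      have [i iK kE] : exists2 i, (i <= K)%N & k = h f i.
        move: kf; rewrite inE => /predU1P[->|/mapP[i]]; first by exists 0%N.
        by rewrite mem_iota add1n ltnS => /andP[_ iK] ->; exists i.
      have := (Tf.2 (inord i) I).2; rewrite /= inordK// -/(h f i) -kE => Eki.
      exact: (gamma_visit Oy (frac01 K_gt0 iK) Eki Ekx).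
    have Oy := EO _ _ Ek; split => //.
    by apply: (@gamma_visit y 0 k) => //; rewrite ?lexx ?ler01// gamma0.
  by apply/seteqP; split => // y [/AY Yy [_]]; exact.
Qed.

End discrete_flow.

(** * Transport of the cell averages along the flow *)

Section stage_flow.
Variables (R : realType) (v wt : nat -> R) (adj : rel nat) (r0 : nat).
Hypothesis v_gt0 : forall k, 0 < v k.
Hypothesis flow : forall N0 (eta : R), (r0 < N0)%N -> 0 < eta ->
  exists (N : nat) (m : 'I_N -> 'I_N -> R) (M lost : 'I_N -> R),
  [/\ (N0 <= N)%N,
      (forall k l, 0 <= m k l) /\ (forall k l : 'I_N, m k l != 0 -> adj k l),
      [/\ forall k, 0 <= lost k, forall k : 'I_N, lost k <= v k &
          \sum_k lost k <= eta],
      (forall k : 'I_N, M k = v k + \sum_l m l k) /\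
      (forall k, \sum_l m k l = if val k == r0 then 0 else M k - lost k) &
      forall k : 'I_N, M k <= wt k].

(* [phi k l] is the signed mass sent from cell [k] to cell [l]; the density
   [beta] is what this transport fails to bring to the root cell. *)
Lemma stage_transport (p : R) (N0 : nat) (a : nat -> R) (alpha eta : R) :
  1 < p -> (r0 < N0)%N -> 0 < eta -> (forall k, `|a k| <= alpha) ->
  exists (N : nat) (phi : 'I_N -> 'I_N -> R) (A beta : 'I_N -> R),
  [/\ (N0 <= N)%N, forall k l : 'I_N, phi k l != 0 -> adj k l,
      [/\ forall k, 0 <= A k,
          forall k : 'I_N, \sum_l `|phi k l| + \sum_l `|phi l k| <= 2 * (wt k * A k) &
          \sum_(k < N) v k * A k `^ p <= 2 `^ p / (p - 1) * \sum_(k < N) v k * `|a k| `^ p],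
      forall k : 'I_N, v k * beta k = v k * a k - (\sum_l phi k l - \sum_l phi l k) &
      \sum_(k < N | val k != r0) v k * `|beta k| `^ p <= alpha `^ p * eta /\
      forall k : 'I_N, val k = r0 ->
        v k * `|beta k| <= `|\sum_(i < N) v i * a i| + alpha * eta].
Proof.
move=> p1 r0N0 eta0 a_le.
have alpha0 : 0 <= alpha by apply: le_trans (a_le 0%N).
have [N [m [M [lost [N0N [m0 madj] [lost0 lost_v lost_eta] [ME mout] Mwt]]]]] :=
  flow r0N0 eta0.
have vN (k : 'I_N) : 0 < v k by [].
have M0 k : 0 <= M k by rewrite ME addr_ge0 ?(ltW (vN _))// sumr_ge0.
have M_out k : \sum_l m k l <= M k.
  by rewrite mout; case: ifP => // _; rewrite lerBlDr lerDl.
have [A AE] := chain_solvable m0 vN ME (fun k => a k).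
(* [A] carries the signed mass, [B] its majorant with data [|a k|]; the [A] of the conclusion is
   [B], to which the Hardy bound applies. *)
have [B BE] := chain_solvable m0 vN ME (fun k => `|a k|).
have minp := chain_min_principle m0 vN ME.
have B0 k : 0 <= B k.
  by apply: minp => j; rewrite BE lerDr mulr_ge0// ltW.
(* Comparison: the minimum principle holds for [B + A] and [B - A], whose data are nonnegative. *)
have AB k : `|A k| <= B k.
  rewrite ler_norml -subr_ge0 opprK -(subr_ge0 (A k)); apply/andP; split.
    rewrite addrC; apply: (minp (fun k => B k + A k)) => j.
    rewrite mulrDr BE AE addrACA -mulrDr; under eq_bigr do rewrite mulrDr.
    rewrite big_split/= lerDr mulr_ge0 ?(ltW (vN _))//.
    by rewrite -lerBlDr sub0r -normrN ler_norm.
  apply: (minp (fun k => B k - A k)) => j.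
  rewrite mulrBr BE AE opprD addrACA -mulrBr; under eq_bigr do rewrite mulrBr.
  by rewrite sumrB lerDr mulr_ge0 ?(ltW (vN _))// subr_ge0 ler_norm.
(* By [M_in], the constant [alpha] solves the system with data [alpha], so it dominates [B]. *)
have B_le k : B k <= alpha.
  rewrite -subr_ge0; apply: (minp (fun k => alpha - B k)) => j.
  rewrite mulrBr BE {1}ME opprD; under eq_bigr do rewrite mulrBr.
  rewrite sumrB -mulr_suml mulrDl addrACA -mulrBr lerDr.
  by rewrite mulr_ge0 ?(ltW (vN _))// subr_ge0.
pose phi k l := m k l * A k.
pose beta (k : 'I_N) := a k - (\sum_l phi k l - \sum_l phi l k) / v k.
have betaE (k : 'I_N) : v k * beta k = v k * a k - (\sum_l phi k l - \sum_l phi l k).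
  by rewrite /beta mulrBr [_ * (_ / _)]mulrC divfK// gt_eqF.
have inE k : \sum_l phi l k = M k * A k - v k * a k by rewrite AE addrC addKr.
have outE k : \sum_l phi k l = if val k == r0 then 0 else (M k - lost k) * A k.
  by rewrite /phi -mulr_suml mout; case: ifP; rewrite ?mul0r.
(* Away from the root the flow is balanced except for the lost mass, and the residue is exactly that
   mass times the mixed value. *)
have beta_lost (k : 'I_N) : val k != r0 -> v k * beta k = lost k * A k.
  by move=> /negbTE kr; rewrite betaE inE outE kr; ring.
exists N, phi, B, beta; split => //.
- by move=> k l; rewrite mulf_eq0 negb_or => /andP[/madj].
- split=> [//|k|].
    have -> : 2 * (wt k * B k) = wt k * B k + wt k * B k by rewrite mulr_natl mulr2n.
    apply: lerD.
      under eq_bigr do rewrite normrM ger0_norm//.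
      rewrite -mulr_suml; apply: ler_pM => //; first exact: sumr_ge0.
      exact: le_trans (M_out _) (Mwt _).
    apply: (@le_trans _ _ (\sum_l m l k * B l)).
      by apply: ler_sum => l _; rewrite normrM ger0_norm// ler_wpM2l.
    apply: (@le_trans _ _ (M k * B k)); last by rewrite ler_wpM2r.
    by rewrite BE lerDr mulr_ge0// ltW.
  exact: (chain_hardy m0 vN ME M_out p1 (fun k => normr_ge0 (a k)) B0 BE).
split.
  apply: (@le_trans _ _ (\sum_(k < N) alpha `^ p * lost k)); last first.
    by rewrite -mulr_sumr ler_wpM2l ?powR_ge0.
  rewrite [leLHS]big_mkcond; apply: ler_sum => k _; case: ifPn => [kr|_]; last first.
    by rewrite mulr_ge0 ?powR_ge0.
  have -> : `|beta k| = (lost k / v k) * `|A k|.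
    apply: (mulfI (_ : v k != 0)); first by rewrite gt_eqF.
    rewrite -{1}(gtr0_norm (vN k)) -normrM beta_lost// normrM ger0_norm//.
    by rewrite mulrA [v k * _]mulrC divfK// gt_eqF.
  have q0 : 0 <= lost k / v k by rewrite divr_ge0// ltW.
  have p0 : 0 <= p by lra.
  rewrite powRM// mulrA [leRHS]mulrC; apply: ler_pM.
  - by rewrite mulr_ge0 ?powR_ge0// ltW.
  - exact: powR_ge0.
  (* Since [lost k <= v k], the ratio is at most 1 and its power [p] is at most the ratio itself;
     this makes the error linear in [lost]. *)
  - have [->|lk] := eqVneq (lost k) 0.
      by rewrite mul0r powR0 ?mulr0// gt_eqF//; lra.
    apply: (@le_trans _ _ (v k * (lost k / v k))).
      rewrite ler_wpM2l ?(ltW (vN _))// ge1r_powR//; last exact: ltW.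
      rewrite divr_gt0//= ?ler_pdivrMr// ?mul1r//.
      by rewrite lt_neqAle lost0 eq_sym lk.
    by rewrite mulrC divfK// gt_eqF.
  - by apply: ge0_ler_powR; rewrite ?nnegrE//; exact: le_trans (AB k) (B_le k).
move=> k kr.
(* Transfers cancel in pairs, so total mass is conserved; the root residue is the total minus the
   small residues elsewhere. *)
have tot : \sum_(i < N) v i * beta i = \sum_(i < N) v i * a i.
  under eq_bigr do rewrite betaE; rewrite sumrB sumrB.
  by rewrite [X in _ - (X - _)]exchange_big subrr subr0.
rewrite -{1}(gtr0_norm (vN k)) -normrM.
have -> : v k * beta k = \sum_(i < N) v i * a i - \sum_(i < N | i != k) v i * beta i.
  by rewrite -tot [X in _ = X - _](bigD1 k)//= addrK.
apply: le_trans (ler_normB _ _) _; rewrite lerD2l.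
apply: le_trans (ler_norm_sum _ _ _) _.
apply: (@le_trans _ _ (\sum_(i < N | i != k) alpha * lost i)).
  apply: ler_sum => i ik; rewrite beta_lost; last first.
    by apply: contra ik => /eqP ir; apply/eqP/val_inj; rewrite kr.
  rewrite normrM ger0_norm// mulrC ler_wpM2r//.
  exact: le_trans (AB i) (B_le i).
rewrite -mulr_sumr ler_wpM2l//; apply: le_trans lost_eta.
by rewrite [leRHS](bigD1 k)//= lerDr.
Qed.

End stage_flow.

(** * One approximation stage *)

Section cell_family.
Context d (T : measurableType d) (R : realType).
Variable mu : {measure set T -> \bar R}.
Variables (O : set T) (E : nat -> set T).
Hypothesis mE : forall k, measurable (E k).
Hypothesis tE : trivIset setT E.
Hypothesis EO : \bigcup_k E k = O.
Hypothesis muO : (mu O < +oo)%E.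

Let E_inj x k l : E k x -> E l x -> k = l.
Proof. by move=> xk xl; apply: (tE I I); exists x. Qed.

(** Outside [O] the index takes the default value 0. *)
Definition cell_index (x : T) : nat := xget 0%N [set k | E k x].

Lemma cell_indexE k x : E k x -> cell_index x = k.
Proof.
by move=> Ek; rewrite /cell_index; case: xgetP => [l _ El|/(_ k)//]; exact: E_inj El Ek.
Qed.

Lemma cell_indexP x : O x -> E (cell_index x) x.
Proof. by rewrite -EO => -[k _ Ek]; rewrite (cell_indexE Ek). Qed.

Lemma cell_family_sub k : E k `<=` O.
Proof. by rewrite -EO => x Ek; exists k. Qed.

Lemma measurable_cell_family : measurable O.
Proof. by rewrite -EO; exact: bigcupT_measurable. Qed.

Lemma measurable_step (u : nat -> R) : measurable_fun O (fun x => u (cell_index x)).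
Proof.
move=> mO B mB.
have -> : O `&` (fun x => u (cell_index x)) @^-1` B = \bigcup_(k in [set k | B (u k)]) E k.
  apply/seteqP; split => x /=.
    by move=> [Ox Bu]; exists (cell_index x) => //; exact: cell_indexP.
  by move=> [k /= Bk Ek]; rewrite /preimage/= (cell_indexE Ek); split => //;
    exact: cell_family_sub Ek.
by apply: bigcup_measurable => k _; exact: mE.
Qed.

Lemma ge0_integral_cells (h : T -> R) :
  measurable_fun O h -> (forall x, O x -> 0 <= h x) ->
  (\int[mu]_(x in O) (h x)%:E = \sum_(k <oo) \int[mu]_(x in E k) (h x)%:E)%E.
Proof.
move=> mh h0; rewrite -EO ge0_integral_bigcup//.
- by rewrite EO; exact/measurable_EFinP.
- by rewrite EO => x Ox; rewrite lee_fin h0.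
Qed.

Let mu_fin k : (mu (E k) < +oo)%E.
Proof.
apply: le_lt_trans muO; apply: le_measure; rewrite ?inE//.
  exact: measurable_cell_family.
exact: cell_family_sub.
Qed.

Lemma mu_cellE k : mu (E k) = (fine (mu (E k)))%:E.
Proof. by rewrite fineK// ge0_fin_numE. Qed.

Lemma integral_cell_cst k (u : T -> R) r : (forall x, E k x -> u x = r) ->
  (\int[mu]_(x in E k) (u x)%:E = (r * fine (mu (E k)))%:E)%E.
Proof.
move=> ur; rewrite (eq_integral (fun=> r%:E)); last first.
  by move=> x /set_mem Ex; rewrite ur.
by rewrite integral_cst// EFinM mu_cellE.
Qed.

Lemma integral_step_le (h : T -> R) (u : nat -> R) N :
  measurable_fun O h -> (forall x, O x -> 0 <= h x) ->
  (forall k x, E k x -> h x <= u k) -> (forall k, (N <= k)%N -> u k <= 0) ->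
  (\int[mu]_(x in O) (h x)%:E <= (\sum_(k < N) fine (mu (E k)) * u k)%:E)%E.
Proof.
move=> mh h0 hu uN; rewrite ge0_integral_cells//.
have int_le k : (\int[mu]_(x in E k) (h x)%:E <= (fine (mu (E k)) * u k)%:E)%E.
  have Oh : measurable_fun (E k) (EFin \o h).
    apply/measurable_EFinP; apply: measurable_funS mh => //.
      exact: measurable_cell_family.
    exact: cell_family_sub.
  rewrite mulrC -(@integral_cell_cst k (fun=> u k))//.
  apply: ge0_le_integral => //.
  - by move=> x /cell_family_sub/h0; rewrite lee_fin.
  - by move=> x /hu; rewrite lee_fin.
rewrite (nneseries_split 0 N); last first.
  by move=> k _; apply: integral_ge0 => x /cell_family_sub/h0; rewrite lee_fin.
rewrite add0n [X in (_ + X)%E]eseries0 ?adde0.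
  rewrite big_mkord -sumEFin; apply: lee_sum => k _; exact: int_le.
move=> k Nk _; apply/eqP; rewrite eq_le; apply/andP; split; last first.
  by apply: integral_ge0 => x /cell_family_sub/h0; rewrite lee_fin.
apply: le_trans (int_le k) _; by rewrite lee_fin mulr_ge0_le0 ?uN// fine_ge0.
Qed.

Variable p : R.
Hypothesis p1 : 1 < p.

Let p0 : 0 < p. Proof. by apply: lt_trans p1. Qed.

Lemma ler_1D_powR (t : R) : 0 <= t -> t <= 1 + t `^ p.
Proof.
move=> t0; have [t1|/ltW t1] := leP t 1; first by rewrite ler_wpDr// powR_ge0.
by rewrite ler_wpDl// le1r_powR// ltW.
Qed.

Lemma measurable_abs_powR (D : set T) (g : T -> R) :
  measurable_fun D g -> measurable_fun D (fun x => `|g x| `^ p).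
Proof.
move=> mg; apply: (measurableT_comp (measurable_powR p)).
by apply: measurableT_comp mg; exact: normr_measurable.
Qed.

Lemma Lp_integrable (g : T -> R) : measurable_fun O g ->
  (\int[mu]_(x in O) (`|g x| `^ p)%:E < +oo)%E -> mu.-integrable O (EFin \o g).
Proof.
move=> mg gp; have mO := measurable_cell_family.
apply: (@le_integrable _ _ _ mu _ mO _ (EFin \o (fun x => 1 + `|g x| `^ p))).
- exact/measurable_EFinP.
- by move=> x _ /=; rewrite lee_fin [leRHS]ger0_norm ?ler_1D_powR.
have -> : EFin \o (fun x => 1 + `|g x| `^ p) =
    (EFin \o cst 1) \+ (fun x => (`|g x| `^ p)%:E).
  by apply/funext => x /=; rewrite EFinD.
apply: integrableD => //.
  apply/integrableP; split; first exact/measurable_EFinP.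
  under eq_integral do rewrite /= normr1.
  by rewrite integral_cst// mul1e.
apply/integrableP; split.
  by apply/measurable_EFinP; exact: measurable_abs_powR.
by under eq_integral do rewrite /= ger0_norm ?powR_ge0//.
Qed.

(* Uses the tangent line of [t `^ p] at the mean. *)
Lemma jensen_cell (g : T -> R) k : measurable_fun O g ->
  (\int[mu]_(x in O) (`|g x| `^ p)%:E < +oo)%E -> 0 < fine (mu (E k)) ->
  ((fine (mu (E k)) * `|fine (\int[mu]_(x in E k) (g x)%:E) / fine (mu (E k))| `^ p)%:E
    <= \int[mu]_(x in E k) (`|g x| `^ p)%:E)%E.
Proof.
move=> mg gp v0; set v := fine (mu (E k)); set I := fine _.
have mO := measurable_cell_family.
have mgk : measurable_fun (E k) g.
  by apply: measurable_funS mg => //; exact: cell_family_sub.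
have ig : mu.-integrable (E k) (EFin \o g).
  by apply: integrableS (Lp_integrable mg gp) => //; exact: cell_family_sub.
pose a : R := `|I / v|; have a0 : 0 <= a by exact: normr_ge0.
have Ia : v * a = `|I| by rewrite /a normrM normfV (gtr0_norm v0) mulrC divfK// gt_eqF.
have Ile : (`|I|%:E <= \int[mu]_(x in E k) `|g x|%:E)%E.
  rewrite -abse_EFin /I fineK ?integrable_fin_num//.
  have /measurable_EFinP mgE := mgk.
  exact: (le_abse_integral mu (mE k) mgE).
have tang t : 0 <= t -> p * a `^ (p - 1) * t <= t `^ p + (p - 1) * a `^ p.
  move=> t0; have := young_powR_pred t0 a0 p1 => /(ler_wpM2l (ltW p0)).
  rewrite mulrDr !mulrA divff ?gt_eqF// mul1r mulrBr mulr1 divff ?gt_eqF//.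
  by apply: le_trans; rewrite mulrAC.
have : ((p * a `^ (p - 1))%:E * \int[mu]_(x in E k) `|g x|%:E <=
    \int[mu]_(x in E k) (`|g x| `^ p)%:E + ((p - 1) * a `^ p * v)%:E)%E.
  rewrite -ge0_integralZl_EFin//; last 2 first.
  - by apply/measurable_EFinP; apply: measurableT_comp mgk; exact: normr_measurable.
  - by rewrite mulr_ge0 ?powR_ge0// ltW.
  rewrite -(@integral_cell_cst k (fun=> (p - 1) * a `^ p))//.
  rewrite -ge0_integralD//; last 2 first.
  - by apply/measurable_EFinP; exact: measurable_abs_powR.
  - by move=> x _; rewrite lee_fin mulr_ge0 ?powR_ge0// subr_ge0 ltW.
  apply: ge0_le_integral => //.
  - by move=> x _; rewrite -EFinM lee_fin !mulr_ge0 ?powR_ge0// ltW.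
  - apply/measurable_EFinP; apply: measurable_funM => //.
    by apply: measurableT_comp mgk; exact: normr_measurable.
  - apply: emeasurable_funD; last exact/measurable_EFinP.
    by apply/measurable_EFinP; exact: measurable_abs_powR.
  - by move=> x _; rewrite -EFinM -EFinD lee_fin tang.
have : (0 <= \int[mu]_(x in E k) (`|g x| `^ p)%:E)%E.
  by apply: integral_ge0 => x _; rewrite lee_fin powR_ge0.
case: (\int[mu]_(x in E k) (`|g x| `^ p)%:E)%E => [r _|_ _|//]; last by rewrite leey.
move=> h; rewrite lee_fin.
have : ((p * a `^ (p - 1))%:E * `|I|%:E <= r%:E + ((p - 1) * a `^ p * v)%:E)%E.
  by apply: le_trans h; rewrite lee_wpmul2l// lee_fin mulr_ge0 ?powR_ge0// ltW.
rewrite -EFinM -EFinD lee_fin -Ia -/a.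
have -> : p * a `^ (p - 1) * (v * a) = p * v * a `^ p.
  by rewrite -(mulr_powRB1 a0 p0); ring.
lra.
Qed.

Lemma integral_tail (h : T -> R) (e : R) : measurable_fun O h ->
  (forall x, O x -> 0 <= h x) -> (\int[mu]_(x in O) (h x)%:E < +oo)%E -> 0 < e ->
  exists N0, forall N, (N0 <= N)%N ->
  (\int[mu]_(x in O) ((N <= cell_index x)%:R * h x)%:E <= e%:E)%E.
Proof.
move=> mh h0 hfin e0.
pose u k : \bar R := (\int[mu]_(x in E k) (h x)%:E)%E.
have u0 k : (0 <= u k)%E.
  by apply: integral_ge0 => x /cell_family_sub/h0; rewrite lee_fin.
have ufin : (\sum_(k <oo) u k < +oo)%E by rewrite -ge0_integral_cells.
have := nneseries_tail_cvg ufin (fun k _ => u0 k).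
move=> /fine_cvgP[Ffin /cvgrPdist_lt/(_ _ e0) Fcvg].
have [N0 _ N0P] : \forall N \near \oo, (\sum_(N <= k <oo) u k)%E \is a fin_num /\
    `|0 - fine (\sum_(N <= k <oo) u k)%E| < e.
  by near=> N; split; near: N.
exists N0 => N /N0P[fN lN].
rewrite ge0_integral_cells; last 2 first.
- by apply: measurable_funM => //; exact: (measurable_step (fun k => (N <= k)%:R)).
- by move=> x Ox; rewrite mulr_ge0// h0.
rewrite (nneseries_split 0 N); last first.
  by move=> k _; apply: integral_ge0 => x /cell_family_sub/h0 hx; rewrite lee_fin mulr_ge0.
rewrite add0n big_mkord big1 ?add0e; last first.
  move=> k _; apply: integral0_eq => x Ek.
  by rewrite (cell_indexE Ek) leqNgt ltn_ord mul0r.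
apply: (@le_trans _ _ (\sum_(N <= k <oo) u k)%E).
  apply: lee_nneseries => [k _ _|k _].
    by apply: integral_ge0 => x /cell_family_sub/h0 hx; rewrite lee_fin mulr_ge0.
  have mEh (f : T -> R) : measurable_fun O f -> measurable_fun (E k) (EFin \o f).
    move=> mf; apply/measurable_EFinP; apply: measurable_funS mf => //.
      exact: measurable_cell_family.
    exact: cell_family_sub.
  apply: ge0_le_integral => //.
  - by move=> x /cell_family_sub/h0 hx; rewrite lee_fin mulr_ge0.
  - apply: mEh; apply: measurable_funM => //.
    exact: (measurable_step (fun k => (N <= k)%:R)).
  - exact: mEh.
  - move=> x /cell_family_sub/h0 hx; rewrite lee_fin ler_piMl//.
    by case: (_ <= _)%N.
rewrite -(fineK fN) lee_fin ltW//; apply: le_lt_trans lN.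
by rewrite sub0r normrN ler_norm.
Unshelve. all: by end_near. Qed.

End cell_family.

(** * Building blocks of zero mean *)

Section mean_zero.
Context d (T : measurableType d) (R : realType).
Variable mu : {measure set T -> \bar R}.

Definition mean_zero (h : T -> R) : Prop :=
  mu.-integrable setT (EFin \o h) /\ (\int[mu]_x (h x)%:E = 0)%E.

Lemma restrict_mul_indic (A : set T) (g : T -> R) :
  (EFin \o g) \_ A = EFin \o (fun x => g x * \1_A x).
Proof.
apply/funext => x; rewrite /= patchE indicE.
by case: (x \in A); rewrite ?mulr1 ?mulr0.
Qed.

Lemma integrable_mul_indic (A : set T) (g : T -> R) : measurable A ->
  mu.-integrable A (EFin \o g) ->
  mu.-integrable setT (EFin \o (fun x => g x * \1_A x)).
Proof.
by move=> mA; rewrite (integrable_mkcond _ mA) restrict_mul_indic.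
Qed.

Lemma integral_mul_indic (A : set T) (g : T -> R) :
  (\int[mu]_x (g x * \1_A x)%:E = \int[mu]_(x in A) (g x)%:E)%E.
Proof. by rewrite [RHS]integral_mkcond restrict_mul_indic. Qed.

Lemma mean_zero_sum (I : Type) (s : seq I) (P : pred I) (h : I -> T -> R) :
  (forall i, mean_zero (h i)) ->
  mean_zero (fun x => \sum_(i <- s | P i) h i x).
Proof.
move=> mh.
have E : EFin \o (fun x => \sum_(i <- s | P i) h i x) =
    (fun x => (\sum_(i <- s | P i) (EFin \o h i) x)%E).
  by apply/funext => x /=; rewrite sumEFin.
split.
  by rewrite E; apply: integrable_sum => // i _; have [] := mh i.
under eq_integral do rewrite -sumEFin.
rewrite (integral_sum measurableT)//; last by move=> i; have [] := mh i.
by rewrite big1// => i _; have [] := mh i.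
Qed.

Lemma mean_zeroD (f g : T -> R) : mean_zero f -> mean_zero g ->
  mean_zero (fun x => f x + g x).
Proof.
move=> mf mg; have := @mean_zero_sum bool [:: true; false] xpredT
  (fun b : bool => if b then f else g).
have -> : (fun x => \sum_(i <- [:: true; false]) (if i then f else g) x) =
    (fun x => f x + g x).
  by apply/funext => x; rewrite !big_cons big_nil addr0.
by apply => -[].
Qed.

Lemma mean_zeroZ (r : R) (f : T -> R) : mean_zero f -> mean_zero (fun x => r * f x).
Proof.
move=> [i0 i1]; split.
  by apply: (integrableZl measurableT r i0).
under eq_integral do rewrite EFinM.
by rewrite (integralZl measurableT i0) i1 mule0.
Qed.

Lemma mean_zero_center (A : set T) (g : T -> R) : measurable A ->
  (mu A < +oo)%E -> 0 < fine (mu A) -> mu.-integrable A (EFin \o g) ->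
  mean_zero (fun x =>
    (g x - fine (\int[mu]_(x in A) (g x)%:E) / fine (mu A)) * \1_A x).
Proof.
move=> mA Afin A0 ig; set a := _ / _.
have ica : mu.-integrable A (EFin \o cst a).
  apply/integrableP; split; first exact/measurable_EFinP.
  by rewrite (integral_cst mu mA `|a|%:E) lte_mul_pinfty.
have iga : mu.-integrable A (EFin \o (fun x => g x - a)).
  rewrite (_ : _ \o _ = ((EFin \o g) \- (EFin \o cst a))%E)//.
  exact: integrableB.
split; first exact: integrable_mul_indic.
rewrite integral_mul_indic.
rewrite (_ : (\int[mu]_(x in A) _ = \int[mu]_(x in A) ((EFin \o g) x - (EFin \o cst a) x))%E)//.
rewrite integralB// [X in (_ - X)%E](integral_cst mu mA a%:E).
rewrite -(fineK (integrable_fin_num mA ig)) -[X in (_ - _ * X)%E]fineK; last first.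
  by rewrite ge0_fin_numE.
by rewrite -EFinM -EFinB /a divfK ?gt_eqF// subrr.
Qed.

(** One unit of mass spread evenly over [A], compensated by one unit over [B]: the elementary
    exchange between neighbouring cells. *)
Lemma mean_zero_exchange (A B : set T) : measurable A -> measurable B ->
  (mu A < +oo)%E -> (mu B < +oo)%E -> 0 < fine (mu A) -> 0 < fine (mu B) ->
  mean_zero (fun x => \1_A x / fine (mu A) - \1_B x / fine (mu B)).
Proof.
move=> mA mB Afin Bfin A0 B0.
have half (D : set T) (mD : measurable D) : (mu D < +oo)%E -> 0 < fine (mu D) ->
    mu.-integrable setT (EFin \o (fun x => (fine (mu D))^-1 * \1_D x)) /\
    (\int[mu]_x ((fine (mu D))^-1 * \1_D x)%:E = 1)%E.
  move=> Dfin D0.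
  have icD : mu.-integrable D (EFin \o cst (fine (mu D))^-1).
    apply/integrableP; split; first exact/measurable_EFinP.
    by rewrite (integral_cst mu mD `|(fine (mu D))^-1|%:E) lte_mul_pinfty.
  split; first exact: (integrable_mul_indic mD icD).
  rewrite (integral_mul_indic D (cst (fine (mu D))^-1)).
  rewrite (integral_cst mu mD (fine (mu D))^-1%:E).
  by rewrite -[X in (_ * X)%E]fineK ?ge0_fin_numE// -EFinM mulVf ?gt_eqF.
have [iA sA] := half A mA Afin A0; have [iB sB] := half B mB Bfin B0.
have -> : (fun x => \1_A x / fine (mu A) - \1_B x / fine (mu B)) =
   (fun x => (fine (mu A))^-1 * \1_A x - (fine (mu B))^-1 * \1_B x).
  by apply/funext => x; rewrite mulrC [X in _ - X]mulrC.
split.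
  exact: (integrableB measurableT iA iB).
under eq_integral do rewrite EFinB.
by rewrite (integralB measurableT iA iB) sA sB subee.
Qed.

End mean_zero.

Section stage_sums.
Variables (R : realType) (N : nat) (v coef : 'I_N -> R) (F : 'I_N -> 'I_N -> R).
Hypothesis v_gt0 : forall k, 0 < v k.

Lemma sum_delta (k : 'I_N) (f : 'I_N -> R) : \sum_i f i * (i == k)%:R = f k.
Proof.
rewrite (bigD1 k)//= eqxx mulr1 big1 ?addr0// => i /negbTE ->.
by rewrite mulr0.
Qed.

(** Value on cell [k] of the block attached to cell [i], with Kronecker symbols for the indicators:
    the oscillation [coef] on the cell [i] itself plus the exchanges that leave [i]. *)
Let Hx k i := coef i * (i == k)%:R +
  \sum_l F i l * ((i == k)%:R / v i - (l == k)%:R / v l).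

Lemma transport_value (k : 'I_N) :
  \sum_i Hx k i = coef k + (\sum_l F k l - \sum_l F l k) / v k.
Proof.
rewrite big_split/= sum_delta; congr (_ + _).
under eq_bigr do (under eq_bigr do rewrite mulrBr; rewrite sumrB).
rewrite sumrB mulrBl; congr (_ - _).
  rewrite -(sum_delta k (fun i => (\sum_l F i l) / v k)).
  apply: eq_bigr => i _; rewrite !mulr_suml; apply: eq_bigr => l _.
  by case: eqVneq => [->|_]; rewrite ?mul0r ?mulr0// mulr1 mul1r.
rewrite mulr_suml; apply: eq_bigr => i _.
rewrite -(sum_delta k (fun l => F i l / v k)); apply: eq_bigr => l _.
by case: eqVneq => [->|_]; rewrite ?mul0r ?mulr0// mulr1 mul1r.
Qed.

Lemma transport_abs (k : 'I_N) :
  \sum_i `|Hx k i| <= `|coef k| + (\sum_l `|F k l| + \sum_l `|F l k|) / v k.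
Proof.
apply: (@le_trans _ _ (\sum_i (`|coef i| * (i == k)%:R +
    \sum_l `|F i l| * ((i == k)%:R / v i + (l == k)%:R / v l)))).
  apply: ler_sum => i _; apply: le_trans (ler_normD _ _) _.
  rewrite normrM normr_nat lerD2l; apply: le_trans (ler_norm_sum _ _ _) _.
  apply: ler_sum => l _; rewrite normrM ler_wpM2l//.
  apply: le_trans (ler_normB _ _) _.
  by rewrite !normrM !normr_nat !normfV !(gtr0_norm (v_gt0 _)).
rewrite big_split/= sum_delta lerD2l.
under eq_bigr do (under eq_bigr do rewrite mulrDr; rewrite big_split/=).
rewrite big_split/= mulrDl; apply: lerD.
  rewrite -(sum_delta k (fun i => (\sum_l `|F i l|) / v k)).
  apply: ler_sum => i _; rewrite !mulr_suml; apply: ler_sum => l _.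
  by case: eqVneq => [->|_]; rewrite ?mul0r ?mulr0// mulr1 mul1r.
rewrite mulr_suml; apply: ler_sum => i _.
rewrite -(sum_delta k (fun l => `|F i l| / v k)); apply: ler_sum => l _.
by case: eqVneq => [->|_]; rewrite ?mul0r ?mulr0// mulr1 mul1r.
Qed.

End stage_sums.

Lemma powR_sum2 (R : realType) (p x y : R) : 0 < p -> 0 <= x -> 0 <= y ->
  (x + y) `^ p <= 2 `^ p * (x `^ p + y `^ p).
Proof.
move=> p0 x0 y0.
wlog xy : x y x0 y0 / x <= y.
  move=> H; case: (leP x y) => [xy|/ltW yx]; first exact: H.
  by rewrite addrC [_ `^ p + _]addrC; exact: H.
apply: (@le_trans _ _ ((2 * y) `^ p)).
  by apply: ge0_ler_powR; rewrite ?nnegrE ?addr_ge0 ?mulr_ge0 ?(ltW p0)//; lra.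
by rewrite powRM// ler_wpM2l ?powR_ge0// lerDr powR_ge0.
Qed.

Lemma powR_sum3 (R : realType) (p x y z : R) : 0 < p -> 0 <= x -> 0 <= y -> 0 <= z ->
  (x + y + z) `^ p <= 3 `^ p * (x `^ p + y `^ p + z `^ p).
Proof.
move=> p0 x0 y0 z0.
have X := powR_ge0 x p; have Y := powR_ge0 y p; have Z := powR_ge0 z p.
have [m [m0 xm ym zm mp]] : exists m : R,
    [/\ 0 <= m, x <= m, y <= m, z <= m & m `^ p <= x `^ p + y `^ p + z `^ p].
  case/orP: (le_total x y) => xy;
    [case/orP: (le_total y z) => yz|case/orP: (le_total x z) => yz];
    [exists z|exists y|exists z|exists x]; split; lra.
apply: (@le_trans _ _ ((3 * m) `^ p)).
  by apply: ge0_ler_powR; rewrite ?nnegrE ?addr_ge0 ?mulr_ge0 ?(ltW p0)//; lra.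
by rewrite powRM// ler_wpM2l ?powR_ge0.
Qed.

Section stage.
Context d (T : measurableType d) (R : realType).
Variable mu : {measure set T -> \bar R}.
Variables (O : set T) (E : nat -> set T).
Hypothesis mE : forall k, measurable (E k).
Hypothesis tE : trivIset setT E.
Hypothesis EO : \bigcup_k E k = O.
Hypothesis muO : (mu O < +oo)%E.
Variables (J : nat -> nat) (S : nat -> set T) (adj : rel nat) (wt : nat -> R).
Variables (r0 : nat) (p : R).
Hypothesis p1 : 1 < p.
Hypothesis ES : forall k, E k `<=` S (J k).
Hypothesis adjS : forall k l, adj k l -> E l `<=` S (J k).
Hypothesis v_gt0 : forall k, 0 < fine (mu (E k)).
Hypothesis v_le_wt : forall k, fine (mu (E k)) <= wt k.
Hypothesis flow : forall N0 (eta : R), (r0 < N0)%N -> 0 < eta ->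
  exists (N : nat) (m : 'I_N -> 'I_N -> R) (M lost : 'I_N -> R),
  [/\ (N0 <= N)%N,
      (forall k l, 0 <= m k l) /\ (forall k l : 'I_N, m k l != 0 -> adj k l),
      [/\ forall k, 0 <= lost k, forall k : 'I_N, lost k <= fine (mu (E k)) &
          \sum_k lost k <= eta],
      (forall k : 'I_N, M k = fine (mu (E k)) + \sum_l m l k) /\
      (forall k, \sum_l m k l = if val k == r0 then 0 else M k - lost k) &
      forall k : 'I_N, M k <= wt k].

Let v k := fine (mu (E k)).
Let idx := cell_index E.
Let p0 : 0 < p. Proof. exact: lt_trans p1. Qed.
Let mO : measurable O. Proof. exact: measurable_cell_family EO. Qed.
Let mu_fin k : (mu (E k) < +oo)%E.
Proof. by rewrite (mu_cellE mE EO muO) ltry. Qed.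

(* A measurable substitute for [bdist Omega x ^+ n / weight Omega gamma x], to
   which it is comparable from above: [wt k] will be the infimum of the weight
   on the cell [E k]. *)
Definition step_weight (x : T) : R := v (idx x) / wt (idx x).

(** [3]^ p[splits the pointwise bound]|g| + |a| + 2 * A[. The two first terms cost 1 each, the
    second by Jensen; the last costs]2 [^ p] times the Hardy constant. *)
Definition stage_constant : R := 3 `^ p * (2 + 2 `^ p * (2 `^ p / (p - 1))).

(** Since [g] has zero mean, its mass in the first [N0] cells is the opposite of the mass in the
    tail. Its smallness is what will control the root cell. *)
Lemma stage_cutoff (g : T -> R) (e1 : R) : measurable_fun O g ->
  (\int[mu]_(x in O) (`|g x| `^ p)%:E < +oo)%E ->
  (\int[mu]_(x in O) (g x)%:E = 0)%E -> 0 < e1 ->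
  exists N0, [/\ (r0 < N0)%N,
    (\int[mu]_(x in O) ((N0 <= idx x)%:R * `|g x| `^ p)%:E <= e1%:E)%E &
    `|\sum_(k < N0) fine (\int[mu]_(x in E k) (g x)%:E)| <= e1].
Proof.
move=> mg gp g0 e10.
have ig := Lp_integrable mE EO muO p1 mg gp.
have mgp := measurable_abs_powR p mg.
have mag : measurable_fun O (fun x => `|g x|).
  by apply: measurableT_comp mg; exact: normr_measurable.
have [N1 N1P] := integral_tail mE tE EO mgp (fun x _ => powR_ge0 _ _) gp e10.
have agfin : (\int[mu]_(x in O) `|g x|%:E < +oo)%E by have /integrableP[_] := ig.
have [N2 N2P] := integral_tail mE tE EO mag (fun x _ => normr_ge0 _) agfin e10.
pose N0 := maxn r0.+1 (maxn N1 N2).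
exists N0; split.
- exact: leq_maxl.
- by apply: N1P; rewrite /N0 !leq_max leqnn orbT.
have {N2P} tail := N2P N0 _; rewrite /N0 !leq_max leqnn !orbT -/N0 in tail.
have {}tail := tail isT.
have igE k : mu.-integrable (E k) (EFin \o g).
  by apply: integrableS ig => //; exact: cell_family_sub.
pose G k : T -> R := fun x => g x * \1_(E k) x.
have iG k : mu.-integrable O (EFin \o G k).
  by apply: integrableS (integrable_mul_indic (mE k) (igE k)).
have IG k : (\int[mu]_(x in O) (G k x)%:E = \int[mu]_(x in E k) (g x)%:E)%E.
  rewrite -(integral_mul_indic mu (E k) g) [LHS]integral_mkcond.
  apply: eq_integral => x _; rewrite patchE; case: ifPn => // xO.
  rewrite /G indicE memNset ?mulr0// => xE.
  by move/negP: xO; apply; rewrite inE; exact: cell_family_sub xE.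
pose h x : R := (N0 <= idx x)%:R * g x.
have mh : measurable_fun O h.
  by apply: measurable_funM => //; exact: (measurable_step mE tE EO (fun k => (N0 <= k)%:R)).
have ih : mu.-integrable O (EFin \o h).
  apply: (@le_integrable _ _ _ mu _ mO _ (EFin \o g)) => //.
    exact/measurable_EFinP.
  move=> x _ /=; rewrite lee_fin /h normrM normr_nat ler_piMl//.
  by case: (_ <= _)%N.
have hI : (`|\int[mu]_(x in O) (h x)%:E| <= e1%:E)%E.
  apply: le_trans tail; have /measurable_EFinP mh' := mh.
  apply: le_trans (le_abse_integral mu mO mh') _.
  rewrite le_eqVlt; apply/orP; left; apply/eqP; apply: eq_integral => x _ /=.
  by rewrite /h normrM normr_nat.
have split_g : (\int[mu]_(x in O) (g x)%:E = \int[mu]_(x in O) (h x)%:E +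
    \int[mu]_(x in O) (\sum_(k < N0) (EFin \o G k) x))%E.
  rewrite -(integralD mO ih); last by apply: (integrable_sum mO) => k _; exact: iG.
  apply: eq_integral => x /set_mem Ox /=; rewrite sumEFin -EFinD; congr (_%:E).
  have Ei := cell_indexP tE EO Ox; rewrite -/idx in Ei.
  have Gx k : G k x = if k == idx x then g x else 0.
    rewrite /G indicE; case: eqVneq => [->|ki]; first by rewrite mem_set// mulr1.
    rewrite memNset ?mulr0// => Ek; move: ki.
    by rewrite -(cell_indexE tE Ek) eqxx.
  rewrite /h; case: (leqP N0 (idx x)) => N0x.
    rewrite mul1r big1 ?addr0// => k _; rewrite Gx ifF//.
    by apply/negbTE; rewrite neq_ltn (leq_trans (ltn_ord k) N0x).
  rewrite mul0r add0r (bigD1 (Ordinal N0x))//= Gx eqxx big1 ?addr0// => k ki.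
  by rewrite Gx ifF//; apply: contraNF ki => /eqP ki; apply/eqP/val_inj.
move: split_g; rewrite g0 (integral_sum mO); last by move=> k; exact: iG.
under eq_bigr do rewrite IG -(fineK (integrable_fin_num (mE _) (igE _))).
have hfin := integrable_fin_num mO ih.
rewrite sumEFin -(fineK hfin) -EFinD => -[/eqP]; rewrite eq_sym addrC addr_eq0 => /eqP ->.
by rewrite normrN; move: hI; rewrite -(fineK hfin).
Qed.

Lemma stage (g : T -> R) (e : R) : measurable_fun O g ->
  (\int[mu]_(x in O) (`|g x| `^ p)%:E < +oo)%E ->
  (\int[mu]_(x in O) (g x)%:E = 0)%E -> 0 < e ->
  exists (n : nat) (G : nat -> T -> R),
  [/\ (forall j, mean_zero mu (G j)),
      (forall j x, ~ S j x -> G j x = 0) /\ (forall j x, ~ O x -> G j x = 0),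
      (forall j x, (n <= j)%N -> G j x = 0),
      (\int[mu]_(x in O) (((\sum_(j < n) `|G j x|) * step_weight x) `^ p)%:E
        <= stage_constant%:E * \int[mu]_(x in O) (`|g x| `^ p)%:E)%E &
      (\int[mu]_(x in O) (`|g x - \sum_(j < n) G j x| `^ p)%:E <= e%:E)%E].
Proof.
move=> mg gp g0 e0.
pose q := e / (3 * 2 `^ p); have q0 : 0 < q by rewrite divr_gt0 ?mulr_gt0 ?powR_gt0.
pose b := v r0 / 2 * (q / v r0) `^ p^-1.
have b0 : 0 < b by rewrite mulr_gt0 ?powR_gt0 ?divr_gt0 ?v_gt0.
have e10 : 0 < Num.min q b by rewrite lt_min q0.
have [N0 [r0N0 tail0 mass0]] := stage_cutoff mg gp g0 e10.
pose a' k := fine (\int[mu]_(x in E k) (g x)%:E)%E / v k.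
pose a k := (k < N0)%N%:R * a' k.
pose alpha := \sum_(k < N0) `|a k|.
have alpha0 : 0 <= alpha by exact: sumr_ge0.
have a_le k : `|a k| <= alpha.
  case: (ltnP k N0) => kN; last by rewrite /a ltnNge kN mul0r normr0.
  by rewrite /alpha (bigD1 (Ordinal kN))//= lerDl sumr_ge0.
(* Adding 1 to the denominators covers the case [alpha = 0]. *)
pose eta := Num.min (q / (alpha `^ p + 1)) (b / (alpha + 1)).
have ap1 : 0 < alpha `^ p + 1 by rewrite ltr_wpDl ?powR_ge0.
have al1 : 0 < alpha + 1 by rewrite ltr_wpDl.
have eta0 : 0 < eta by rewrite lt_min !divr_gt0.
have eta1 : alpha `^ p * eta <= q.
  have : eta <= q / (alpha `^ p + 1) by rewrite ge_min lexx.
  rewrite ler_pdivlMr// mulrDr mulr1 mulrC => h.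
  by apply: le_trans h; rewrite lerDl ltW.
have eta2 : alpha * eta <= b.
  have : eta <= b / (alpha + 1) by rewrite ge_min lexx orbT.
  rewrite ler_pdivlMr// mulrDr mulr1 mulrC => h.
  by apply: le_trans h; rewrite lerDl ltW.
have [N [phi [A [beta [N0N phi_adj [A0 phiA hardy] betaE [beta1 beta2]]]]]] :=
  stage_transport v_gt0 flow p1 r0N0 eta0 a_le.
(* The oscillation is removed only in the first [N0] cells, where the average is transported; cells
   from [N0] to [N] contribute exchanges alone. *)
pose coef (i : 'I_N) x := (i < N0)%N%:R * (g x - a' i).
pose H (i : 'I_N) x := coef i x * \1_(E i) x +
  \sum_l phi i l * (\1_(E i) x / v i - \1_(E l) x / v l).
have ig := Lp_integrable mE EO muO p1 mg gp.
have igE k : mu.-integrable (E k) (EFin \o g).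
  by apply: integrableS ig => //; exact: (cell_family_sub EO).
have mzH i : mean_zero mu (H i).
  apply: mean_zeroD.
    under [X in mean_zero mu X]eq_fun do rewrite -mulrA.
    apply: mean_zeroZ; exact: (mean_zero_center (mE i) (mu_fin i) (v_gt0 i) (igE i)).
  by apply: mean_zero_sum => l; apply: mean_zeroZ; apply: mean_zero_exchange.
pose G j x := \sum_(i < N | J i == j) H i x.
pose n := (\max_(i < N) (J i).+1)%N.
have Jn (i : 'I_N) : (J i < n)%N by exact: (leq_bigmax i).
have regroup (f : 'I_N -> R) : \sum_(j < n) \sum_(i < N | J i == j) f i = \sum_i f i.
  under eq_bigr do rewrite big_mkcond.
  rewrite exchange_big/=; apply: eq_bigr => i _.
  rewrite (bigD1 (Ordinal (Jn i)))//= eqxx big1 ?addr0// => j ji.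
  by rewrite ifF//; apply: contraNF ji => /eqP ji; apply/eqP/val_inj.
have sumG x : \sum_(j < n) G j x = \sum_i H i x by exact: regroup.
have sumabsG x : \sum_(j < n) `|G j x| <= \sum_i `|H i x|.
  rewrite -(regroup (fun i => `|H i x|)); apply: ler_sum => j _.
  exact: ler_norm_sum.
have vN (k : 'I_N) : 0 < v k by exact: v_gt0.
pose ext (f : 'I_N -> R) (k : nat) : R := oapp f 0 (insub k).
have ext_ord f (k : 'I_N) : ext f k = f k by rewrite /ext valK.
have ext_out f k : (N <= k)%N -> ext f k = 0.
  by move=> Nk; rewrite /ext insubF// ltnNge Nk.
have indE x k : E k x -> forall i, \1_(E i) x = (i == k)%:R :> R.
  move=> Ek i; rewrite indicE; case: eqVneq => [->|ik]; first by rewrite mem_set.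
  rewrite memNset// => Ei; move: ik.
  by rewrite -(cell_indexE tE Ek) (cell_indexE tE Ei) eqxx.
have HE x (k : 'I_N) : E k x -> forall i, H i x = coef i x * (i == k)%:R +
    \sum_l phi i l * ((i == k)%:R / v i - (l == k)%:R / v l).
  move=> Ek i; rewrite /H (indE _ _ Ek) -val_eqE; congr (_ + _).
  by apply: eq_bigr => l _; rewrite (indE _ _ Ek).
have H0 x k : E k x -> (N <= k)%N -> forall i, H i x = 0.
  move=> Ek Nk i; have ik (l : 'I_N) : (l == k :> nat) = false.
    by apply/negbTE; rewrite neq_ltn (leq_trans (ltn_ord l) Nk).
  rewrite /H (indE _ _ Ek) ik mulr0 add0r big1// => l _.
  by rewrite (indE _ _ Ek) ik !mul0r subr0 mulr0.
have mG j : measurable_fun O (G j).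
  have [/measurable_int/measurable_EFinP + _] := mean_zero_sum (index_enum _) (fun i : 'I_N => J
    i == j) mzH.
  exact: measurable_funTS.
have mgp := measurable_abs_powR p mg.
have va_le : ((\sum_(k < N) v k * `|a k| `^ p)%:E <= \int[mu]_(x in O) (`|g x| `^ p)%:E)%E.
  rewrite (ge0_integral_cells mu mE tE EO mgp (fun x _ => powR_ge0 _ _)).
  have u0 k : (0 <= k)%N -> true -> (0 <= \int[mu]_(x in E k) (`|g x| `^ p)%:E)%E.
    by move=> _ _; apply: integral_ge0 => x _; rewrite lee_fin powR_ge0.
  apply: le_trans (@nneseries_lim_ge R _ xpredT 0%N N u0).
  rewrite big_mkord -sumEFin; apply: lee_sum => k _.
  case: (ltnP k N0) => kN; last first.
    by rewrite /a ltnNge kN mul0r normr0 powR0 ?mulr0 ?u0// gt_eqF.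
  by rewrite /a kN mul1r; exact: (jensen_cell mE EO muO p1 mg gp (v_gt0 k)).
have bound1 : (\int[mu]_(x in O) (((\sum_(j < n) `|G j x|) * step_weight x) `^ p)%:E
        <= stage_constant%:E * \int[mu]_(x in O) (`|g x| `^ p)%:E)%E.
  pose u k : R := (k < N)%N%:R * (`|a k| `^ p + 2 `^ p * ext A k `^ p).
  have u0 k : 0 <= u k by rewrite mulr_ge0// addr_ge0 ?mulr_ge0 ?powR_ge0.
  have mu' : measurable_fun O (fun x => u (idx x)) by exact: measurable_step.
  have pw x : O x -> ((\sum_(j < n) `|G j x|) * step_weight x) `^ p <=
      3 `^ p * (`|g x| `^ p + u (idx x)).
    move=> Ox; have Ex := cell_indexP tE EO Ox; rewrite -/idx in Ex.
    case: (ltnP (idx x) N) => [kN|Nk]; last first.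
      rewrite big1 ?mul0r ?powR0 ?gt_eqF ?mulr_ge0 ?addr_ge0 ?powR_ge0//.
      by move=> j _; rewrite /G big1 ?normr0// => i _; exact: H0 Ex Nk i.
    pose k := Ordinal kN; have Ek : E k x by [].
    have wt0 : 0 < wt k by apply: lt_le_trans (v_le_wt k); exact: v_gt0.
    have S1 : \sum_(j < n) `|G j x| <= `|g x| + `|a k| + 2 * (wt k * A k) / v k.
      apply: le_trans (sumabsG x) _.
      under eq_bigr do rewrite (HE _ _ Ek).
      apply: le_trans (transport_abs (fun i => coef i x) phi vN k) _.
      apply: lerD; last by rewrite ler_wpM2r ?invr_ge0 ?(ltW (vN _)).
      rewrite /coef /a; case: (_ < _)%N; rewrite ?mul1r ?mul0r ?normr0 ?addr0//.
      exact: ler_normB.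
    have W0 : 0 <= step_weight x by rewrite divr_ge0 ?(ltW wt0) ?(ltW (vN k)).
    have W1 : step_weight x <= 1 by rewrite ler_pdivrMr// mul1r v_le_wt.
    (* The step weight [v k / wt k] is at most 1 on the oscillation and cancels the throughput
       factor [wt k / v k] in the exchanges. *)
    have S2 : (\sum_(j < n) `|G j x|) * step_weight x <= `|g x| + `|a k| + 2 * A k.
      apply: le_trans (ler_wpM2r W0 S1) _; rewrite mulrDl; apply: lerD.
        by rewrite ler_piMr// addr_ge0.
      rewrite /step_weight -/(v _) -[idx x]/(val k) le_eqVlt; apply/orP; left.
      by apply/eqP; field; rewrite !gt_eqF// v_gt0.
    apply: (@le_trans _ _ ((`|g x| + `|a k| + 2 * A k) `^ p)).
      apply: ge0_ler_powR; rewrite ?nnegrE ?(ltW p0)//.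
        by rewrite mulr_ge0// sumr_ge0.
      by rewrite !addr_ge0// mulr_ge0.
    apply: le_trans (powR_sum3 p0 _ _ _) _; rewrite ?mulr_ge0//.
    rewrite ler_wpM2l ?powR_ge0// -addrA lerD2l /u kN mul1r powRM// -[idx x]/(val k).
    by rewrite (ext_ord A k).
  apply: (@le_trans _ _ (\int[mu]_(x in O) ((3 `^ p)%:E * ((`|g x| `^ p)%:E + (u (idx x))%:E)))%E).
    apply: ge0_le_integral => //.
    - by move=> x _; rewrite lee_fin powR_ge0.
    - apply/measurable_EFinP; apply: (measurableT_comp (measurable_powR p)).
      apply: measurable_funM; last exact: (measurable_step mE tE EO (fun k => v k / wt k)).
      apply: measurable_sum => j; apply: measurableT_comp (mG j).
      exact: normr_measurable.
    - apply: emeasurable_funM; first exact: measurable_cst.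
      by apply: emeasurable_funD; exact/measurable_EFinP.
  rewrite ge0_integralZl_EFin//; last 2 first.
  - by move=> x Ox; rewrite -EFinD lee_fin addr_ge0 ?powR_ge0.
  - by apply: emeasurable_funD; exact/measurable_EFinP.
  rewrite /stage_constant EFinM -muleA lee_wpmul2l ?lee_fin ?powR_ge0//.
  rewrite ge0_integralD//; last 3 first.
  - exact/measurable_EFinP.
  - by move=> x _; rewrite lee_fin.
  - exact/measurable_EFinP.
  have uS : (\int[mu]_(x in O) (u (idx x))%:E <=
      (\sum_(k < N) v k * u k)%:E)%E.
    apply: (integral_step_le mE tE EO muO mu') => //.
      by move=> k x Ek; rewrite /idx (cell_indexE tE Ek).
    by move=> k Nk; rewrite /u ltnNge Nk mul0r.
  have S3 : \sum_(k < N) v k * u k <=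
      (1 + 2 `^ p * (2 `^ p / (p - 1))) * \sum_(k < N) v k * `|a k| `^ p.
    under eq_bigr do rewrite /u ltn_ord mul1r ext_ord mulrDr.
    rewrite big_split/= mulrDl mul1r lerD2l.
    under eq_bigr do rewrite mulrCA.
    by rewrite -mulr_sumr -mulrA ler_wpM2l ?powR_ge0.
  have Ifin : (\int[mu]_(x in O) (`|g x| `^ p)%:E)%E \is a fin_num.
    rewrite ge0_fin_numE//; apply: integral_ge0 => x _.
    by rewrite lee_fin powR_ge0.
  have c0 : 0 <= 2 `^ p * (2 `^ p / (p - 1)).
    by rewrite !mulr_ge0 ?powR_ge0// invr_ge0 subr_ge0 ltW.
  move: va_le; rewrite -(fineK Ifin) lee_fin => va_le.
  apply: le_trans (leeD (lexx _) uS) _; rewrite -EFinD -EFinM lee_fin.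
  rewrite (_ : 2 = 1 + 1 :> R)// -addrA mulrDl mul1r lerD2l.
  exact: le_trans S3 (ler_wpM2l (addr_ge0 ler01 c0) va_le).
have bound2 : (\int[mu]_(x in O) (`|g x - \sum_(j < n) G j x| `^ p)%:E <= e%:E)%E.
  pose u k : R := `|ext beta k| `^ p.
  have u0 k : 0 <= u k by exact: powR_ge0.
  have mu' : measurable_fun O (fun x => u (idx x)) by exact: measurable_step.
  pose t x : R := (N0 <= idx x)%:R * `|g x| `^ p.
  have t0 x : 0 <= t x by rewrite mulr_ge0 ?powR_ge0.
  have mt : measurable_fun O t.
    by apply: measurable_funM => //; exact: (measurable_step mE tE EO (fun k => (N0 <= k)%:R)).
  have pw x : O x -> `|g x - \sum_(j < n) G j x| `^ p <= 2 `^ p * (t x + u (idx x)).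
    move=> Ox; have Ex := cell_indexP tE EO Ox; rewrite -/idx in Ex.
    (* Oscillation plus transported average restores [g] on the first [N0] cells up to [beta]; what
       remains is the tail of [g] and [beta]. *)
    have -> : g x - \sum_(j < n) G j x = (N0 <= idx x)%:R * g x + ext beta (idx x).
      rewrite sumG; case: (ltnP (idx x) N) => [kN|Nk]; last first.
        rewrite big1 ?subr0; last by move=> i _; exact: H0 Ex Nk i.
        by rewrite (leq_trans N0N Nk) mul1r ext_out// addr0.
      pose k := Ordinal kN; have Ek : E k x by [].
      under eq_bigr do rewrite (HE _ _ Ek).
      rewrite (transport_value (fun i : 'I_N => v i) (fun i => coef i x) phi k).
      rewrite -[idx x]/(val k) ext_ord.
      have -> : (\sum_l phi k l - \sum_l phi l k) / v k = a k - beta k.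
        apply: (mulIf (_ : v k != 0)); first by rewrite gt_eqF.
        by rewrite divfK ?gt_eqF// mulrBl [beta k * _]mulrC betaE mulrC subKr.
      rewrite /coef /a; case: leqP => _ /=; ring.
    apply: (@le_trans _ _ (((N0 <= idx x)%:R * `|g x| + `|ext beta (idx x)|) `^ p)).
      apply: ge0_ler_powR; rewrite ?nnegrE ?(ltW p0) ?addr_ge0 ?mulr_ge0//.
      by apply: le_trans (ler_normD _ _) _; rewrite normrM normr_nat.
    apply: le_trans (powR_sum2 p0 _ _) _; rewrite ?mulr_ge0//.
    rewrite ler_wpM2l ?powR_ge0// lerD2r /t; case: (_ <= _)%N; rewrite ?mul1r//.
    by rewrite !mul0r powR0// gt_eqF.
  apply: (@le_trans _ _ (\int[mu]_(x in O) ((2 `^ p)%:E * ((t x)%:E + (u (idx x))%:E)))%E).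
    apply: ge0_le_integral => //.
    - apply/measurable_EFinP; apply: measurable_abs_powR.
      by apply: measurable_funB => //; exact: measurable_sum.
    - apply: emeasurable_funM; first exact: measurable_cst.
      by apply: emeasurable_funD; exact/measurable_EFinP.
  rewrite ge0_integralZl_EFin//; last 2 first.
  - by move=> x Ox; rewrite -EFinD lee_fin addr_ge0.
  - by apply: emeasurable_funD; exact/measurable_EFinP.
  rewrite ge0_integralD//; last 4 first.
  - by move=> x _; rewrite lee_fin.
  - exact/measurable_EFinP.
  - by move=> x _; rewrite lee_fin.
  - exact/measurable_EFinP.
  have uS : (\int[mu]_(x in O) (u (idx x))%:E <=
      (\sum_(k < N) v k * u k)%:E)%E.
    apply: (integral_step_le mE tE EO muO mu') => //.
      by move=> k x Ek; rewrite /idx (cell_indexE tE Ek).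
    by move=> k Nk; rewrite /u ext_out// normr0 powR0// gt_eqF.
  have r0N : (r0 < N)%N by exact: leq_trans r0N0 N0N.
  pose r := Ordinal r0N.
  have vr0 := v_gt0 r0.
  have beta_r : v r * `|beta r| `^ p <= q.
    have : v r * `|beta r| <= 2 * b.
      apply: le_trans (beta2 r erefl) _.
      have -> : \sum_(i < N) v i * a i = \sum_(k < N0) fine (\int[mu]_(x in E k) (g x)%:E)%E.
        rewrite (big_ord_widen N (fun k => fine (\int[mu]_(x in E k) (g x)%:E)%E) N0N).
        rewrite [RHS]big_mkcond; apply: eq_bigr => i _; rewrite /a /a'.
        case: (_ < _)%N; rewrite ?mul0r ?mulr0// mul1r mulrC divfK// gt_eqF//.
      have : Num.min q b <= b by rewrite ge_min lexx orbT.
      by rewrite mulr_natl mulr2n => qb; apply: lerD => //; exact: le_trans qb.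
    have -> : 2 * b = v r * (q / v r0) `^ p^-1 by rewrite /b; field.
    rewrite ler_pM2l// => h.
    apply: (@le_trans _ _ (v r * ((q / v r0) `^ p^-1) `^ p)).
      rewrite ler_wpM2l ?(ltW vr0)//.
      by apply: ge0_ler_powR; rewrite ?nnegrE ?(ltW p0) ?powR_ge0.
    have qv : 0 <= q / v r0 by rewrite divr_ge0 ?(ltW q0) ?(ltW vr0).
    by rewrite -powRrM mulVf ?gt_eqF// (powRr1 qv) [v r * _]mulrC divfK// gt_eqF.
  have beta_sum : \sum_(k < N) v k * u k <= q + q.
    under eq_bigr do rewrite /u ext_ord.
    rewrite (bigD1 r)//=; apply: lerD => //.
    by apply: le_trans eta1; apply: le_trans beta1; rewrite le_eqVlt eqxx.
  have tail : (\int[mu]_(x in O) (t x)%:E <= q%:E)%E.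
    by apply: le_trans tail0 _; rewrite lee_fin ge_min lexx.
  apply: (@le_trans _ _ ((2 `^ p)%:E * (q%:E + (q + q)%:E))%E).
    rewrite lee_wpmul2l ?lee_fin ?powR_ge0//; apply: leeD => //.
    by apply: le_trans uS _; rewrite lee_fin.
  rewrite -EFinD -EFinM lee_fin /q le_eqVlt; apply/orP; left; apply/eqP.
  by field; rewrite gt_eqF// powR_gt0.
exists n, G; split.
- by move=> j; exact: mean_zero_sum.
- split=> j x.
    move=> Sx; rewrite /G big1// => i /eqP Ji.
    have Ei : ~ E i x by move=> /ES; rewrite Ji.
    rewrite /H indicE memNset// mulr0 add0r big1// => l _.
    have [->|/phi_adj/adjS il] := eqVneq (phi i l) 0; first by rewrite mul0r.
    rewrite mul0r sub0r indicE memNset ?mul0r ?oppr0 ?mulr0// => /il.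
    by rewrite Ji.
  move=> Ox; have EN k : \1_(E k) x = 0 :> R.
    by rewrite indicE memNset// => /(cell_family_sub EO).
  rewrite /G big1// => i _; rewrite /H EN mulr0 add0r big1// => l _.
  by rewrite !EN !mul0r subr0 mulr0.
- move=> j x nj; rewrite /G big1// => i /eqP Ji.
  by move: (Jn i); rewrite Ji ltnNge nj.
- exact: bound1.
- exact: bound2.
Qed.

End stage.

Lemma cvg_sum_ord (R : realType) (m : nat) (u : 'I_m -> R^nat) (l : 'I_m -> R) :
  (forall j, u j @ \oo --> l j) ->
  \sum_(j < m) u j k @[k --> \oo] --> \sum_(j < m) l j.
Proof.
move=> ul; apply: cvg_big => // -[x y].
by apply: cvgD; [exact: cvg_fst|exact: cvg_snd].
Qed.

(** * Iteration of the stages *)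

Section double_series.
Variables (R : realType) (G : nat -> nat -> R) (N : nat -> nat) (f r : R).
Hypothesis G_N : forall i j, (N i <= j)%N -> G i j = 0.

Lemma sum_support_le i m : \sum_(j < m) `|G i j| <= \sum_(j < N i) `|G i j|.
Proof.
have [mN|Nm] := leqP m (N i).
  rewrite (big_ord_widen (N i) (fun j => `|G i j|) mN) [leLHS]big_mkcond/=.
  by apply: ler_sum => j _; case: ifP.
rewrite (big_ord_widen m (fun j => `|G i j|) (ltnW Nm)) [leRHS]big_mkcond/=.
apply: ler_sum => j _; case: ltnP => // Nj.
by rewrite G_N// normr0.
Qed.

Lemma sum_support_eq i m : (N i <= m)%N ->
  \sum_(j < m) G i j = \sum_(j < N i) G i j.
Proof.
move=> Nm; rewrite (big_ord_widen m (fun j => G i j) Nm) [RHS]big_mkcond/=.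
by apply: eq_bigr => j _; case: ltnP => // Nj; rewrite G_N.
Qed.

Hypothesis sum_le : forall K, \sum_(i < K) \sum_(j < N i) `|G i j| <= r.

Let col j := [sequence \sum_(i < K) G i j]_K.

Lemma double_series_is_cvg j : cvgn (col j).
Proof.
have : cvgn [normed series (G ^~ j)].
  apply: nondecreasing_is_cvgn.
    by apply/nondecreasing_series => i _ _; exact: normr_ge0.
  exists r => _ [K _ <-]; apply: le_trans (sum_le K).
  change (\sum_(0 <= i < K) `|G i j| <= \sum_(i < K) \sum_(l < N i) `|G i l|).
  rewrite big_mkord; apply: ler_sum => i _.
  apply: le_trans (sum_support_le i j.+1).
  by rewrite big_ord_recr/= lerDr sumr_ge0.
move/normed_cvg; rewrite (_ : series _ = col j)//.
by apply/funext => K; rewrite /series/= big_mkord.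
Qed.

Lemma double_series_abs_le m : \sum_(j < m) `|limn (col j)| <= r.
Proof.
have cv : \sum_(j < m) `|col j K| @[K --> \oo] --> \sum_(j < m) `|limn (col j)|.
  apply: cvg_sum_ord => j; apply: cvg_norm; exact: double_series_is_cvg.
rewrite -(cvg_lim (@Rhausdorff R) cv); apply: limr_le.
  by apply/cvg_ex; exists (\sum_(j < m) `|limn (col j)|).
near=> K; apply: le_trans (sum_le K).
apply: (@le_trans _ _ (\sum_(i < K) \sum_(j < m) `|G i j|)).
  by rewrite exchange_big/=; apply: ler_sum => j _; exact: ler_norm_sum.
by apply: ler_sum => i _; exact: sum_support_le.
Unshelve. all: by end_near. Qed.

Hypothesis residual_cvg :
  f - \sum_(i < K) \sum_(j < N i) G i j @[K --> \oo] --> (0 : R).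

(** Rows are stages and columns are Whitney cubes. Summation by rows converges to [f] by the
    residual hypothesis, and absolute summability allows summation by columns. *)
Lemma double_series_cvg : \sum_(0 <= j < m) limn (col j) @[m --> \oo] --> f.
Proof.
pose s := series (fun i => \sum_(j < N i) `|G i j|).
have sE K : s K = \sum_(i < K) \sum_(j < N i) `|G i j| by rewrite /s /series/= big_mkord.
have s_nd : nondecreasing_seq s.
  by apply/nondecreasing_series => i _ _; rewrite sumr_ge0.
have s_cvg : cvgn s.
  by apply: nondecreasing_is_cvgn => //; exists r => _ [K _ <-]; rewrite sE.
apply/cvgrPdist_le => e e0.
have e2 : 0 < e / 2 by rewrite divr_gt0.
have [K _ HK] : \forall K \near \oo, `|f - \sum_(i < K) \sum_(j < N i) G i j| <= e / 2
    /\ limn s - s K <= e / 2.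
  near=> K; split.
    rewrite -[X in `|X|]subr0 distrC; near: K.
    by move/cvgrPdist_le : residual_cvg => /(_ _ e2).
  apply: le_trans (ler_norm _) _; near: K.
  by move/cvgrPdist_le : s_cvg => /(_ _ e2).
have [HK1 HK2] := HK K (leqnn K).
(* Beyond this bound the first [K] rows are complete, so only the absolute tail of the later rows
   remains. *)
exists (\max_(i < K) N i)%N => // m /= Nm.
rewrite big_mkord.
have cv : f - \sum_(j < m) col j L @[L --> \oo] --> f - \sum_(j < m) limn (col j).
  apply: cvgB; first exact: cvg_cst.
  by apply: cvg_sum_ord => j; exact: double_series_is_cvg.
rewrite -(cvg_lim (@Rhausdorff R) (cvg_norm cv)); apply: limr_le.
  by apply/cvg_ex; exists `|f - \sum_(j < m) limn (col j)|; exact: cvg_norm.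
exists K => // L /= KL.
rewrite exchange_big/= (_ : \sum_(i < L) _ = \sum_(i < K) \sum_(j < N i) G i j +
   \sum_(K <= i < L) \sum_(j < m) G i j); last first.
  rewrite -(big_mkord xpredT (fun i => \sum_(j < m) G i j)) (big_cat_nat (leq0n K) KL)/=.
  congr (_ + _); rewrite big_mkord; apply: eq_bigr => i _.
  by apply: sum_support_eq; apply: leq_trans Nm; exact: leq_bigmax.
rewrite opprD addrA (splitr e); apply: le_trans (ler_normB _ _) (lerD HK1 _).
apply: le_trans HK2; apply: le_trans (ler_norm_sum _ _ _) _.
apply: (@le_trans _ _ (s L - s K)); last first.
  by rewrite lerD2r; exact: nondecreasing_cvgn_le.
rewrite /s sub_series_geq//; apply: ler_sum => i _.
by apply: le_trans (ler_norm_sum _ _ _) (sum_support_le _ _).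
Unshelve. all: by end_near. Qed.

End double_series.

(** Jensen for weights of total mass at most 1: Young is applied to each [y k] against the power
    [p - 1] of the weighted sum. *)
Lemma weighted_powR_sum (R : realType) (p : R) (K : nat) (w y : 'I_K -> R) :
  1 < p -> (forall k, 0 <= w k) -> (forall k, 0 <= y k) -> \sum_k w k <= 1 ->
  (\sum_k w k * y k) `^ p <= \sum_k w k * y k `^ p.
Proof.
move=> p1 w0 y0 w1; set s := \sum_k _.
have p0 : 0 < p by lra.
have s0 : 0 <= s by rewrite sumr_ge0// => k _; rewrite mulr_ge0.
have : s * s `^ (p - 1) <= p^-1 * \sum_k w k * y k `^ p + (1 - p^-1) * s `^ p.
  rewrite {1}/s mulr_suml.
  apply: (@le_trans _ _ (\sum_k w k * (p^-1 * y k `^ p + (1 - p^-1) * s `^ p))).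
    by apply: ler_sum => k _; rewrite -mulrA ler_wpM2l// young_powR_pred.
  under eq_bigr do rewrite mulrDr.
  rewrite big_split/= mulr_sumr; apply: lerD.
    by apply: ler_sum => k _; rewrite mulrCA.
  rewrite -mulr_suml ler_piMl// mulr_ge0 ?powR_ge0// subr_ge0.
  by rewrite invf_le1// ltW.
rewrite mulr_powRB1// -lerBlDr -{1}[s `^ p]mul1r -mulrBl.
have -> : 1 - (1 - p^-1) = p^-1 by ring.
by rewrite ler_pM2l// invr_gt0.
Qed.

Section iteration.
Context d (T : measurableType d) (R : realType).
Variables (mu : {measure set T -> \bar R}) (O : set T) (S : nat -> set T).
Variables (W : T -> R) (p C1 : R).
Hypotheses (mO : measurable O) (muO : (mu O < +oo)%E) (p1 : 1 < p) (C1_ge0 : 0 <= C1).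
Hypotheses (mW : measurable_fun O W) (W_gt0 : forall x, O x -> 0 < W x).
Hypothesis S_lb : forall j, exists2 w, 0 < w & forall x, S j x -> O x -> w <= W x.

Let Lp_mean_zero (g : T -> R) : Prop := [/\ measurable_fun O g,
  (\int[mu]_(x in O) (`|g x| `^ p)%:E < +oo)%E & (\int[mu]_(x in O) (g x)%:E = 0)%E].

Hypothesis stage : forall (g : T -> R) (e : R), Lp_mean_zero g -> 0 < e ->
  exists (n : nat) (G : nat -> T -> R),
  [/\ forall j, mean_zero mu (G j),
      (forall j x, ~ S j x -> G j x = 0) /\ (forall j x, ~ O x -> G j x = 0),
      forall j x, (n <= j)%N -> G j x = 0,
      (\int[mu]_(x in O) (((\sum_(j < n) `|G j x|) * W x) `^ p)%:E <=
        C1%:E * \int[mu]_(x in O) (`|g x| `^ p)%:E)%E &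
      (\int[mu]_(x in O) (`|g x - \sum_(j < n) G j x| `^ p)%:E <= e%:E)%E].

Lemma mean_zero_integral (h : T -> R) : mean_zero mu h -> (forall x, ~ O x -> h x = 0) ->
  mu.-integrable O (EFin \o h) /\ (\int[mu]_(x in O) (h x)%:E = 0)%E.
Proof.
move=> [ih h0] hO; split; first exact: integrableS ih.
rewrite -h0 [LHS]integral_mkcond; apply: eq_integral => x _.
by rewrite patchE; case: ifPn => //; rewrite notin_setE => /hO ->.
Qed.

Lemma Lp0_residual (g : T -> R) (n : nat) (G : nat -> T -> R) (e : R) : Lp_mean_zero g ->
  (forall j, mean_zero mu (G j)) -> (forall j x, ~ O x -> G j x = 0) ->
  (\int[mu]_(x in O) (`|g x - \sum_(j < n) G j x| `^ p)%:E <= e%:E)%E ->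
  Lp_mean_zero (fun x => g x - \sum_(j < n) G j x).
Proof.
move=> [mg gp g0] mG GO ge.
have [iG G0] : mu.-integrable O (EFin \o (fun x => \sum_(j < n) G j x)) /\
    (\int[mu]_(x in O) (\sum_(j < n) G j x)%:E = 0)%E.
  apply: mean_zero_integral; first exact: mean_zero_sum.
  by move=> x Ox; rewrite big1// => j _; exact: GO.
have ig : mu.-integrable O (EFin \o g).
  have UO : \bigcup_(k in [set: nat]) O = O by rewrite bigcup_const//; exists 0%N.
  exact: (Lp_integrable (fun=> mO) UO muO p1 mg gp).
split.
- apply: measurable_funB => //; apply/measurable_EFinP; exact: measurable_int iG.
- by apply: le_lt_trans ge _; rewrite ltry.
- under eq_integral do rewrite EFinB.
  by rewrite (integralB mO ig iG) g0 G0 subee.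
Qed.

(* The ratio [(2 `^ p) ^- 2] beats the factor [(2 `^ p) ^+ k] lost at stage [k]
   when the stages are summed by the weighted Jensen inequality with weights
   [2 ^- k.+1]. *)
Lemma approximation_sequence (f : T -> R) (I : R) : Lp_mean_zero f -> 0 < I ->
  (\int[mu]_(x in O) (`|f x| `^ p)%:E <= I%:E)%E ->
  let th := (2 `^ p) ^- 2 in
  exists (N : nat -> nat) (G : nat -> nat -> T -> R), forall i,
  [/\ forall j, mean_zero mu (G i j),
      (forall j x, ~ S j x -> G i j x = 0) /\ (forall j x, ~ O x -> G i j x = 0),
      forall j x, (N i <= j)%N -> G i j x = 0,
      (\int[mu]_(x in O) (((\sum_(j < N i) `|G i j x|) * W x) `^ p)%:E <=
        (C1 * (th ^+ i * I))%:E)%E &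
      measurable_fun O (fun x => f x - \sum_(k < i) \sum_(j < N k) G k j x) /\
      (\int[mu]_(x in O) (`|f x - \sum_(k < i) \sum_(j < N k) G k j x| `^ p)%:E
        <= (th ^+ i * I)%:E)%E].
Proof.
move=> Lf I0 fI th.
have th0 : 0 < th by rewrite invr_gt0 exprn_gt0// powR_gt0.
pose small (kg : nat * (T -> R)) := Lp_mean_zero kg.2 /\
  (\int[mu]_(x in O) (`|kg.2 x| `^ p)%:E <= (th ^+ kg.1 * I)%:E)%E.
(* The conclusion is conditional on [small], so that [choice] applies to all pairs; the stage number
   in the pair fixes the tolerance. *)
have H (kg : nat * (T -> R)) : exists nG : nat * (nat -> T -> R), small kg ->
  [/\ forall j, mean_zero mu (nG.2 j),
      (forall j x, ~ S j x -> nG.2 j x = 0) /\ (forall j x, ~ O x -> nG.2 j x = 0),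
      forall j x, (nG.1 <= j)%N -> nG.2 j x = 0,
      (\int[mu]_(x in O) (((\sum_(j < nG.1) `|nG.2 j x|) * W x) `^ p)%:E <=
        C1%:E * \int[mu]_(x in O) (`|kg.2 x| `^ p)%:E)%E &
      (\int[mu]_(x in O) (`|kg.2 x - \sum_(j < nG.1) nG.2 j x| `^ p)%:E <=
         (th ^+ kg.1.+1 * I)%:E)%E].
  have [[Lg sg]|ns] := pselect (small kg); last by exists (0%N, fun _ _ => 0) => /ns.
  have e0 : 0 < th ^+ kg.1.+1 * I by rewrite mulr_gt0// exprn_gt0.
  have [n [G HG]] := stage Lg e0.
  by exists (n, G).
have [F HF] := choice H.
pose g := fix g k : T -> R := if k is k'.+1 then
  (fun x => g k' x - \sum_(j < (F (k', g k')).1) (F (k', g k')).2 j x) else f.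
have sm k : small (k, g k).
  elim: k => [|k IH]; first by split; rewrite // expr0 mul1r.
  have [m0 [_ mO0] _ _ le] := HF _ IH; split => //.
  exact: Lp0_residual IH.1 m0 mO0 le.
pose N k := (F (k, g k)).1; pose G k := (F (k, g k)).2.
have gE k x : g k x = f x - \sum_(i < k) \sum_(j < N i) G i j x.
  elim: k => [|k IH]; first by rewrite big_ord0 subr0.
  by rewrite big_ord_recr/= opprD addrA -IH.
exists N, G => i; have [m0 s0 n0 le _] := HF _ (sm i).
have [[mg _ _] /= sg] := sm i; split; [exact: m0|exact: s0|exact: n0| |].
- by apply: le_trans le _; rewrite EFinM lee_wpmul2l ?lee_fin.
- have <- : g i = (fun x => f x - \sum_(k < i) \sum_(j < N k) G k j x).
    by apply/funext => x; rewrite gE.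
  split; first exact: mg.
  by under eq_integral do rewrite -gE.
Qed.

Lemma geometric_series_integrable (u : nat -> T -> R) (e : R) : 0 <= e ->
  (forall i, measurable_fun O (u i)) -> (forall i x, 0 <= u i x) ->
  (forall i, (\int[mu]_(x in O) (u i x)%:E <= (e / (2 ^ i.+1)%:R)%:E)%E) ->
  mu.-integrable O (fun x => \sum_(i <oo) (u i x)%:E)%E /\
  (\int[mu]_(x in O) (\sum_(i <oo) (u i x)%:E) <= e%:E)%E.
Proof.
move=> e0 mu_ u0 ue.
have mU i : measurable_fun O (fun x => (u i x)%:E) by exact/measurable_EFinP.
have U0 x : (0 <= \sum_(i <oo) (u i x)%:E)%E.
  by apply: nneseries_ge0 => i _ _; rewrite lee_fin.
have le : (\int[mu]_(x in O) (\sum_(i <oo) (u i x)%:E) <= e%:E)%E.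
  rewrite integral_nneseries//; last by move=> i x _; rewrite lee_fin.
  apply: le_trans (epsilon_trick0 xpredT e0).
  apply: lee_nneseries => i _; last exact: ue.
  by move=> _; apply: integral_ge0 => x _; rewrite lee_fin.
split=> //; apply/integrableP; split.
  apply: (ge0_emeasurable_sum (P := xpredT)) => //.
  by move=> i x _ _; rewrite lee_fin.
apply: le_lt_trans (ltry e); apply: le_trans le.
by under eq_integral do rewrite gee0_abs//.
Qed.

Lemma partial_sum_le_series (u : nat -> R) (K : nat) : (forall i, 0 <= u i) ->
  (\sum_(i <oo) (u i)%:E)%E \is a fin_num ->
  \sum_(i < K) u i <= fine (\sum_(i <oo) (u i)%:E)%E.
Proof.
move=> u0 uf; rewrite -lee_fin fineK// -sumEFin -(big_mkord xpredT (fun i => (u i)%:E)).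
by apply: nneseries_lim_ge => i _ _; rewrite lee_fin.
Qed.

Lemma series_powR_cvg0 (u : nat -> R) : 
  (\sum_(i <oo) (`|u i| `^ p)%:E)%E \is a fin_num -> u @ \oo --> (0 : R).
Proof.
move=> uf; have p0 : 0 < p := lt_trans ltr01 p1.
have c : cvgn (series (fun i => `|u i| `^ p)).
  apply: nondecreasing_is_cvgn.
    by apply/nondecreasing_series => i _ _; exact: powR_ge0.
  exists (fine (\sum_(i <oo) (`|u i| `^ p)%:E)%E) => _ [K _ <-].
  rewrite /series/= big_mkord; apply: (partial_sum_le_series K (u := fun i => `|u i| `^ p)) => //.
have := cvg_series_cvg_0 c => /cvgrPdist_lt h.
apply/cvgrPdist_lt => e e0.
have := h (e `^ p); rewrite powR_gt0// => /(_ isT).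
apply: filterS => i; rewrite !sub0r !normrN ger0_norm ?powR_ge0//.
by rewrite ltNge => /negP H; rewrite ltNge; apply/negP => le; apply: H;
  rewrite ge0_ler_powR ?nnegrE ?(ltW p0) ?(ltW e0).
Qed.

(** [I] is assumed positive because each stage needs a positive tolerance. *)
Lemma iteration_pos (f : T -> R) (I : R) : Lp_mean_zero f -> 0 < I ->
  (\int[mu]_(x in O) (`|f x| `^ p)%:E <= I%:E)%E ->
  exists F : nat -> T -> R,
  [/\ forall j, measurable_fun setT (F j),
      forall j x, ~ S j x -> F j x = 0,
      forall j, mean_zero mu (F j),
      {ae mu, forall x, O x -> \sum_(0 <= j < m) F j x @[m --> \oo] --> f x} &
      forall m, (\int[mu]_(x in O) (((\sum_(j < m) `|F j x|) * W x) `^ p)%:E <=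
        (2 `^ p * C1 * I)%:E)%E].
Proof.
move=> Lf I0 fI; have [N [G HG]] := approximation_sequence Lf I0 fI.
have p0 : 0 < p := lt_trans ltr01 p1.
pose a : R := 2 `^ p.
have a2 : 2 <= a.
  rewrite -{1}[2 : R]powRr1 ?ler_powR ?(ltW p1)//.
  by rewrite (_ : 1 = 1%:R)// ler_nat.
have mG i j : measurable_fun O (G i j).
  have [/(_ j)[iG _] _ _ _ _] := HG i.
  apply: (@measurable_funS _ _ _ _ setT) => //.
  by apply/measurable_EFinP; exact: measurable_int iG.
pose s i x := (\sum_(j < N i) `|G i j x|) * W x.
pose q i : R := 2 ^+ i.+1.
have q0 i : 0 < q i by rewrite exprn_gt0.
(* The weights [(q i)^-1] have sum below 1, so by Jensen the series of the [t i] dominates the power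
   [p] of the sum of the [s i]. *)
pose t i x := (q i)^-1 * (q i * s i x) `^ p.
pose res i x := f x - \sum_(k < i) \sum_(j < N k) G k j x.
have t0 i x : 0 <= t i x by rewrite mulr_ge0 ?powR_ge0 ?invr_ge0 ?(ltW (q0 i)).
have s0 i x : O x -> 0 <= s i x.
  by move=> Ox; rewrite mulr_ge0 ?sumr_ge0// (ltW (W_gt0 Ox)).
have ms i : measurable_fun O (s i).
  apply: measurable_funM => //; apply: measurable_sum => j.
  by apply: measurableT_comp (mG i j); exact: normr_measurable.
have msp i : measurable_fun O (fun x => s i x `^ p).
  exact: (measurableT_comp (measurable_powR p) (ms i)).
have qp i : q i `^ p = a ^+ i.+1.
  by rewrite /q -powR_mulrn// -powRrM mulrC powRrM powR_mulrn ?powR_ge0.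
have tE i x : O x -> t i x = ((q i)^-1 * a ^+ i.+1) * s i x `^ p.
  by move=> Ox; rewrite /t powRM ?(ltW (q0 i)) ?s0// qp mulrA.
have mt i : measurable_fun O (t i).
  apply: (eq_measurable_fun (fun x => ((q i)^-1 * a ^+ i.+1) * s i x `^ p)).
    by move=> x /set_mem Ox; rewrite tE.
  by apply: measurable_funM => //; exact: measurable_cst.
have c0 i : 0 <= (q i)^-1 * a ^+ i.+1.
  by rewrite mulr_ge0 ?invr_ge0 ?(ltW (q0 i))// exprn_ge0// powR_ge0.
have aC0 : 0 <= a * C1 * I by rewrite !mulr_ge0 ?powR_ge0// ltW.
have a0 : 0 < a by exact: powR_gt0.
have a1 : 1 <= a by apply: le_trans a2; rewrite ler1n.
have ath i : a ^+ i.+1 * (a ^- 2) ^+ i <= a.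
  rewrite exprS -mulrA -exprMn ler_piMr ?(ltW a0)//.
  apply: exprn_ile1.
    by rewrite mulr_ge0 ?invr_ge0 ?exprn_ge0 ?(ltW a0).
  by rewrite ler_pdivrMr ?exprn_gt0// mul1r expr2 ler_peMl ?(ltW a0).
have [iT1 T1le] : mu.-integrable O (fun x => \sum_(i <oo) (t i x)%:E)%E /\
    (\int[mu]_(x in O) (\sum_(i <oo) (t i x)%:E) <= (a * C1 * I)%:E)%E.
  apply: geometric_series_integrable => // i.
  rewrite (eq_integral (fun x => ((q i)^-1 * a ^+ i.+1)%:E * (s i x `^ p)%:E)%E); last first.
    by move=> x /set_mem Ox; rewrite tE// EFinM.
  rewrite ge0_integralZl_EFin//; last 2 first.
  - by move=> x _; rewrite lee_fin powR_ge0.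
  - exact/measurable_EFinP.
  have [_ _ _ le _] := HG i.
  apply: le_trans (lee_wpmul2l _ le) _; first by rewrite lee_fin.
  rewrite -EFinM lee_fin natrX -/(q i).
  rewrite [leRHS]mulrC -!mulrA ler_wpM2l ?invr_ge0 ?(ltW (q0 i))//.
  rewrite -/a [C1 * _]mulrCA [leLHS]mulrA.
  by apply: ler_wpM2r (ath i); rewrite mulr_ge0 ?(ltW I0).
have mres i : measurable_fun O (fun x => `|res i x| `^ p).
  by apply: measurable_abs_powR; have [_ _ _ _ []] := HG i.
(* Summable integrals of the residuals give a summable series at almost every point, hence residuals
   tending to 0 there without passing to a subsequence. *)
have [iT2 _] : mu.-integrable O (fun x => \sum_(i <oo) (`|res i x| `^ p)%:E)%E /\
    (\int[mu]_(x in O) (\sum_(i <oo) (`|res i x| `^ p)%:E) <= (2 * I)%:E)%E.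
  apply: geometric_series_integrable => [|//|i x|i]; first by rewrite mulr_ge0// ltW.
    exact: powR_ge0.
  have [_ _ _ _ [_ le]] := HG i; apply: le_trans le _; rewrite lee_fin.
  have -> : 2 * I / (2 ^ i.+1)%:R = (2^-1) ^+ i * I.
    by rewrite natrX exprS exprVn; field; rewrite expf_neq0.
  rewrite ler_wpM2r ?(ltW I0)//; apply: lerXn2r; rewrite ?nnegrE ?invr_ge0//.
  rewrite lef_pV2 ?posrE ?exprn_gt0// -/a expr2.
  by apply: le_trans a2 _; rewrite ler_peMr ?(ltW a0).
pose T1 x := (\sum_(i <oo) (t i x)%:E)%E.
pose T2 x := (\sum_(i <oo) (`|res i x| `^ p)%:E)%E.
have s_le x K : O x -> T1 x \is a fin_num -> (\sum_(i < K) s i x) `^ p <= fine (T1 x).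
  move=> Ox T1x; apply: le_trans (partial_sum_le_series K _ T1x); last by [].
  rewrite (_ : \sum_(i < K) s i x = \sum_(i < K) (q i)^-1 * (q i * s i x)); last first.
    by apply: eq_bigr => i _; rewrite mulKf// gt_eqF.
  apply: weighted_powR_sum => //.
  - by move=> i; rewrite invr_ge0 (ltW (q0 _)).
  - by move=> i; rewrite mulr_ge0 ?s0// (ltW (q0 _)).
  have -> : \sum_(i < K) (q i)^-1 = 1 - 2 ^- K.
    elim: K => [|K IH]; first by rewrite big_ord0 expr0 invr1 subrr.
    by rewrite big_ord_recr/= IH /q exprS; field; rewrite expf_neq0.
  by rewrite gerBl invr_ge0 exprn_ge0.
have sG_le x K : O x -> T1 x \is a fin_num ->
    \sum_(i < K) \sum_(j < N i) `|G i j x| <= fine (T1 x) `^ p^-1 / W x.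
  move=> Ox T1x; rewrite ler_pdivlMr ?W_gt0// mulr_suml.
  have S0 : 0 <= \sum_(i < K) s i x by apply: sumr_ge0 => i _; exact: s0.
  rewrite -[leLHS](powRr1 S0) -(mulfV (lt0r_neq0 p0)) powRrM.
  apply: ge0_ler_powR; rewrite ?nnegrE ?powR_ge0 ?invr_ge0 ?(ltW p0)//.
    by rewrite fine_ge0//; apply: nneseries_ge0 => i _ _; rewrite lee_fin.
  exact: s_le.
pose B := O `&` [set x | T1 x \is a fin_num] `&` (O `&` [set x | T2 x \is a fin_num]).
have mB : measurable B.
  by apply: measurableI; apply: emeasurable_fin_num => //;
    [exact: measurable_int iT1|exact: measurable_int iT2].
have aeB : {ae mu, forall x, O x -> B x}.
  have := integrable_ae mO iT1; have := integrable_ae mO iT2.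
  by apply: filterS2 => x h2 h1 Ox; split; split => //; [exact: h1|exact: h2].
have GN x i j : (N i <= j)%N -> G i j x = 0 by have [_ _ + _ _] := HG i; apply.
have GO i j x : ~ O x -> G i j x = 0 by have [_ [_ +] _ _ _] := HG i; apply.
have GS i j x : ~ S j x -> G i j x = 0 by have [_ [+ _] _ _ _] := HG i; apply.
have sumG_le x : B x -> forall K, \sum_(i < K) \sum_(j < N i) `|G i j x| <=
    fine (T1 x) `^ p^-1 / W x.
  by move=> [[Ox T1x] _] K; exact: sG_le.
(* The indicator of [B], where both series are finite, makes [F j] measurable on the whole space and
   zero outside [O]. *)
pose F j x := \1_B x * limn (fun K => \sum_(i < K) G i j x).
have FB j x : B x -> F j x = limn (fun K => \sum_(i < K) G i j x).
  by move=> Bx; rewrite /F indicE mem_set// mul1r.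
have FnB j x : ~ B x -> F j x = 0 by move=> Bx; rewrite /F indicE memNset// mul0r.
have G_cvg j x : B x -> \sum_(i < K) G i j x @[K --> \oo] --> F j x.
  move=> Bx; rewrite FB//.
  exact: (double_series_is_cvg (G := fun i j => G i j x) (GN x) (sumG_le x Bx)).
have mGT i j : measurable_fun setT (G i j).
  have [/(_ j)[iG _] _ _ _ _] := HG i.
  by apply/measurable_EFinP; exact: measurable_int iG.
have mF j : measurable_fun setT (F j).
  apply: (measurable_fun_cvg (h := fun K x => \1_B x * \sum_(i < K) G i j x)).
    by move=> K; apply: measurable_funM => //; exact: measurable_sum.
  move=> x _; have [Bx|nB] := pselect (B x).
    by rewrite indicE mem_set//; under eq_cvg do rewrite mul1r; exact: G_cvg.
  rewrite FnB// indicE memNset//; under eq_cvg do rewrite mul0r.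
  exact: cvg_cst.
have F0S j x : ~ S j x -> F j x = 0.
  move=> Sx; rewrite /F; under eq_fun do under eq_bigr do rewrite GS//.
  under eq_fun do rewrite big1//.
  by rewrite lim_cst// mulr0.
have mz j : mean_zero mu (F j).
  have [w w0 Sw] := S_lb j.
  (* Dominating function for the partial sums of column [j]: on [S j] they are at most the root of
     order [p] of [T1], divided by [W], with [W >= w], and such a root is at most [1 + T1]. *)
  pose g x := ((w^-1)%:E * (1 + T1 x))%E.
  have ig : mu.-integrable O g.
    apply: integrableZl => //; apply: integrableD => //.
    apply/integrableP; split; first exact: measurable_cst.
    by rewrite (integral_cst mu mO `|1|%E) lte_mul_pinfty// normr1.
  have T1_0 x : (0 <= T1 x)%E by apply: nneseries_ge0 => i _ _; rewrite lee_fin.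
  have dom x K : O x -> (`|(\sum_(i < K) G i j x)%:E| <= g x)%E.
    move=> Ox; have [T1x|] := boolP (T1 x \is a fin_num); last first.
      rewrite ge0_fin_numE// -leNgt leye_eq => /eqP T1x.
      by rewrite /g T1x addey// gt0_muley ?lte_fin ?invr_gt0// leey.
    have T1f0 : 0 <= fine (T1 x) by rewrite fine_ge0.
    rewrite /g -(fineK T1x) -EFinD -EFinM lee_fin.
    have [Sx|nS] := pselect (S j x); last first.
      rewrite big1; last by move=> i _; exact: GS.
      by rewrite normr0 mulr_ge0 ?invr_ge0 ?(ltW w0)// addr_ge0.
    apply: le_trans (ler_norm_sum _ _ _) _.
    apply: (@le_trans _ _ (fine (T1 x) `^ p^-1 / W x)).
      apply: le_trans (sG_le x K Ox T1x); apply: ler_sum => i _.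
      apply: le_trans (sum_support_le (G := fun i j => G i j x) (GN x) i j.+1).
      by rewrite big_ord_recr/= lerDr sumr_ge0.
    rewrite mulrC; apply: ler_pM; rewrite ?invr_ge0 ?powR_ge0 ?(ltW (W_gt0 Ox))//.
      by rewrite lef_pV2 ?posrE ?W_gt0// Sw.
    apply: le_trans (ler_1D_powR p1 (powR_ge0 _ _)) _.
    by rewrite -powRrM mulVf ?gt_eqF// powRr1.
  pose u K x := (\sum_(i < K) G i j x)%:E.
  have mu_ K : measurable_fun O (u K).
    by apply/measurable_EFinP/measurable_sum => i; exact: mG.
  have mFj : measurable_fun O (EFin \o F j).
    by apply/measurable_EFinP; exact: measurable_funTS.
  have uF : {ae mu, forall x, O x -> u ^~ x @ \oo --> (EFin \o F j) x}.
    apply: filterS aeB => x OB Ox; apply/fine_cvgP; split; first exact: nearW.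
    exact: G_cvg (OB Ox).
  have ug : {ae mu, forall x K, O x -> (`|u K x| <= g x)%E}.
    by apply: aeW => x K Ox; exact: dom.
  have [iF _ cF] := dominated_convergence mO mu_ mFj uF ig ug.
  have u0 K : (\int[mu]_(x in O) u K x = 0)%E.
    have : mean_zero mu (fun x => \sum_(i < K) G i j x).
      by apply: mean_zero_sum => i; have [/(_ j)] := HG i.
    move/mean_zero_integral => [|//] x Ox; rewrite big1// => i _; exact: GO.
  have F_O : (EFin \o F j) \_ O = EFin \o F j.
    apply/funext => x; rewrite patchE; case: ifPn => //; rewrite notin_setE => Ox.
    by rewrite /= FnB// => -[[]].
  split.
    by move/(integrable_mkcond _ mO) : iF; rewrite F_O.
  move: cF; rewrite (_ : [sequence _]_K = cst 0%E); last by apply/funext => K; exact: u0.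
  move=> cF; have := cvg_unique (@ereal_hausdorff R) cF (cvg_cst 0%E).
  by rewrite integral_mkcond F_O; apply.
have F_le x m : B x -> ((\sum_(j < m) `|F j x|) * W x) `^ p <= fine (T1 x).
  move=> Bx; have Ox : O x by case: Bx => -[].
  have T1x : T1 x \is a fin_num by case: Bx => -[].
  have T1f0 : 0 <= fine (T1 x).
    by rewrite fine_ge0//; apply: nneseries_ge0 => i _ _; rewrite lee_fin.
  rewrite -[leRHS](powRr1 T1f0) -(mulVf (lt0r_neq0 p0)) powRrM.
  apply: ge0_ler_powR; rewrite ?nnegrE ?powR_ge0 ?(ltW p0)//.
    by rewrite mulr_ge0 ?(ltW (W_gt0 Ox))// sumr_ge0.
  rewrite -ler_pdivlMr ?W_gt0//; under eq_bigr do rewrite FB//.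
  exact: (double_series_abs_le (G := fun i j => G i j x) (GN x) (sumG_le x Bx)).
exists F; split => //.
- apply: filterS aeB => x OB Ox; have Bx := OB Ox.
  under eq_cvg do under eq_bigr do rewrite FB//.
  apply: (double_series_cvg (G := fun i j => G i j x) (f := f x) (GN x) (sumG_le x Bx)).
  by apply: series_powR_cvg0; case: Bx => _ [].
- move=> m; apply: le_trans T1le.
  apply: ae_ge0_le_integral => //.
  + by move=> x _; rewrite lee_fin powR_ge0.
  + apply/measurable_EFinP; apply: (measurableT_comp (measurable_powR p)).
    apply: measurable_funM => //; apply: measurable_sum => j.
    by apply: measurableT_comp; [exact: normr_measurable|exact: measurable_funTS].
  + by move=> x _; apply: nneseries_ge0 => i _ _; rewrite lee_fin.
  + exact: measurable_int iT1.
  + apply: filterS aeB => x OB Ox; have Bx := OB Ox.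
    have T1x : T1 x \is a fin_num by case: Bx => -[].
    by rewrite -/(T1 x) -(fineK T1x) lee_fin F_le.
Qed.

Lemma iteration (f : T -> R) : Lp_mean_zero f -> exists F : nat -> T -> R,
  [/\ forall j, measurable_fun setT (F j),
      forall j x, ~ S j x -> F j x = 0,
      forall j, mean_zero mu (F j),
      {ae mu, forall x, O x -> \sum_(0 <= j < m) F j x @[m --> \oo] --> f x} &
      forall m, (\int[mu]_(x in O) (((\sum_(j < m) `|F j x|) * W x) `^ p)%:E <=
        (2 `^ p * C1)%:E * \int[mu]_(x in O) (`|f x| `^ p)%:E)%E].
Proof.
move=> Lf; have [mf fp _] := Lf; have p0 : 0 < p := lt_trans ltr01 p1.
have I_ge0 : (0 <= \int[mu]_(x in O) (`|f x| `^ p)%:E)%E.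
  by apply: integral_ge0 => x _; rewrite lee_fin powR_ge0.
have If : (\int[mu]_(x in O) (`|f x| `^ p)%:E)%E \is a fin_num by rewrite ge0_fin_numE.
rewrite -(fineK If) -EFinM; set I := fine _.
(* When [I = 0] the function vanishes almost everywhere and the zero decomposition serves. *)
have [I0|I0] := eqVneq I 0; last first.
  apply: iteration_pos => //; last by rewrite fineK.
  by rewrite lt_neqAle eq_sym I0 fine_ge0.
have f0 : {ae mu, forall x, O x -> f x = 0}.
  have mfp : measurable_fun O (fun x => (`|f x| `^ p)%:E).
    by apply/measurable_EFinP; exact: measurable_abs_powR.
  have : ae_eq mu O (fun x => (`|f x| `^ p)%:E) (cst 0%E).
    apply/(ae_eq_integral_abs mu mO mfp).
    under eq_integral do rewrite gee0_abs ?lee_fin ?powR_ge0//.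
    by rewrite -(fineK If) -/I I0.
  apply: filterS => x fx Ox; have [/eqP] := fx Ox.
  by rewrite powR_eq0 => /andP[/eqP/normr0_eq0].
exists (fun _ _ => 0); split => //.
- by move=> j; split; [exact: integrable0|rewrite integral0].
- apply: filterS f0 => x fx Ox; rewrite (fx Ox).
  by under eq_cvg do rewrite big1//; exact: cvg_cst.
- move=> m; under eq_integral do rewrite normr0 sumr_const mul0rn mul0r powR0 ?gt_eqF//.
  by rewrite integral0 lee_fin I0 mulr0.
Qed.

End iteration.

(** * The decomposition adapted to a Whitney family *)

(* [weight] is not known to be measurable. *)
Lemma ge0_le_integral_nonmeasurable d (T : measurableType d) (R : realType)
    (mu : {measure set T -> \bar R}) (D : set T) (f g : T -> \bar R) :
  (forall x, D x -> 0 <= f x)%E -> (forall x, D x -> f x <= g x)%E ->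
  (\int[mu]_(x in D) f x <= \int[mu]_(x in D) g x)%E.
Proof.
move=> f0 fg; have g0 x : D x -> (0 <= g x)%E.
  by move=> Dx; exact: le_trans (f0 x Dx) (fg x Dx).
rewrite !ge0_integralE//; apply: ge_ereal_sup => _ [h hf <-]; apply: ereal_sup_ubound;
  exists h => // x.
apply: le_trans (hf x) _; rewrite !patchE; case: ifPn => // /set_mem; exact: fg.
Qed.

Lemma sum_powR_le (R : realType) (p : R) (m : nat) (a : 'I_m -> R) : 1 < p ->
  (forall j, 0 <= a j) -> \sum_j a j `^ p <= (\sum_j a j) `^ p.
Proof.
move=> p1 a0; have p0 : 0 < p := lt_trans ltr01 p1.
have s0 : 0 <= \sum_j a j by exact: sumr_ge0.
rewrite -[leRHS]mulr_powRB1// mulr_suml; apply: ler_sum => j _.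
rewrite -[leLHS]mulr_powRB1//; apply: ler_wpM2l => //.
apply: ge0_ler_powR; rewrite ?nnegrE ?subr_ge0 ?(ltW p1)//.
by rewrite (bigD1 j)//= lerDl sumr_ge0.
Qed.

Lemma bdist_ge0 (R : realType) (n : nat) (Omega : set 'rV[R]_n) x : 0 <= bdist Omega x.
Proof.
rewrite /bdist; set D := [set _ | _ in _].
have [->|/set0P D0] := eqVneq D set0; first by rewrite inf0.
by apply: lb_le_inf => // _ [z _ <-]; exact: sqrtr_ge0.
Qed.

Section decomposition.
Variables (R : realType) (n : nat) (Omega : set 'rV[R]_n).
Variables (x0 : 'rV[R]_n) (gamma : R -> 'rV[R]_n -> 'rV[R]_n).
Variables (c : nat -> 'rV[R]_n) (s : nat -> R).
Hypotheses (n_gt0 : (0 < n)%N) (oO : open Omega) (bO : bounded_set Omega).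
Hypotheses (Ox0 : Omega x0) (pf : path_family Omega x0 gamma).
Hypothesis wh : whitney Omega x0 c s.

(** Joint measurability gives measurability at a fixed time by taking sections. *)
Lemma path_family_coord_measurable (r : R) (i : 'I_n) : 0 <= r <= 1 ->
  measurable_fun (Omega : set (Rn R n)) (fun y : Rn R n => gamma r y ord0 i).
Proof.
move=> r01 mO; have [_ [mgamma _] _ _] := pf.
apply: (measurability _ (RGenOInfty.measurableE R)) => // _ [_ [a ->] <-].
have oU : open [set z : 'rV[R]_n | a < z ord0 i].
  have := @open_comp _ _ (fun z : 'rV[R]_n => z ord0 i) [set x | a < x].
  apply; [by move=> z _; exact: coord_continuous|exact: open_gt].
have := measurable_xsection r (mgamma _ oU).
congr (measurable _); apply/seteqP; split => y.
  rewrite /xsection/= in_setE/= => -[[_ Oy] ay]; split => //=.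
  by rewrite in_itv/= andbT.
case=> Oy /=; rewrite in_itv/= andbT => ay.
rewrite /xsection/= in_setE/=; split=> //.
Qed.

Lemma weight_ge0 x : 0 <= weight Omega gamma x.
Proof. by rewrite /weight fine_ge0. Qed.

(** [W] is the measurable step weight and does not depend on [p] or [f]. The constant [500 * n ^ 2]
    is [5 * n * M] with [M = 100 * n]. *)
Lemma whitney_decomposition : exists W : Rn R n -> R,
  [/\ measurable_fun (Omega : set (Rn R n)) W, forall x, Omega x -> 0 < W x,
      forall x, Omega x -> 0 < weight Omega gamma x,
      forall x, Omega x -> bdist Omega x ^+ n / weight Omega gamma x <=
        (500 * n%:R ^+ 2) ^+ n * W x &
      forall (p : R) (f : Rn R n -> R), 1 < p -> Lp0 Omega p f ->
      exists F : nat -> Rn R n -> R,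
      [/\ forall j, measurable_fun setT (F j),
          forall j x, ~ cube (c j) (3 / 2 * s j) x -> F j x = 0,
          forall j, mean_zero leb (F j),
          {ae leb, forall x : Rn R n, Omega x ->
            \sum_(0 <= j < m) F j x @[m --> \oo] --> f x} &
          forall m, (\int[leb]_(x in (Omega : set (Rn R n))) (((\sum_(j < m) `|F j x|) * W x) `^
            p)%:E <=
            (2 `^ p * stage_constant p)%:E * \int[leb]_(x in Omega) (`|f x| `^ p)%:E)%E]].
Proof.
pose M := (100 * n)%N; have M_gt0 : (0 < M)%N by rewrite muln_gt0.
have M_ge : (100 * n <= M)%N by [].
have [J [b [cube_sub cube_cover cube_dis]]] := whitney_subdivision wh M_gt0.
pose E : nat -> set (Rn R n) := cell s M J b.
have mE k : measurable (E k) by exact: measurable_cell.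
have tE : trivIset setT E by exact: cell_trivIset.
have EO : \bigcup_k E k = Omega by exact: cell_cover.
have mO : measurable (Omega : set (Rn R n)) by exact: measurable_cell_family mE EO.
have muO : (leb (Omega : set (Rn R n)) < +oo)%E by exact: leb_bounded.
have v0 k : 0 < fine (leb (E k)) by exact: (leb_cell_gt0 wh M_gt0 cube_dis).
have [r0 Er0] : exists r0, E r0 x0 by move: Ox0; rewrite -EO => -[r0 _]; exists r0.
have [pin _ _ _] := pf.
have flow N0 eta : (r0 < N0)%N -> 0 < eta ->
    exists N (m : 'I_N -> 'I_N -> R) (Mass lost : 'I_N -> R),
    [/\ (N0 <= N)%N,
        (forall k l, 0 <= m k l) /\ (forall k l, m k l != 0 -> adj c s M J b k l),
        [/\ forall k, 0 <= lost k, forall k, lost k <= fine (leb (E k)) &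
            \sum_k lost k <= eta],
        (forall k, Mass k = fine (leb (E k)) + \sum_l m l k) /\
        (forall k, \sum_l m k l = if val k == r0 then 0 else Mass k - lost k) &
        forall (k : 'I_N) x, E k x -> Mass k <= weight Omega gamma x].
  apply: (discrete_flow (x0 := x0) muO mO EO _ mE) => //.
  - by move=> x k l; exact: cell_inj.
  - by move=> y Oy; have [] := pin y Oy.
  - by move=> y Oy; have [] := pin y Oy.
  - by move=> r y r01 Oy; have [_ + _ _] := pin y Oy; apply; rewrite in_itv.
  - move=> r k r01.
    exact: (@measurable_cell_preimage R n s M J b _ (Rn R n) Omega (gamma r) k mO
      (fun i => path_family_coord_measurable i r01)).
  - by move=> y Oy; exact: (path_adj_fine n_gt0 oO wh M_gt0 cube_sub M_ge (pin y Oy)).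
  - by move=> y r k x Oy r01 yk xk;
    exact: (cell_gdist_path oO wh M_gt0 cube_sub cube_cover M_ge r01 yk xk).
(* The flow shows this itself: cell [k] injects its own volume, and its throughput is at most the
   weight. *)
have weight_ge k x : E k x -> fine (leb (E k)) <= weight Omega gamma x.
  move=> Ex; have [|N [m [Mass [lost [N0 [m0 _] _ [ME _] le]]]]] :=
    flow (maxn k r0).+1 1 _ ltr01; first by rewrite ltnS leq_maxr.
  have kN : (k < N)%N by apply: leq_trans N0; rewrite ltnS leq_maxl.
  apply: le_trans (le (Ordinal kN) x Ex); rewrite ME lerDl.
  by apply: sumr_ge0 => l _; exact: m0.
pose wt k := inf [set weight Omega gamma x | x in E k].
have E_neq0 k : E k !=set0.
  apply/set0P/eqP => Ek; have := v0 k.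
  by rewrite Ek measure0 ltxx.
have wt_ge k (r : R) : (forall x, E k x -> r <= weight Omega gamma x) -> r <= wt k.
  move=> H; apply: lb_le_inf => [|_ [x Ex <-]]; last exact: H.
  by have [x Ex] := E_neq0 k; exists (weight Omega gamma x), x.
have wt_le k x : E k x -> wt k <= weight Omega gamma x.
  move=> Ex; apply: ge_inf; last by exists x.
  by exists 0 => _ [y _ <-]; exact: weight_ge0.
have v_le_wt k : fine (leb (E k)) <= wt k by apply: wt_ge => x; exact: weight_ge.
have wt0 k : 0 < wt k by exact: lt_le_trans (v0 k) (v_le_wt k).
pose W := step_weight leb E wt.
have WE k x : E k x -> W x = fine (leb (E k)) / wt k.
  by move=> Ex; rewrite /W /step_weight (cell_indexE tE Ex).
pose V := fine (leb (Omega : set (Rn R n))).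
have weight_le_V x : weight Omega gamma x <= V.
  have wO : [set y | Omega y /\ (gdist_path Omega (gamma^~ y) x <=
    (bdist Omega x / 2)%:E)%E] `<=` Omega by move=> y [].
  have le := le_lebesgue_outer wO.
  rewrite /weight /V fine_le// ge0_fin_numE// ?lebesgue_outer_ge0//.
  exact: le_lt_trans le muO.
have V0 : 0 < V.
  by apply: lt_le_trans (weight_le_V x0); exact: lt_le_trans (v0 r0) (weight_ge _ _ Er0).
have inE x : Omega x -> exists k, E k x by rewrite -EO => -[k _]; exists k.
exists W; split.
- exact: (measurable_step mE tE EO (fun k => fine (leb (E k)) / wt k)).
- by move=> x /inE[k Ex]; rewrite (WE _ _ Ex) divr_gt0.
- by move=> x /inE[k Ex]; exact: lt_le_trans (wt0 k) (wt_le _ _ Ex).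
- move=> x /inE[k Ex]; rewrite (WE _ _ Ex).
  have w0 := lt_le_trans (wt0 k) (wt_le _ _ Ex).
  have b_le := cell_bdist_expn oO wh M_gt0 cube_sub cube_cover cube_dis Ex.
  have -> : 500 * n%:R ^+ 2 = 5 * n%:R * M%:R :> R by rewrite /M natrM; ring.
  rewrite mulrA; apply: ler_pM => //.
  + by rewrite exprn_ge0 ?bdist_ge0.
  + by rewrite invr_ge0 ltW.
  + by rewrite lef_pV2 ?posrE// wt_le.
- move=> p f p1 [mf fp f0].
  pose S : nat -> set (Rn R n) := fun j => cube (c j) (3 / 2 * s j).
  have ES k : E k `<=` S (J k).
    move=> x Ex; have sJ := whitney_side_gt0 wh (J k).
    apply/cubeE; first by rewrite mulr_ge0// ltW.
    by apply: le_trans (cell_dist wh cube_sub Ex) _; lra.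
  have adjS k l : adj c s M J b k l -> E l `<=` S (J k) by move/asboolP.
  have p0 : 0 < p := lt_trans ltr01 p1.
  have C_ge0 : 0 <= stage_constant p.
    by rewrite mulr_ge0 ?addr_ge0 ?mulr_ge0 ?powR_ge0 ?invr_ge0 ?subr_ge0 ?(ltW p1).
  have mW : measurable_fun (Omega : set (Rn R n)) W.
    exact: (measurable_step mE tE EO (fun k => fine (leb (E k)) / wt k)).
  have W_gt0 x : Omega x -> 0 < W x.
    by move=> /inE[k Ex]; rewrite (WE _ _ Ex) divr_gt0.
  have S_lb j : exists2 w, 0 < w & forall x, S j x -> Omega x -> w <= W x.
    have sj := whitney_side_gt0 wh j.
    have K0 : 0 < (5 * n%:R * M%:R) ^+ n :> R by rewrite exprn_gt0// !mulr_gt0// ltr0n.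
    (* On the cube of side [3 / 2 * s j] one has [bdist >= s j / 4], which bounds the cell volume
       from below, while the weight is at most the measure [V] of [Omega]. *)
    exists ((s j / 4) ^+ n / (5 * n%:R * M%:R) ^+ n / V).
      by rewrite divr_gt0// divr_gt0// exprn_gt0// divr_gt0.
    move=> x Sx /[dup] Ox /inE[k Ex]; rewrite (WE _ _ Ex).
    apply: ler_pM; rewrite ?invr_ge0 ?(ltW V0)//.
    - by rewrite divr_ge0 ?(ltW K0)// exprn_ge0// divr_ge0// ltW.
    - rewrite ler_pdivrMr// [leRHS]mulrC.
      apply: le_trans (cell_bdist_expn oO wh M_gt0 cube_sub cube_cover cube_dis Ex).
      apply: lerXn2r; rewrite ?nnegrE ?divr_ge0 ?(ltW sj) ?bdist_ge0//.
      apply: le_trans (whitney_bdist_ge oO wh j Ox).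
      have : `|x - c j| <= 3 / 2 * s j / 2.
        by apply/cubeE => //; rewrite mulr_ge0 ?(ltW sj).
      by lra.
    - by rewrite lef_pV2 ?posrE// (le_trans (wt_le _ _ Ex)).
  apply: (@iteration _ _ _ leb _ S W p _ mO muO p1 C_ge0 mW W_gt0 S_lb) => // g e [mg gp g0] e0.
  apply: (stage mE tE EO muO p1 ES adjS v0 v_le_wt (r0 := r0)) => //.
  move=> N0 eta h1 h2; have [N [m [Mass [lost [? ? ? ? le]]]]] := flow N0 eta h1 h2.
  exists N, m, Mass, lost; split => // k; apply: wt_ge => x; exact: le.
Qed.

End decomposition.

(** * From the bound on the sum of the pieces to the norms of the pieces *)

Section decomposition_norms.
Context d (T : measurableType d) (R : realType).
Variables (mu : {measure set T -> \bar R}) (O : set T) (F : nat -> T -> R) (p : R).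
Hypotheses (mO : measurable O) (mF : forall j, measurable_fun setT (F j)) (p1 : 1 < p).

Let mFO (D : set T) j : measurable_fun D (fun x => `|F j x|).
Proof. by apply: measurable_funTS; exact: measurableT_comp. Qed.

Lemma sum_integral_powR_le (Q : nat -> set T) (W : T -> R) (a : \bar R) :
  (forall j, measurable (Q j)) -> (forall j, Q j `<=` O) ->
  measurable_fun O W -> (forall x, O x -> 0 <= W x) ->
  (forall m, \int[mu]_(x in O) (((\sum_(j < m) `|F j x|) * W x) `^ p)%:E <= a)%E ->
  (\sum_(0 <= j <oo) \int[mu]_(x in Q j) ((`|F j x| * W x) `^ p)%:E <= a)%E.
Proof.
move=> mQ QO mW W0 le.
have mFW j : measurable_fun O (fun x => ((`|F j x| * W x) `^ p)%:E).
  apply/measurable_EFinP; apply: (measurableT_comp (measurable_powR p)).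
  exact: measurable_funM.
apply: lime_le.
  by apply: is_cvg_nneseries => j _ _; apply: integral_ge0 => x _; rewrite lee_fin powR_ge0.
apply: nearW => m; rewrite big_mkord; apply: le_trans (le m).
apply: (@le_trans _ _ (\sum_(j < m) \int[mu]_(x in O) ((`|F j x| * W x) `^ p)%:E)%E).
  apply: lee_sum => j _; apply: ge0_subset_integral => //.
  by move=> x _; rewrite lee_fin powR_ge0.
rewrite -ge0_integral_sum//; last by move=> j x _; rewrite lee_fin powR_ge0.
apply: ge0_le_integral => //.
- by move=> x _; apply: sume_ge0 => j _; rewrite lee_fin powR_ge0.
- exact: emeasurable_sum.
- apply/measurable_EFinP; apply: (measurableT_comp (measurable_powR p)).
  by apply: measurable_funM => //; exact: measurable_sum.
- move=> x Ox; rewrite sumEFin lee_fin mulr_suml; apply: sum_powR_le => // j.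
  by rewrite mulr_ge0 ?W0.
Qed.

Section weighted_series.
Variables (Q : nat -> set T) (W : T -> R) (a : \bar R).
Hypotheses (mQ : forall j, measurable (Q j)) (QO : forall j, Q j `<=` O).
Hypotheses (mW : measurable_fun O W) (W_gt0 : forall x, O x -> 0 < W x).
Hypothesis sum_le : forall m,
  (\int[mu]_(x in O) (((\sum_(j < m) `|F j x|) * W x) `^ p)%:E <= a)%E.

Let measurable_FW j : measurable_fun (Q j) (fun x => (`|F j x| * W x) `^ p).
Proof.
apply: (measurableT_comp (measurable_powR p)); apply: measurable_funM => //.
exact: measurable_funS mW.
Qed.

Let series_integral_le (k : R) (h : nat -> T -> R) : 0 <= k ->
  (forall j x, 0 <= h j x) ->
  (forall j, \int[mu]_(x in Q j) (h j x)%:E <=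
    \int[mu]_(x in Q j) (k * (`|F j x| * W x) `^ p)%:E)%E ->
  (\sum_(0 <= j <oo) \int[mu]_(x in Q j) (h j x)%:E <= k%:E * a)%E.
Proof.
move=> k0 h0 hle.
have W0 x : O x -> 0 <= W x by move/W_gt0/ltW.
apply: le_trans (lee_wpmul2l _ (sum_integral_powR_le mQ QO mW W0 sum_le)); last by rewrite lee_fin.
rewrite -nneseriesZl; last first.
  by move=> j _; apply: integral_ge0 => x _; rewrite lee_fin powR_ge0.
apply: lee_nneseries => j _.
  by move=> _; apply: integral_ge0 => x _; rewrite lee_fin.
apply: le_trans (hle j) _; under eq_integral do rewrite EFinM.
rewrite ge0_integralZl_EFin//; first by move=> x _; rewrite lee_fin powR_ge0.
by apply/measurable_EFinP; exact: measurable_FW.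
Qed.

Lemma series_weighted_integral_le (k : R) (rho : T -> R) : 0 <= k ->
  (forall x, O x -> 0 <= rho x <= k * W x) ->
  (\sum_(0 <= j <oo) \int[mu]_(x in Q j) (`|F j x| `^ p * rho x `^ p)%:E <=
    (k `^ p)%:E * a)%E.
Proof.
move=> k0 rhoW; apply: series_integral_le; first exact: powR_ge0.
  by move=> j x; rewrite mulr_ge0 ?powR_ge0.
move=> j; apply: ge0_le_integral_nonmeasurable => x /QO Ox.
  by rewrite lee_fin mulr_ge0 ?powR_ge0.
have W0 := ltW (W_gt0 Ox); have /andP[r0 rW] := rhoW x Ox.
rewrite lee_fin powRM// mulrCA ler_wpM2l ?powR_ge0// -powRM//.
by apply: ge0_ler_powR; rewrite ?nnegrE ?mulr_ge0// ltW// (lt_trans ltr01).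
Qed.

Lemma series_integral_powR_le (k : R) : 0 <= k ->
  {ae mu, forall x, O x -> 1 <= k * W x} ->
  (\sum_(0 <= j <oo) \int[mu]_(x in Q j) (`|F j x| `^ p)%:E <= (k `^ p)%:E * a)%E.
Proof.
move=> k0 kW; apply: series_integral_le; first exact: powR_ge0.
  by move=> j x; exact: powR_ge0.
move=> j; apply: ae_ge0_le_integral => //.
- by apply/measurable_EFinP; apply: (measurableT_comp (measurable_powR p)).
- by move=> x _; rewrite lee_fin mulr_ge0 ?powR_ge0.
- by apply/measurable_EFinP; apply: measurable_funM => //; exact: measurable_cst.
apply: filterS kW => x kW /QO Ox; have W0 := ltW (W_gt0 Ox).
rewrite lee_fin powRM// mulrCA ler_peMr ?powR_ge0// -powRM//.
rewrite -[leLHS](_ : 1 `^ p = 1); last by rewrite powR1.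
by rewrite ge0_ler_powR ?nnegrE ?mulr_ge0 ?kW// ltW// (lt_trans ltr01).
Qed.

End weighted_series.

Lemma integral_support (Q : set T) (f : T -> \bar R) : Q `<=` O ->
  (forall x, ~ Q x -> f x = 0%E) ->
  (\int[mu]_(x in O) f x = \int[mu]_(x in Q) f x)%E.
Proof.
move=> QO f0; rewrite integral_mkcond [RHS]integral_mkcond; apply: eq_integral => x _.
rewrite !patchE; case: ifPn; case: ifPn => //.
  by rewrite notin_setE => /f0.
by move=> /set_mem/QO Ox; rewrite notin_setE.
Qed.

(** At each point at most [N] pieces are nonzero, and each is bounded by the root of order [p] of
    the full series of powers. *)
Lemma overlap_integral_le (f : T -> R) (S : nat -> set T) (N : nat) :
  (0 < N)%N -> measurable_fun O f -> (forall j x, ~ S j x -> F j x = 0) ->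
  (forall x m, (\sum_(j < m) `[< S j x >] <= N)%N) ->
  {ae mu, forall x, O x -> \sum_(0 <= j < m) F j x @[m --> \oo] --> f x} ->
  (\int[mu]_(x in O) (`|f x| `^ p)%:E <=
    (N%:R `^ p)%:E * \sum_(0 <= j <oo) \int[mu]_(x in O) (`|F j x| `^ p)%:E)%E.
Proof.
move=> N0 mf F0 SN cv; have p0 : 0 < p := lt_trans ltr01 p1.
have mFp j : measurable_fun O (fun x => (`|F j x| `^ p)%:E).
  by apply/measurable_EFinP; apply: (measurableT_comp (measurable_powR p)).
have Fp0 j x : (0 <= (`|F j x| `^ p)%:E)%E by rewrite lee_fin powR_ge0.
pose V x := (\sum_(0 <= j <oo) (`|F j x| `^ p)%:E)%E.
have V0 x : (0 <= V x)%E by exact: nneseries_ge0.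
have mV : measurable_fun O V.
  by apply: (ge0_emeasurable_sum (P := xpredT)).
rewrite -integral_nneseries// -ge0_integralZl_EFin ?powR_ge0//; last by move=> x _; exact: V0.
apply: ae_ge0_le_integral => //.
- by apply/measurable_EFinP; exact: measurable_abs_powR.
- by move=> x _; rewrite mule_ge0 ?lee_fin ?powR_ge0//; exact: V0.
- by apply: emeasurable_funM => //; exact: measurable_cst.
apply: filterS cv => x cv Ox; rewrite -/(V x).
have [Vx|] := boolP (V x \is a fin_num); last first.
  rewrite ge0_fin_numE// -leNgt leye_eq => /eqP ->.
  by rewrite gt0_muley ?leey// lte_fin powR_gt0// ltr0n.
have fV0 : 0 <= fine (V x) by exact: fine_ge0.
set r := fine (V x) `^ p^-1.
have rp : r `^ p = fine (V x) by rewrite -powRrM mulVf ?gt_eqF// powRr1.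
have Fr j : `|F j x| <= r.
  have : `|F j x| `^ p <= r `^ p.
    have := @partial_sum_le_series _ (fun j => `|F j x| `^ p) j.+1 _ Vx.
    rewrite rp => /(_ (fun i => powR_ge0 _ _)); apply: le_trans.
    by rewrite big_ord_recr/= lerDr sumr_ge0// => i _; exact: powR_ge0.
  by rewrite !leNgt; apply: contra => h; apply: gt0_ltr_powR; rewrite ?nnegrE ?powR_ge0.
have le : `|f x| <= N%:R * r.
  have cvx : `|\sum_(0 <= j < m) F j x| @[m --> \oo] --> `|f x|.
    exact: cvg_norm (cv Ox).
  rewrite -(cvg_lim (@Rhausdorff R) cvx); apply: limr_le.
    by apply/cvg_ex; exists `|f x|.
  apply: nearW => m; rewrite big_mkord; apply: le_trans (ler_norm_sum _ _ _) _.
  apply: (@le_trans _ _ (\sum_(j < m) (`[< S j x >] : nat)%:R * r)).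
    apply: ler_sum => j _; case: asboolP => Sx; first by rewrite mul1r.
    by rewrite F0// normr0 mul0r.
  by rewrite -mulr_suml ler_wpM2r ?powR_ge0// -natr_sum ler_nat.
rewrite -(fineK Vx) -EFinM lee_fin -rp -powRM ?powR_ge0//.
by apply: ge0_ler_powR; rewrite ?nnegrE ?mulr_ge0 ?powR_ge0 ?(ltW p0).
Qed.

End decomposition_norms.

Theorem proposition4p2 (R : realType) (n : nat) (Omega : set 'rV[R]_n)
    (x0 : 'rV[R]_n) (gamma : R -> 'rV[R]_n -> 'rV[R]_n) (p : R) :
  (2 <= n)%N ->
  open Omega -> connected Omega -> Omega !=set0 -> bounded_set Omega ->
  Omega x0 -> path_family Omega x0 gamma ->
  1 < p ->
  exists2 C : R, 0 < C &
  forall (c : nat -> 'rV[R]_n) (s : nat -> R), whitney Omega x0 c s ->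
  forall f : Rn R n -> R, Lp0 Omega p f ->
  exists F : nat -> Rn R n -> R,
    [/\ (forall j, measurable_fun setT (F j)) /\
        {ae leb, forall x : Rn R n, Omega x ->
          \sum_(0 <= j < N) F j x @[N --> \oo] --> f x},
        (forall j x, ~ cube (c j) (2 * s j) x -> F j x = 0),
        (forall j, leb.-integrable (cube (c j) (2 * s j)) (EFin \o F j) /\
          (\int[leb]_(x in cube (c j) (2 * s j)) (F j x)%:E = 0)%E),
        (\sum_(0 <= j <oo) \int[leb]_(x in cube (c j) (2 * s j))
            (`|F j x| `^ p *
              (bdist Omega x ^+ n / weight Omega gamma x) `^ p)%:E
          <= C%:E * \int[leb]_(x in Omega) (`|f x| `^ p)%:E)%E &
        (exists2 K : R, 0 < K & {ae leb, forall x : Rn R n, Omega x ->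
            weight Omega gamma x <= K * bdist Omega x ^+ n}) ->
        ((C^-1)%:E * \int[leb]_(x in Omega) (`|f x| `^ p)%:E
          <= \sum_(0 <= j <oo) \int[leb]_(x in cube (c j) (2 * s j))
               (`|F j x| `^ p)%:E)%E /\
        (\sum_(0 <= j <oo) \int[leb]_(x in cube (c j) (2 * s j))
            (`|F j x| `^ p)%:E
          <= C%:E * \int[leb]_(x in Omega) (`|f x| `^ p)%:E)%E].
Proof.
move=> n2 oO _ _ bO Ox0 pf p1.
have n_gt0 : (0 < n)%N by exact: ltnW.
have p0 : 0 < p := lt_trans ltr01 p1.
pose comparable (K : R) := {ae leb, forall x : Rn R n, Omega x ->
  weight Omega gamma x <= K * bdist Omega x ^+ n}.
(* [C] has to be fixed before the comparability assumption is made, so a comparison constant is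
   selected by excluded middle; it depends on [Omega] and [gamma] only. *)
have [K1 K1_gt0 K1P] : exists2 K1 : R, 0 < K1 &
    (exists2 K : R, 0 < K & comparable K) -> comparable K1.
  have [[K K0 KP]|nK] := pselect (exists2 K : R, 0 < K & comparable K).
    by exists K.
  by exists 1 => // /nK.
have [K0 K0_gt0 K0E] : exists2 K0 : R, 0 < K0 & K0 = (500 * n%:R ^+ 2) ^+ n.
  exists ((500 * n%:R ^+ 2) ^+ n) => [|//]; apply: exprn_gt0; apply: mulr_gt0.
    by rewrite (ltr0n R 500).
  by apply: exprn_gt0; rewrite ltr0n.
pose C2 := 2 `^ p * stage_constant p.
(* [N] is the overlap bound, and [C] adds one constant for each of the three inequalities. *)
pose N := ((55 * n) ^ n)%N; pose C := K0 `^ p * C2 + (K0 * K1) `^ p * C2 + N%:R `^ p.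
have N_gt0 : (0 < N)%N by rewrite expn_gt0 muln_gt0 n_gt0.
have C2_ge0 : 0 <= C2.
  by rewrite !mulr_ge0 ?addr_ge0 ?mulr_ge0 ?powR_ge0 ?invr_ge0 ?subr_ge0 ?(ltW p1).
have Np_gt0 : 0 < N%:R `^ p :> R by rewrite powR_gt0// ltr0n.
have C_gt0 : 0 < C by rewrite ltr_wpDl// addr_ge0// mulr_ge0// powR_ge0.
exists C => // c s wh f Lf; have [mf fp _] := Lf.
have [W [mW W_gt0 w_gt0 W_ge dec]] := whitney_decomposition n_gt0 oO bO Ox0 pf wh.
rewrite -K0E in W_ge.
have [F [mF FS mz cv le]] := dec p f p1 Lf.
pose Q j : set (Rn R n) := cube (c j) (2 * s j).
have mQ j : measurable (Q j) by exact: measurable_cube.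
have QO j : Q j `<=` Omega by have [_ _ _ + _] := wh => /(_ j)[].
have mO : measurable (Omega : set (Rn R n)).
  have [_ -> _ _ _] := wh; apply: bigcup_measurable => j _; exact: measurable_cube.
have SQ j : cube (c j) (3 / 2 * s j) `<=` Q j.
  have sj := whitney_side_gt0 wh j.
  by move=> x Sx i; apply: le_trans (Sx i) _; lra.
have F0 j x : ~ Q j x -> F j x = 0 by move=> Qx; apply: FS => /SQ.
set I := (\int[leb]_(x in Omega) (`|f x| `^ p)%:E)%E.
have I_ge0 : (0 <= I)%E by apply: integral_ge0 => x _; rewrite lee_fin powR_ge0.
have C_ge k : k <= C -> (k%:E * I <= C%:E * I)%E.
  by move=> kC; apply: lee_wpmul2r => //; rewrite lee_fin.
have C_le (k : R) : ((k `^ p)%:E * (C2%:E * I) = (k `^ p * C2)%:E * I)%E.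
  by rewrite muleA EFinM.
have a1 : 0 <= K0 `^ p * C2 by rewrite mulr_ge0 ?powR_ge0.
have a2 : 0 <= (K0 * K1) `^ p * C2 by rewrite mulr_ge0 ?powR_ge0.
exists F; split; [by split|exact: F0| | |].
- move=> j; have [iF F00] := mz j; split; first exact: (integrableS measurableT (mQ j) _ iF).
  rewrite -F00 [RHS](@integral_support _ _ _ leb setT (Q j)) => // x Qx.
  by rewrite F0.
- apply: le_trans (series_weighted_integral_le mO mF p1 mQ QO mW W_gt0 le (ltW K0_gt0) _) _.
    by move=> x Ox; rewrite W_ge// andbT divr_ge0 ?exprn_ge0 ?bdist_ge0 ?weight_ge0.
  by rewrite C_le; apply: C_ge; rewrite /C -addrA lerDl addr_ge0// ltW.
move=> /K1P cmp; split.
- have := overlap_integral_le mO mF p1 N_gt0 mf FS (fun x m => whitney_overlap n_gt0 oO wh x m) cv.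
  have -> : (\sum_(0 <= j <oo) \int[leb]_(x in (Omega : set (Rn R n))) (`|F j x| `^ p)%:E =
     \sum_(0 <= j <oo) \int[leb]_(x in Q j) (`|F j x| `^ p)%:E)%E.
    apply: eq_eseriesr => j _; apply: (integral_support leb (QO j)) => x Qx.
    by rewrite F0// normr0 powR0 ?gt_eqF.
  set Z := (\sum_(0 <= j <oo) _)%E => leZ.
  rewrite lee_pdivrMl//; apply: le_trans leZ _; apply: lee_wpmul2r.
    by apply: nneseries_ge0 => j _ _; apply: integral_ge0 => x _; rewrite lee_fin powR_ge0.
  by rewrite lee_fin /C lerDr addr_ge0.
- have K01 : 0 <= K0 * K1 by rewrite mulr_ge0 ?(ltW K0_gt0) ?(ltW K1_gt0).
  apply: le_trans (series_integral_powR_le mO mF p1 mQ QO mW W_gt0 le K01 _) _.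
    apply: filterS cmp => x cmp Ox.
    have := W_ge x Ox; have := cmp Ox; have := w_gt0 x Ox => w0 wb.
    rewrite ler_pdivrMr// => bW.
    have : weight Omega gamma x * 1 <= weight Omega gamma x * (K0 * K1 * W x).
      rewrite mulr1; apply: le_trans wb _.
      rewrite (_ : weight _ _ _ * _ = K1 * (K0 * W x * weight Omega gamma x)); last by ring.
      by rewrite ler_wpM2l ?(ltW K1_gt0).
    by rewrite ler_pM2l.
  rewrite C_le; apply: C_ge; rewrite /C addrAC lerDr.
  by rewrite addr_ge0// ltW.
Qed.
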